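(* Let $Q=(0,\infty)\times(0,\infty)$. Let $u_0\in\mathcal S([0,\infty))$, $g_0\in C^\infty([0,\infty))$, and $f\in C^\infty(\overline Q)$, with $f(\cdot,t)\in\mathcal S([0,\infty))$ with respect to $x$, uniformly for $t$ in compact subsets of $[0,\infty)$. Assume in addition that $u_0(0)=g_0(0)$ and $u_0''(0)+f(0,0)=g_0'(0)$. Let $U(x,t)$ be defined for $x>0$, $t>0$ by the unified transform formula $$2\pi U(x,t)=\int_{-\infty}^{\infty}e^{i\lambda x-\lambda^2t}\hat u_0(\lambda)\,d\lambda-\int_\gamma e^{i\lambda x-\lambda^2t}\hat u_0(-\lambda)\,d\lambda-\int_\gamma e^{i\lambda x-\lambda^2t}\,2i\lambda\,\widetilde g_0(\lambda,t)\,d\lambda$$ $$\qquad\qquad+\int_{-\infty}^{\infty}e^{i\lambda x-\lambda^2t}\,\widetilde{\hat f}(\lambda,t)\,d\lambda-\int_\gamma e^{i\lambda x-\lambda^2t}\,\widetilde{\hat f}(-\lambda,t)\,d\lambda$$ (notation in the context). Then $U$ is the unique solution of the problem $$U_t-U_{xx}=f\ \text{ in }Q,\qquad \lim_{t\to0^+}U(x,t)=u_0(x)\ (x>0),\qquad \lim_{x\to0^+}U(x,t)=g_0(t)\ (t>0)\qquad(\ast)$$ in the following sense. Suppose that $V(x,t)$ satisfies the following: (i) $V$ is a $C^2$ function in $\overline Q\setminus\{(0,0)\}$ and solves $(\ast)$; (ii) for every $t>0$, $\lim_{x\to\infty}V(x,t)=0$ and $\sup_{x\ge1}|V_x(x,t)|<\infty$;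 (iii) for every $T>0$ there is a positive function $B_T$ on $(0,\infty)$ with $\int_0^\infty B_T(x)\,dx<+\infty$ such that $|V(x,t)|^2\le B_T(x)$ and $|V_t(x,t)|^2\le B_T(x)$ for all $x>0$ and $0<t\le T$. Then $V\equiv U$.
   Context: Functions are complex-valued. $\mathcal S([0,\infty))$ is the space of $C^\infty$ functions $\varphi$ on $[0,\infty)$ with $\sup_{x\ge0}|x^\ell\varphi^{(k)}(x)|<\infty$ for all integers $k,\ell\ge0$. The assumption on $f$ that $f(\cdot,t)\in\mathcal S([0,\infty))$ uniformly for $t$ in compact sets means: for all integers $k,\ell\ge0$ and all $T>0$, $\sup_{x\ge0,\,0\le t\le T}|x^\ell\partial_x^k f(x,t)|<\infty$. For $\operatorname{Im}\lambda\le0$: $$\hat u_0(\lambda)=\int_0^\infty e^{-i\lambda y}u_0(y)\,dy,\qquad \hat f(\lambda,t)=\int_0^\infty e^{-i\lambda y}f(y,t)\,dy,\qquad \widetilde{\hat f}(\lambda,t)=\int_0^t e^{\lambda^2\tau}\hat f(\lambda,\tau)\,d\tau .$$ For $\lambda\in\mathbb C$: $\widetilde g_0(\lambda,t)=\int_0^t e^{\lambda^2\tau}g_0(\tau)\,d\tau$. The contour $\gamma$ is the boundary of $\{\lambda\in\mathbb C:\operatorname{Im}\lambda\ge0,\ \operatorname{Re}(\lambda^2)\le0\}$, i.e. the two rays $\arg\lambda=3\pi/4$ and $\arg\lambda=\pi/4$, oriented from $\infty e^{3\pi i/4}$ to $0$ and then to $\infty e^{i\pi/4}$ (so that the domain lies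 to the left). ''$C^2$ in $\overline Q\setminus\{(0,0)\}$'' means that $V$ and all its partial derivatives up to order 2 extend continuously from $Q$ to $\overline Q\setminus\{(0,0)\}$. *)

(* Defs.v *)
From mathcomp Require Export all_boot all_order all_algebra.
From mathcomp Require Export complex.
From mathcomp Require Export all_classical all_reals all_analysis.
Set Implicit Arguments.
Unset Strict Implicit.
Unset Printing Implicit Defensive.
Export Order.TTheory GRing.Theory Num.Theory.
Export numFieldNormedType.Exports.
#[global] Open Scope classical_set_scope.
#[global] Open Scope ring_scope.

Section ComplexValued.
Variable R : realType.
Implicit Types (u : R -> R[i]) (z : R[i]).

Definition cexp z : R[i] :=
  (expR (complex.Re z))%:C%C * (cos (complex.Im z) +i* sin (complex.Im z))%C.

(* R[i] carries no topology over R in the library: limits, derivatives and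
   integrals of R[i]-valued functions are taken componentwise. *)
Definition ccvg {T : Type} (h : T -> R[i]) (F : set_system T) (l : R[i]) : Prop :=
  (complex.Re (h s) @[s --> F] --> complex.Re l) /\
  (complex.Im (h s) @[s --> F] --> complex.Im l).

Definition ccontinuous_on {T : topologicalType} (A : set T) (h : T -> R[i]) : Prop :=
  {within A, continuous (fun s => complex.Re (h s))} /\
  {within A, continuous (fun s => complex.Im (h s))}.

Definition cint (D : set R) u : R[i] :=
  ((\int[lebesgue_measure]_(s in D) complex.Re (u s)) +i*
   (\int[lebesgue_measure]_(s in D) complex.Im (u s)))%C.

(* Derivative on the half-line [0, +oo[: the usual derivative at x > 0 and the
   right derivative at x = 0. *)
Definition hderivable (h : R -> R) (x : R) : Prop :=
  if 0 < x then derivable h x 1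
  else cvg ((h y - h 0) / y @[y --> 0^'+]).

Definition hderive (h : R -> R) (x : R) : R :=
  if 0 < x then derive1 h x
  else lim ((h y - h 0) / y @[y --> 0^'+]).

Definition chderivable u (x : R) : Prop :=
  hderivable (fun s => complex.Re (u s)) x /\
  hderivable (fun s => complex.Im (u s)) x.

Definition chderive u (x : R) : R[i] :=
  (hderive (fun s => complex.Re (u s)) x +i*
   hderive (fun s => complex.Im (u s)) x)%C.

Definition smooth_half u : Prop :=
  forall (k : nat) (x : R), 0 <= x -> chderivable (iter k chderive u) x.

Definition schwartz_half u : Prop :=
  smooth_half u /\
  forall k l : nat, exists M : R, forall x : R, 0 <= x ->
    `|x%:C%C ^+ l * iter k chderive u x| <= M%:C%C.

End ComplexValued.

Section TwoVariables.
Variable R : realType.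
Implicit Types F : R -> R -> R[i].

Definition Dx F : R -> R -> R[i] := fun x t => chderive (fun s => F s t) x.
Definition Dt F : R -> R -> R[i] := fun x t => chderive (fun s => F x s) t.

Definition partials_exist F (x t : R) : Prop :=
  chderivable (fun s => F s t) x /\ chderivable (fun s => F x s) t.

(* A word w encodes a mixed partial derivative: true for x, false for t. *)
Definition pderiv (w : seq bool) F : R -> R -> R[i] :=
  foldr (fun b G => if b then Dx G else Dt G) F w.

Definition Q : set (R * R) := [set p | 0 < p.1 /\ 0 < p.2].
Definition Qbar : set (R * R) := [set p | 0 <= p.1 /\ 0 <= p.2].

Definition smooth_Qbar F : Prop :=
  forall w : seq bool,
    (forall x t : R, 0 <= x -> 0 <= t -> partials_exist (pderiv w F) x t) /\
    ccontinuous_on Qbar (fun p => pderiv w F p.1 p.2).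

Definition schwartz_loc_unif F : Prop :=
  forall (k l : nat) (T : R), 0 < T ->
    exists M : R, forall x t : R, 0 <= x -> 0 <= t <= T ->
      `|x%:C%C ^+ l * iter k Dx F x t| <= M%:C%C.

Definition extends_continuously (A : set (R * R)) F : Prop :=
  exists G : R * R -> R[i],
    ccontinuous_on A G /\ forall p, Q p -> G p = F p.1 p.2.

Definition C2_off_corner F : Prop :=
  (forall w : seq bool, (size w <= 1)%N ->
     forall x t : R, 0 < x -> 0 < t -> partials_exist (pderiv w F) x t) /\
  (forall w : seq bool, (size w <= 2)%N ->
     extends_continuously (Qbar `\ (0, 0)) (pderiv w F)).

Definition solves_heat (f : R -> R -> R[i]) (u0 g0 : R -> R[i])
    (W : R -> R -> R[i]) : Prop :=
  [/\ forall x t : R, 0 < x -> 0 < t ->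
        [/\ partials_exist W x t, chderivable (fun s => Dx W s t) x &
            Dt W x t - Dx (Dx W) x t = f x t],
      forall x : R, 0 < x -> ccvg (fun t => W x t) 0^'+ (u0 x) &
      forall t : R, 0 < t -> ccvg (fun x => W x t) 0^'+ (g0 t)].

End TwoVariables.

Section UnifiedTransform.
Variable R : realType.
Implicit Types (f : R -> R -> R[i]) (lam : R[i]).

Definition fhat (u : R -> R[i]) lam : R[i] :=
  cint `[0, +oo[ (fun y => cexp (- 'i%C * lam * y%:C%C) * u y).

Definition ftilde (h : R -> R[i]) lam (t : R) : R[i] :=
  cint `[0, t] (fun tau => cexp (lam ^+ 2 * tau%:C%C) * h tau).

Definition fhat_tilde f lam (t : R) : R[i] :=
  ftilde (fun tau => fhat (fun y => f y tau) lam) lam t.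

Definition line_int (F : R[i] -> R[i]) : R[i] := cint setT (fun s => F s%:C%C).

(* The contour runs in along the ray arg = 3 pi / 4 and out along the ray
   arg = pi / 4; each ray is parametrised by arc length from 0. *)
Definition ray_int (theta : R) (F : R[i] -> R[i]) : R[i] :=
  cint `[0, +oo[ (fun s => F (s%:C%C * cexp ('i%C * theta%:C%C))
                           * cexp ('i%C * theta%:C%C)).

Definition gamma_int (F : R[i] -> R[i]) : R[i] :=
  ray_int (pi / 4) F - ray_int (3 * pi / 4) F.

(* For x, t > 0 and smooth rapidly decaying data every integrand below is
   absolutely integrable, so the default value of cint never occurs. *)
Definition unified_transform (u0 g0 : R -> R[i]) f (x t : R) : R[i] :=
  let E lam := cexp ('i%C * lam * x%:C%C - lam ^+ 2 * t%:C%C) in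
  line_int (fun lam => E lam * fhat u0 lam)
  - gamma_int (fun lam => E lam * fhat u0 (- lam))
  - gamma_int (fun lam => E lam * (2 * 'i%C * lam) * ftilde g0 lam t)
  + line_int (fun lam => E lam * fhat_tilde f lam t)
  - gamma_int (fun lam => E lam * fhat_tilde f (- lam) t).

End UnifiedTransform.

(* Main.v *)
(** With [K(z,s)] the heat kernel, [G(x,y,s) = K(x-y,s) - K(x+y,s)] the Dirichlet
    kernel and [h(x,s) = (x/s) K(x,s)], Fubini's theorem and a deformation of the
    contour turn the unified transform formula into
      [U(x,t) = int_0^oo u0(y) G(x,y,t) dy + int_0^t g0(r) h(x,t-r) dr
                + int_0^t int_0^oo f(y,r) G(x,y,t-r) dy dr],
    whose derivatives and limits can be computed under the integral sign.
    Conversely, if [V] satisfies (i)-(iii), then for fixed [(x,t)] the function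
    [r |-> int_0^oo V(y,r) G(x,y,t-r) dy] on [(0,t)] has, by Green's identity,
    derivative [h(x,t-r) g0(r) + int_0^oo f(y,r) G(x,y,t-r) dy]; integrating it
    from [0] to [t] represents [V(x,t)] by the same formula. *)

Require Import Defs.
From mathcomp Require Import measurable_realfun ring lra.
Set Implicit Arguments.
Unset Strict Implicit.
Unset Printing Implicit Defensive.

(** * Integration *)

(** A competitor [V] is known only through [|V|^2 <= B], so [|V|] is bounded by [1 + B] and need not
    be integrable in space. Integrals in [y] are therefore controlled by the decay [(1 + y ^+ 2)^-1]
    of the Dirichlet kernel, and [dominated] with its [weight] records this one mode of domination
    for data and competitor alike. The corner [(0, 0)] needs no estimate: Green's identity is
    applied at fixed positive times, and as [r] tends to [0] the kernel time [t - r] stays near [t],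
    so pointwise convergence of [V] suffices. The derivative in [r] extends continuously past
    [r = 0] and [r = t], because the data are frozen at negative times, [hh] vanishes at nonpositive
    times and [hPt] continues the source term; a primitive on a larger interval can then be
    subtracted. The contour is deformed by real variables only: a family of integrands whose
    parameter derivative is an exact derivative along the contour has constant integral. For a
    single ray only the real part is invariant; the imaginary parts cancel between the two mirror
    rays. *)

Section Toolkit.
Variable R : realType.
Notation mu := (@lebesgue_measure R).
Notation itg D f := (mu.-integrable D (EFin \o f)).
Implicit Types (D : set R) (f g : R -> R).

Lemma itg_measurable D f : itg D f -> measurable_fun D f.
Proof. by move=> /integrableP[/measurable_EFinP]. Qed.

Lemma itg_le D f g : measurable D -> measurable_fun D f ->
  (forall x, D x -> `|f x| <= g x) -> itg D g -> itg D f.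
Proof.
move=> mD mf fg; apply: le_integrable => //; first exact/measurable_EFinP.
by move=> x Dx /=; rewrite lee_fin (le_trans (fg x Dx)) ?ler_norm.
Qed.

Lemma itgZl D f k : measurable D -> itg D f -> itg D (fun x => k * f x).
Proof. by move=> mD fi; apply: (@integrableZl _ _ R mu D mD k (EFin \o f)). Qed.

Lemma itgD D f g : measurable D -> itg D f -> itg D g ->
  itg D (fun x => f x + g x).
Proof. by move=> mD fi gi; apply: (@integrableD _ _ R mu D mD (EFin \o f) (EFin \o g)). Qed.

Lemma itgB D f g : measurable D -> itg D f -> itg D g ->
  itg D (fun x => f x - g x).
Proof. by move=> mD fi gi; apply: (@integrableB _ _ R mu D mD (EFin \o f) (EFin \o g)). Qed.

Lemma itg_norm D f : itg D f -> itg D (fun x => `|f x|).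
Proof. by move=> fi; exact: integrable_norm. Qed.

Lemma itg_EFin D f : measurable D -> itg D f ->
  (\int[mu]_(x in D) (f x)%:E)%E = (\int[mu]_(x in D) f x)%:E.
Proof.
by move=> mD fi; rewrite /Rintegral fineK//; apply: integrable_fin_num.
Qed.

Lemma eq_itg D f g : measurable D -> (forall x, D x -> f x = g x) -> itg D f -> itg D g.
Proof.
by move=> mD fg; apply: eq_integrable => //= x /set_mem Dx; rewrite fg.
Qed.

Lemma eqRint D f g : (forall x, D x -> f x = g x) ->
  \int[mu]_(x in D) f x = \int[mu]_(x in D) g x.
Proof. by move=> fg; apply: eq_Rintegral => x /set_mem; exact: fg. Qed.

Lemma normRint_le D f g : measurable D -> measurable_fun D f ->
  (forall x, D x -> `|f x| <= g x) -> itg D g ->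
  `|\int[mu]_(x in D) f x| <= \int[mu]_(x in D) g x.
Proof.
move=> mD mf fg gi; have fi := itg_le mD mf fg gi.
apply: (@le_trans _ _ (\int[mu]_(x in D) `|f x|)).
  exact: le_normr_Rintegral.
by apply: le_Rintegral => //; exact: itg_norm.
Qed.

Lemma is_derive_under (D : set R) (f df : R -> R -> R) (a u v : R) g :
  measurable D -> u < a < v ->
  (forall x, u < x < v -> itg D (f x)) ->
  (forall x y, u < x < v -> D y -> is_derive x (1 : R) (f ^~ y) (df x y)) ->
  itg D g ->
  (forall x y, u < x < v -> D y -> `|df x y| <= g y) ->
  is_derive a (1 : R) (fun x => \int[mu]_(y in D) f x y)
    (\int[mu]_(y in D) df a y).
Proof.
move=> mD ain fi dfP gi gb.
have I x : x \in `]u, v[ -> u < x < v by rewrite in_itv.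
have d1 x y : u < x < v -> D y -> partial1of2 f x y = df x y.
  by move=> hx Dy; rewrite partial1of2E; have H := dfP _ _ hx Dy; rewrite derive_val.
have H := @cvg_differentiation_under_integral R _ _ mu f D mD a u v.
have {}H : h^-1 *: (\int[mu]_(y in D) f (h + a) y - \int[mu]_(y in D) f a y)
    @[h --> 0^'] --> \int[mu]_(y in D) partial1of2 f a y.
  apply: (H _ _ _ (fun y => `|g y|)).
  - by rewrite /= in_itv.
  - by move=> x /I; exact: fi.
  - by move=> x y /I hx Dy; have H' := dfP _ _ hx Dy; apply: ex_derive.
  - by [].
  - exact: itg_norm.
  - move=> x y /I hx Dy; rewrite d1//.
    by rewrite (le_trans (gb _ _ hx Dy)) ?ler_norm.
have -> : \int[mu]_(y in D) df a y = \int[mu]_(y in D) partial1of2 f a y.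
  by apply: eqRint => y Dy; rewrite d1.
apply: DeriveDef.
  apply/cvg_ex; exists (\int[mu]_(y in D) partial1of2 f a y).
  by under eq_fun do rewrite scaler1.
apply/cvg_lim => //.
by under eq_fun do rewrite scaler1.
Qed.

Lemma cvg_Rint_seq D (F : nat -> R -> R) f g : measurable D ->
  (forall n, measurable_fun D (F n)) ->
  (forall y, D y -> F n y @[n --> \oo] --> f y) ->
  itg D g -> (forall n y, D y -> `|F n y| <= g y) ->
  itg D f /\
  \int[mu]_(y in D) F n y @[n --> \oo] --> \int[mu]_(y in D) f y.
Proof.
move=> mD mF Ff gi Fg.
have mf : measurable_fun D (EFin \o f).
  apply/measurable_EFinP; exact: (measurable_fun_cvg mF Ff).
have Fb : {ae mu, forall y n, D y -> (`|(EFin \o F n) y| <= (EFin \o g) y)%E}.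
  by apply: aeW => y n Dy; rewrite lee_fin; exact: Fg.
have Fc : {ae mu, forall y, D y -> (EFin \o F n) y @[n --> \oo] --> (EFin \o f) y}.
  by apply: aeW => y Dy; apply: cvg_EFin; [exact: nearW|exact: Ff].
have mF' n : measurable_fun D (EFin \o F n) by apply/measurable_EFinP.
have [fi _ H] := @dominated_convergence _ _ _ mu D mD
    (fun n => EFin \o F n) (EFin \o f) (EFin \o g) mF' mf Fc gi Fb.
split=> //; apply: fine_cvg; rewrite fineK//.
exact: integrable_fin_num.
Qed.

(** The Lipschitz majorant bounds every difference quotient, so dominated convergence along
    sequences applies and differentiability is asked only at [a]. The Duhamel integrand, with a kink
    where the time equals [tau], needs this form: no neighbourhood of [t] is free of kinks for all
    [tau] at once. *)
Lemma is_derive_under_lip D (f : R -> R -> R) (df g : R -> R) (a : R) :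
  measurable D -> itg D g ->
  (\forall x \near a, itg D (f x)) ->
  (\forall x \near a, forall y, D y -> `|f x y - f a y| <= g y * `|x - a|) ->
  (forall y, D y -> is_derive a (1 : R) (f ^~ y) (df y)) ->
  is_derive a (1 : R) (fun x => \int[mu]_(y in D) f x y)
    (\int[mu]_(y in D) df y).
Proof.
move=> mD gi fi fg fdf.
have fai : itg D (f a) by exact: (nbhs_singleton fi).
suff H : h^-1 *: (\int[mu]_(y in D) f (h + a) y - \int[mu]_(y in D) f a y)
    @[h --> 0^'] --> \int[mu]_(y in D) df y.
  apply: DeriveDef.
    apply/cvg_ex; exists (\int[mu]_(y in D) df y).
    by under eq_fun do rewrite scaler1.
  apply/cvg_lim => //.
  by under eq_fun do rewrite scaler1.
apply/cvgr_dnbhsP => t [tn0 t0].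
have ta : t n + a @[n --> \oo] --> a.
  by rewrite -[X in _ --> X]add0r; apply: cvgD => //; exact: cvg_cst.
have [N _ NP] : \forall n \near \oo, itg D (f (t n + a)) /\
    forall y, D y -> `|f (t n + a) y - f a y| <= g y * `|t n + a - a|.
  have h1 := ta _ fi; have h2 := ta _ fg.
  by near=> n; split; near: n.
(* Dropping the first [N] terms makes the eventual integrability and Lipschitz bound hold for every
   index, as [cvg_Rint_seq] demands. *)
rewrite -(cvg_shiftn N) /=.
have -> : (fun n => (t (n + N)%N)^-1 *:
   (\int[mu]_(y in D) f (t (n + N)%N + a) y - \int[mu]_(y in D) f a y)) =
   (fun n => \int[mu]_(y in D) ((t (n + N)%N)^-1 * (f (t (n + N)%N + a) y - f a y))).
  apply/funext => n; have [/= h1 h2] := NP _ (leq_addl n N).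
  by rewrite RintegralZl ?RintegralB//; exact: itgB.
apply: (proj2 (cvg_Rint_seq mD _ _ gi _)).
- move=> n; have [/= h1 h2] := NP _ (leq_addl n N).
  by apply: itg_measurable; apply: itgZl => //; exact: itgB.
- move=> y Dy; have H := fdf y Dy.
  have /cvg_ex[l Hl] : derivable (f ^~ y) a 1 by apply: ex_derive.
  have E : df y = l.
    rewrite -[LHS](@derive_val _ _ _ _ _ _ _ H); apply/cvg_lim => //.
  rewrite E.
  move: Hl => /cvgr_dnbhsP /(_ t (conj tn0 t0)).
  rewrite -(cvg_shiftn N) /=.
  by under [in X in X -> _]eq_fun do rewrite scaler1.
- move=> n y Dy; have [/= h1 /(_ y Dy) h2] := NP _ (leq_addl n N).
  rewrite normrM normfV ler_pdivrMl ?normr_gt0 ?tn0// mulrC.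
  by rewrite addrK in h2.
Unshelve. all: by end_near. Qed.

Lemma cvg_Rint_at_right D (f : R -> R -> R) (l g : R -> R) (p q : R) :
  measurable D -> p < q -> itg D g ->
  (forall x, p < x < q -> measurable_fun D (f x)) ->
  (forall x y, p < x < q -> D y -> `|f x y| <= g y) ->
  (forall y, D y -> f x y @[x --> p^'+] --> l y) ->
  \int[mu]_(y in D) f x y @[x --> p^'+] --> \int[mu]_(y in D) l y.
Proof.
move=> mD pq gi mf fg fl.
apply/cvg_at_rightP => u [pu up].
have [N _ NP] : \forall n \near \oo, u n < q.
  by apply: (cvgr_lt p) => //.
rewrite -(cvg_shiftn N) /=.
have uin n : p < u (n + N)%N < q by rewrite pu (NP _ (leq_addl n N)).
apply: (proj2 (cvg_Rint_seq mD _ _ gi _)).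
- by move=> n; exact: mf.
- move=> y Dy; move: (fl y Dy) => /cvg_at_rightP /(_ u (conj pu up)).
  by rewrite -(cvg_shiftn N).
- by move=> n y Dy; exact: fg.
Qed.

Lemma itg_cst_oo (a b k : R) : itg `]a, b[ (fun=> k).
Proof.
apply: measurable_bounded_integrable => //.
- rewrite /= lebesgue_measure_itv/=; case: ifP => _; last by rewrite ltry.
  by rewrite -EFinB ltry.
- by exists `|k|; split => // x kx y _ /=; exact: ltW.
Qed.

Lemma itg_bounded_oo (a b k : R) f : measurable_fun `]a, b[ f ->
  (forall x, a < x < b -> `|f x| <= k) -> itg `]a, b[ f.
Proof.
move=> mf fk; apply: (@itg_le _ _ (fun=> k)) => //; last exact: itg_cst_oo.
Qed.

(** The fundamental theorem on [[1/(n+1), n+2]] passes to the limit by dominated convergence with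
    majorant [|a|]. The offset in [n+2] keeps the left end below the right one already for
    [n = 0]. *)
Lemma FTC_0y (A a : R -> R) (l m : R) :
  (forall y : R, 0 < y -> is_derive y (1 : R) A (a y)) ->
  (forall y, 0 < y -> {for y, continuous a}) ->
  itg `]0, +oo[ a ->
  A y @[y --> 0^'+] --> l -> A y @[y --> +oo] --> m ->
  \int[mu]_(y in `]0, +oo[) a y = m - l.
Proof.
move=> dA ca ai A0 Ay.
pose lo n : R := n.+1%:R^-1.
pose hi n : R := n.+2%:R.
have lo0 n : 0 < lo n by rewrite invr_gt0.
have lohi n : lo n < hi n.
  apply: (@le_lt_trans _ _ 1); last by rewrite ltr1n.
  by rewrite invf_le1// ler1n.
pose F n := a \_ `[lo n, hi n].
have sub n : `[lo n, hi n] `<=` `]0, +oo[.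
  by move=> x /=; rewrite !in_itv/= andbT => /andP[+ _]; exact: lt_le_trans.
have FE n : \int[mu]_(y in `]0, +oo[) F n y = A (hi n) - A (lo n).
  rewrite -Rintegral_mkcondr setIidr//.
  rewrite /Rintegral (@continuous_FTC2 _ a A)//.
  - apply/continuous_within_itvP => //; split.
    + move=> x; rewrite in_itv/= => /andP[lx _]; apply: ca.
      exact: lt_trans lx.
    + apply: cvg_at_right_filter; apply: ca; exact: lo0.
    + apply: cvg_at_left_filter; apply: ca; exact: lt_trans (lohi n).
  - have cA y : 0 < y -> {for y, continuous A}.
      move=> y0; apply: differentiable_continuous; apply/derivable1_diffP.
      by have H := dA y y0; apply: ex_derive.
    split.
    + move=> x; rewrite in_itv/= => /andP[lx _].
      by have H := dA x (lt_trans (lo0 n) lx); apply: ex_derive.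
    + by apply: cvg_at_right_filter; apply: cA; exact: lo0.
    + by apply: cvg_at_left_filter; apply: cA; exact: lt_trans (lohi n).
  - move=> x; rewrite in_itv/= => /andP[lx _].
    by have H := dA x (lt_trans (lo0 n) lx); rewrite derive1E derive_val.
have H1 : \int[mu]_(y in `]0, +oo[) F n y @[n --> \oo] -->
    \int[mu]_(y in `]0, +oo[) a y.
  apply: (proj2 (@cvg_Rint_seq _ _ _ (fun y => `|a y|) _ _ _ _ _)) => //.
  - move=> n; apply/measurable_restrict => //.
    by apply: measurable_funS (itg_measurable ai) => // x [].
  - move=> y /=; rewrite in_itv/= andbT => y0.
    apply: cvg_near_cst; near=> n.
    rewrite /F /patch mem_set//= in_itv/=; apply/andP; split.
      rewrite /lo -[leRHS]invrK lef_pV2 ?posrE ?invr_gt0//.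
      rewrite (@le_trans _ _ n%:R)// ?ler_nat ?leqW//.
      by near: n; exact: nbhs_infty_ger.
    rewrite /hi (@le_trans _ _ n%:R)// ?ler_nat ?leqW//.
    by near: n; exact: nbhs_infty_ger.
  - exact: itg_norm.
  - by move=> n y _; rewrite /F /patch; case: ifP => // _; rewrite normr0.
have H2 : \int[mu]_(y in `]0, +oo[) F n y @[n --> \oo] --> m - l.
  under eq_fun do rewrite FE.
  apply: cvgB.
    move/cvg_pinftyP: Ay; apply.
    apply/cvgryPge => x; near=> n; rewrite /hi (@le_trans _ _ n%:R)// ?ler_nat ?leqW//.
    by near: n; exact: nbhs_infty_ger.
  move/cvg_at_rightP : A0; apply; split => //.
  exact: cvg_harmonic.
exact: (cvg_unique _ H1 H2).
Unshelve. all: by end_near. Qed.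

(** Sampling the second variable at a grid point [r n s] to the right of [s] turns [F] into a
    countable gluing of functions of [x] alone, hence jointly measurable; right continuity recovers
    [F] in the limit. The grid point is strictly larger than [s] because the limit is taken along
    [s^'+]. *)
Lemma measurable_caratheodory (F : R -> R -> R) :
  (forall s, 0 <= s -> measurable_fun setT (F ^~ s)) ->
  (forall x s, 0 <= s -> F x s' @[s' --> s^'+] --> F x s) ->
  measurable_fun [set p : R * R | 0 <= p.2] (fun p => F p.1 p.2).
Proof.
move=> mF cF.
pose k n (s : R) : R := (Num.truncn (n.+1%:R * s))%:R.
pose r n (s : R) : R := (k n s + 1) / n.+1%:R.
have r0 n s : 0 <= r n s by rewrite divr_ge0// addr_ge0// ler0n.
have mk n : measurable_fun setT (k n).
  apply: nondecreasing_measurable => // x y xy.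
  by rewrite ler_nat Num.Theory.le_truncn// ler_wpM2l.
apply: (@measurable_fun_cvg _ _ _ _ (fun n p => F p.1 (r n p.2))) => [n|[x s]/= s0].
  apply: measurable_funTS => _ Y mY; rewrite setTI.
  rewrite (_ : _ @^-1` _ = \bigcup_(m : nat)
    ((F ^~ ((m%:R + 1) / n.+1%:R)) @^-1` Y `*` (k n @^-1` [set m%:R])))%classic.
    apply: bigcupT_measurable => m; apply: measurableX.
      by rewrite -[X in measurable X]setTI; apply: mF => //; rewrite divr_ge0// addr_ge0// ler0n.
    by rewrite -[X in measurable X]setTI; apply: mk.
  apply/seteqP; split=> [[x s]/= H|[x s] [m _ [/= H1 H2]]]; last by rewrite /r H2.
  by exists (Num.truncn (n.+1%:R * s)).
have rs n : s < r n s by rewrite /r ltr_pdivlMr// /k mulrC natr1 truncnS_gt.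
have rs' n : r n s - s <= n.+1%:R^-1.
  rewrite /r mulrDl mul1r lerBlDr addrC lerD2l ler_pdivrMr// mulrC /k.
  by rewrite truncn_le mulr_ge0.
move/cvg_at_rightP: (cF x s s0); apply; split=> //.
apply/cvgrPdist_le => e e0; near=> n.
rewrite distrC ger0_norm ?subr_ge0 ?(ltW (rs _))// (le_trans (rs' _))//.
near: n; have := @cvg_harmonic R => /cvgrPdist_le /(_ _ e0).
by apply: filterS => n /=; rewrite sub0r normrN ger0_norm.
Unshelve. all: by end_near. Qed.

(** Extension by zero to the plane, followed by Tonelli's theorem with the majorant [g] of the inner
    integrals of [|F|], gives integrability for the product measure. Sections are integrable at
    every point, not almost every point, so that real and extended-real inner integrals agree
    everywhere. *)
Lemma Fubini_dom (D1 D2 : set R) (F : R -> R -> R) (g : R -> R) :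
  measurable D1 -> measurable D2 ->
  measurable_fun (D1 `*` D2) (fun p : R * R => F p.1 p.2) ->
  (forall x, D1 x -> itg D2 (F x)) ->
  (forall y, D2 y -> itg D1 (F ^~ y)) ->
  itg D1 g ->
  (forall x, D1 x -> \int[mu]_(y in D2) `|F x y| <= g x) ->
  [/\ itg D1 (fun x => \int[mu]_(y in D2) F x y),
      itg D2 (fun y => \int[mu]_(x in D1) F x y) &
  \int[mu]_(x in D1) (\int[mu]_(y in D2) F x y) =
  \int[mu]_(y in D2) (\int[mu]_(x in D1) F x y)].
Proof.
move=> mD1 mD2 mF F2 F1 gi Fg.
pose H : R * R -> R := (fun p => F p.1 p.2) \_ (D1 `*` D2).
have mD : measurable (D1 `*` D2 : set (R * R)) by exact: measurableX.
have mH : measurable_fun [set: R * R] H by apply/(measurable_restrictT _ _).1.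
have HE x y : H (x, y) = ((F x) \_ D2) y * \1_D1 x.
  rewrite /H /patch indicE in_setX /=.
  by case: (x \in D1); case: (y \in D2); rewrite ?mulr1 ?mulr0.
have HE' x y : H (x, y) = ((F ^~ y) \_ D1) x * \1_D2 y.
  rewrite /H /patch indicE in_setX /=.
  by case: (x \in D1); case: (y \in D2); rewrite ?mulr1 ?mulr0.
have mH' : measurable_fun [set: R * R] (EFin \o H) by exact/measurable_EFinP.

have HD1 x : D1 x -> (\int[mu]_y (EFin \o H) (x, y))%E =
    (\int[mu]_(y in D2) (F x y)%:E)%E.
  move=> Dx; rewrite [RHS]integral_mkcond; apply: eq_integral => y _.
  by rewrite /= HE indicE mem_set// mulr1 /patch; case: ifP.
have HN1 x : ~ D1 x -> (\int[mu]_y (EFin \o H) (x, y))%E = 0%E.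
  move=> Dx; rewrite integral0_eq// => y _.
  by rewrite /= HE indicE memNset// mulr0.
have HD2 y : D2 y -> (\int[mu]_x (EFin \o H) (x, y))%E =
    (\int[mu]_(x in D1) (F x y)%:E)%E.
  move=> Dx; rewrite [RHS]integral_mkcond; apply: eq_integral => x _.
  by rewrite /= HE' indicE mem_set// mulr1 /patch; case: ifP.
have HN2 y : ~ D2 y -> (\int[mu]_x (EFin \o H) (x, y))%E = 0%E.
  move=> Dx; rewrite integral0_eq// => x _.
  by rewrite /= HE' indicE memNset// mulr0.
have F2E x : D1 x -> (\int[mu]_(y in D2) (F x y)%:E)%E = (\int[mu]_(y in D2) F x y)%:E.
  by move=> Dx; apply: itg_EFin => //; exact: F2.
have F1E y : D2 y -> (\int[mu]_(x in D1) (F x y)%:E)%E = (\int[mu]_(x in D1) F x y)%:E.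
  by move=> Dy; apply: itg_EFin => //; exact: F1.
have iH : (mu \x mu)%E.-integrable setT (EFin \o H).
  apply/(@integrable12ltyP _ _ _ _ R mu mu (EFin \o H) mH').
  apply: (@le_lt_trans _ _ (\int[mu]_x ((EFin \o g) \_ D1) x)%E); last first.
    rewrite -integral_mkcond; exact: integrable_lty.
  apply: ge0_le_integral => //.
  - by move=> x _; exact: integral_ge0.
  - apply: (@measurable_fun_fubini_tonelli_F _ _ _ _ R mu (abse \o (EFin \o H))).
      exact: measurableT_comp.
    by move=> x; exact: abse_ge0.
  - apply/(measurable_restrictT _ _).1 => //.
    exact: measurable_int gi.
  - move=> x _; rewrite [leRHS]/patch; case: ifPn => [/set_mem Dx|/negP Dx].
      apply: le_trans (_ : (\int[mu]_(y in D2) `|F x y|)%:E <= _)%E; last first.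
        by rewrite lee_fin; exact: Fg.
      rewrite -itg_EFin//; last by apply: itg_norm; exact: F2.
      rewrite [leRHS]integral_mkcond; apply: ge0_le_integral => //.
      + apply: measurableT_comp => //.
        exact: (measurableT_comp mH' (measurable_pair1 x)).
      + apply/(measurable_restrictT _ _).1 => //.
        by apply: measurable_int; apply: itg_norm; exact: F2.
      + by move=> y _; rewrite /= HE indicE mem_set// mulr1 /patch; case: ifP => //; rewrite ?normr0.
    rewrite integral0_eq// => y _.
    by rewrite /= HE indicE (negbTE (introN idP Dx)) mulr0 normr0.
have E12 := @integral12_prod_meas1 _ _ _ _ R mu mu _ iH.
have E21 := @integral21_prod_meas1 _ _ _ _ R mu mu _ iH.
have I1 := @integrable_fubini_F _ _ _ _ R mu mu _ iH.

have J1 : itg D1 (fun x => \int[mu]_(y in D2) F x y).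
  apply: (@eq_integrable _ _ _ mu _ mD1 (fubini_F mu (EFin \o H))).
    by move=> x /set_mem Dx; rewrite /fubini_F HD1//= F2E.
  by apply: integrableS I1.
have mG : measurable_fun setT (fubini_G mu (EFin \o H)).
  exact: (@measurable_fubini_G _ _ _ _ R mu mu _ iH).
have I2 : mu.-integrable setT (fubini_G mu (EFin \o H)).
  apply/integrableP; split => //.
  apply: le_lt_trans ((@integrable21ltyP _ _ _ _ R mu mu (EFin \o H) mH').1 iH).
  apply: ge0_le_integral => //.
  - exact: measurableT_comp.
  - apply: (@measurable_fun_fubini_tonelli_G _ _ _ _ R mu (abse \o (EFin \o H))).
      exact: measurableT_comp.
    by move=> x; exact: abse_ge0.
  - move=> y _; apply: le_abse_integral => //.
    exact: (measurableT_comp mH' (measurable_pair2 y)).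
have J2 : itg D2 (fun y => \int[mu]_(x in D1) F x y).
  apply: (@eq_integrable _ _ _ mu _ mD2 (fubini_G mu (EFin \o H))).
    by move=> y /set_mem Dy; rewrite /fubini_G HD2//= F1E.
  by apply: integrableS I2.
split => //; rewrite [LHS]/Rintegral [RHS]/Rintegral; congr fine.
transitivity (\int[mu]_x fubini_F mu (EFin \o H) x)%E.
  rewrite integral_mkcond; apply: eq_integral => x _; rewrite /fubini_F /patch.
  by case: ifPn => [/set_mem Dx|/negP Dx]; [rewrite HD1// F2E|rewrite HN1// => /mem_set].
rewrite E12 -E21 [RHS]integral_mkcond; apply: eq_integral => y _.
rewrite /fubini_G /patch.
by case: ifPn => [/set_mem Dy|/negP Dy]; [rewrite HD2// F1E|rewrite HN2// => /mem_set].
Qed.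

End Toolkit.

(** * The heat kernel *)

Section Kernel.
Variable R : realType.
Notation mu := (@lebesgue_measure R).
Notation itg D f := (mu.-integrable D (EFin \o f)).
Implicit Types (x y z s : R).

(* For [s <= 0] the junk value [Num.sqrt _ = 0] makes [hK z s = 0]. *)
Definition hK z s : R := (Num.sqrt (4 * pi * s))^-1 * expR (- (z ^+ 2 / (4 * s))).
Definition hKz z s : R := - (z / (2 * s)) * hK z s.
Definition hKzz z s : R := (z ^+ 2 / (4 * s ^+ 2) - (2 * s)^-1) * hK z s.

Lemma hK_ge0 z s : 0 <= hK z s.
Proof. by rewrite mulr_ge0 ?expR_ge0// invr_ge0 sqrtr_ge0. Qed.

Lemma hK_le0 z s : s <= 0 -> hK z s = 0.
Proof.
move=> s0; rewrite /hK ler0_sqrtr ?invr0 ?mul0r//.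
by rewrite pmulr_rle0// mulr_gt0// pi_gt0.
Qed.

Lemma hKN z s : hK (- z) s = hK z s.
Proof. by rewrite /hK sqrrN. Qed.

Lemma is_derive_hKz z s : s != 0 -> is_derive z (1 : R) (hK ^~ s) (hKz z s).
Proof.
move=> s0; rewrite /hKz /hK; apply: is_derive_eq.
by rewrite /GRing.scale /=; set r := (Num.sqrt _)^-1; field.
Qed.

Lemma is_derive_hKzz z s : s != 0 -> is_derive z (1 : R) (hKz ^~ s) (hKzz z s).
Proof.
move=> s0; rewrite /hKz /hKzz; have H := is_derive_hKz z s0.
by apply: is_derive_eq; rewrite /GRing.scale /= /hKz; field.
Qed.

(** This is the heat equation for the kernel: reusing [hKzz] as time derivative is what later makes
    time derivatives of potentials equal to second space derivatives. *)
Lemma is_derive_hKs z s : 0 < s -> is_derive s (1 : R) (hK z) (hKzz z s).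
Proof.
move=> s0; have s0' : s != 0 by rewrite gt_eqF.
have y0 : 0 < 4 * pi * s by rewrite !mulr_gt0 ?pi_gt0.
have r0 : Num.sqrt (4 * pi * s) != 0 by rewrite gt_eqF// sqrtr_gt0.
rewrite /hKzz /hK.
have d1 : is_derive s (1 : R) (fun u => Num.sqrt (4 * pi * u))
   ((2 * Num.sqrt (4 * pi * s))^-1 * (4 * pi)).
  have H : is_derive s (1 : R) (fun u : R => 4 * pi * u) (4 * pi).
    by apply: is_derive_eq; rewrite /GRing.scale /= mulr1.
  exact: (@is_derive1_comp _ Num.sqrt _ _ _ _ (is_derive1_sqrt y0) H).
have d2 := @is_deriveV R (fun u => Num.sqrt (4 * pi * u)) s _ 1 r0 d1.
have d3 : is_derive s (1 : R) (fun u : R => - (z ^+ 2 / (4 * u))) (z ^+ 2 / (4 * s ^+ 2)).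
  have s4 : 4 * s != 0 by rewrite mulf_neq0.
  have H : is_derive s (1 : R) (fun u : R => 4 * u) 4.
    by apply: is_derive_eq; rewrite /GRing.scale /= mulr1.
  have H' := @is_deriveV R (fun u => 4 * u) s _ 1 s4 H.
  by apply: is_derive_eq; rewrite /GRing.scale /=; field.
apply: is_derive_eq; rewrite /GRing.scale /=.
have := sqr_sqrtr (ltW y0).
set r := Num.sqrt _ in r0 *; set e := expR _ => rE.
have -> : r ^- 2 = (4 * pi * s)^-1 by rewrite -rE.
have p0 : (pi : R) != 0 by rewrite gt_eqF ?pi_gt0.
move: (pi : R) (z) r e p0 r0 {rE y0 d1 d2 d3} => p z' r e p0 r0.
by field; rewrite r0 s0' p0.
Qed.

Lemma continuous_hK z s : s != 0 -> {for z, continuous (hK ^~ s)}.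
Proof.
move=> s0; apply: differentiable_continuous; apply/derivable1_diffP.
by have H := is_derive_hKz z s0; apply: ex_derive.
Qed.

(** With [Y = z^2/(4b)], the inequality [1 + Y^3/3! <= exp Y] pays for the third power. The bound is
    uniform in [s] because the exponent is largest at [s = b]. *)
Lemma expR_poly_bound (b : R) : 0 < b -> exists2 C : R, 0 < C &
  forall z s, 0 < s <= b -> expR (- (z ^+ 2 / (4 * s))) * (1 + z ^+ 2) ^+ 3 <= C.
Proof.
move=> b0; have B0 : 0 < (4 * b) ^+ 3 by rewrite exprn_gt0// mulr_gt0.
(* The outer [4] comes from [(1 + u)^3 <= 4 (1 + u^3)] with [u = z^2], the rest from
   [u^3 = (4 b)^3 Y^3] and [Y^3 <= 6 exp Y]. *)
exists (4 * (1 + 6 * (4 * b) ^+ 3)); first by nra.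
move=> z s /andP[s0 sb]; pose Y := z ^+ 2 / (4 * b).
have Y0 : 0 <= Y by rewrite divr_ge0 ?sqr_ge0// mulr_ge0// ltW.
have E1 : expR (- (z ^+ 2 / (4 * s))) <= expR (- Y).
  rewrite ler_expR lerN2 /Y ler_wpM2l ?sqr_ge0// lef_pV2 ?posrE ?mulr_gt0//.
  by rewrite ler_wpM2l.
have uE : z ^+ 2 = 4 * b * Y by rewrite /Y mulrC divfK// gt_eqF// mulr_gt0.
have E2 := expR_ge1Dxn 2 Y0.
apply: (@le_trans _ _ (expR (- Y) * (4 * (1 + 6 * (4 * b) ^+ 3) * expR Y))); last first.
  by rewrite mulrCA -expRD addNr expR0 mulr1.
apply: ler_pM => //; rewrite ?expR_ge0 ?exprn_ge0 ?addr_ge0 ?sqr_ge0//.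
apply: (@le_trans _ _ (4 * (1 + (z ^+ 2) ^+ 3))).
  have : 0 <= z ^+ 2 by exact: sqr_ge0.
  move: (z ^+ 2) => u u0.
  (* This quantity is exactly [4 (1 + u^3) - (1 + u)^3]. *)
  have : 0 <= 3 * ((1 - u) ^+ 2 * (1 + u)).
    by apply: mulr_ge0 => //; apply: mulr_ge0; [exact: sqr_ge0|exact: addr_ge0].
  by nra.
rewrite -mulrA ler_wpM2l// uE.
rewrite exprMn.
have V0 : 0 <= Y ^+ 3 by rewrite exprn_ge0.
rewrite (_ : 3`!%:R = 6 :> R) in E2; last by [].
move: ((4 * b) ^+ 3) (Y ^+ 3) (expR Y) B0 V0 E2 => B V E B0 V0 E2.
by nra.
Qed.

(** A Peetre-type inequality: [y = x - (x - y)] gives [y^2 <= 2 x^2 + 2 (x - y)^2]. It trades decay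
    in [x - y] for decay in [y], uniformly over bounded [x]. *)
Lemma oneDsqr_shift (X x y : R) : `|x| <= X ->
  (1 + (x - y) ^+ 2)^-1 <= 2 * (1 + X ^+ 2) * (1 + y ^+ 2)^-1.
Proof.
move=> xX.
have p z : 0 < 1 + z ^+ 2 by rewrite ltr_pwDl ?sqr_ge0.
rewrite ler_pdivlMr// mulrC ler_pdivrMr//.
have : x ^+ 2 <= X ^+ 2.
  by rewrite -[x ^+ 2]real_normK ?num_real// lerXn2r ?nnegrE// (le_trans _ xX).
have := p x; have := sqr_ge0 (x - y); have : 0 <= (x + (x - y)) ^+ 2 by exact: sqr_ge0.
nra.
Qed.

(** A single integrable majorant in [y], uniform for bounded [x] and for [s] in a compact set of
    positive times. Each polynomial prefactor is at most [m * (1 + z^2)], and the Gaussian absorbs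
    it with a further factor [1 + z^2] to spare. *)
Lemma hK_bounds (a b X : R) : 0 < a -> exists2 C : R, 0 < C &
  forall x y s, `|x| <= X -> a <= s <= b ->
  [/\ hK (x - y) s <= C * (1 + y ^+ 2)^-1,
      `|hKz (x - y) s| <= C * (1 + y ^+ 2)^-1 &
      `|hKzz (x - y) s| <= C * (1 + y ^+ 2)^-1].
Proof.
move=> a0.
have b'0 : 0 < `|b| + 1 by rewrite ltr_wpDl.
have [C1 C10 C1P] := expR_poly_bound b'0.
pose c0 := (Num.sqrt (4 * pi * a))^-1.
have pia : 0 < 4 * pi * a by rewrite !mulr_gt0 ?pi_gt0.
have c00 : 0 < c0 by rewrite invr_gt0 sqrtr_gt0.
pose m := 1 + (2 * a)^-1 + (4 * a ^+ 2)^-1.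
have ia : 0 < (2 * a)^-1 by rewrite invr_gt0 mulr_gt0.
have ia2 : 0 < (4 * a ^+ 2)^-1 by rewrite invr_gt0 mulr_gt0// exprn_gt0.
have m0 : 0 < m by rewrite /m !addr_gt0.
exists (m * (c0 * C1) * (2 * (1 + X ^+ 2))).
  by rewrite !mulr_gt0// ltr_pwDl ?sqr_ge0.
move=> x y s xX /andP[sa sb]; set z := x - y.
have s0 : 0 < s by exact: lt_le_trans sa.
have p : 0 < 1 + z ^+ 2 by rewrite ltr_pwDl ?sqr_ge0.
have p1 : 1 <= 1 + z ^+ 2 by rewrite lerDl sqr_ge0.
have Kb : hK z s * (1 + z ^+ 2) ^+ 3 <= c0 * C1.
  rewrite /hK -[_ * _ * _ ^+ 3]mulrA; apply: ler_pM.
  - by rewrite invr_ge0 sqrtr_ge0.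
  - by rewrite mulr_ge0 ?expR_ge0// exprn_ge0// ltW.
  - rewrite /c0 lef_pV2 ?posrE ?sqrtr_gt0// ?mulr_gt0 ?pi_gt0//.
    by rewrite ler_wsqrtr// ler_wpM2l// mulr_ge0// pi_ge0.
  - by apply: C1P; rewrite s0 (le_trans sb)// (le_trans (ler_norm b))// lerDl.
have mult (q : R) : `|q| <= m * (1 + z ^+ 2) -> `|q * hK z s| <=
    m * (c0 * C1) * (2 * (1 + X ^+ 2)) * (1 + y ^+ 2)^-1.
  move=> qb; rewrite normrM (ger0_norm (hK_ge0 _ _)).
  rewrite -mulrA.
  apply: (@le_trans _ _ (m * (c0 * C1) * (1 + z ^+ 2)^-1)); last first.
    rewrite ler_wpM2l//; last exact: oneDsqr_shift.
    by rewrite !mulr_ge0// ltW.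
  rewrite ler_pdivlMr//.
  apply: (@le_trans _ _ (m * (hK z s * (1 + z ^+ 2) ^+ 3))); last first.
    by rewrite ler_wpM2l// ltW.
  apply: (@le_trans _ _ (m * (1 + z ^+ 2) * hK z s * (1 + z ^+ 2))).
    by rewrite ler_wpM2r ?(ltW p)// ler_wpM2r// hK_ge0.
  have -> : m * (1 + z ^+ 2) * hK z s * (1 + z ^+ 2) = m * hK z s * (1 + z ^+ 2) ^+ 2 by ring.
  have -> : m * (hK z s * (1 + z ^+ 2) ^+ 3) = m * hK z s * (1 + z ^+ 2) ^+ 3 by ring.
  by rewrite ler_wpM2l ?mulr_ge0 ?hK_ge0 ?(ltW m0)// ler_weXn2l.
have is_ : 0 <= (2 * s)^-1 <= (2 * a)^-1.
  by rewrite invr_ge0 mulr_ge0 ?(ltW s0)//= lef_pV2 ?posrE ?mulr_gt0// ler_wpM2l.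
have is2 : 0 <= (4 * s ^+ 2)^-1 <= (4 * a ^+ 2)^-1.
  rewrite invr_ge0 mulr_ge0 ?exprn_ge0 ?(ltW s0)//= lef_pV2 ?posrE ?mulr_gt0 ?exprn_gt0//.
  by rewrite ler_wpM2l// lerXn2r ?nnegrE// ltW.
have z2 : 0 <= z ^+ 2 by exact: sqr_ge0.
move: is_ is2 => /andP[i0 i1] /andP[j0 j1].
split.
- rewrite -[leLHS]ger0_norm ?hK_ge0// -[X in `|X|]mul1r; apply: mult.
  rewrite normr1 /m; nra.
- apply: mult; rewrite normrN normrM (ger0_norm i0).
  have : `|z| <= 1 + z ^+ 2.
    rewrite -[z ^+ 2]real_normK ?num_real//; have := sqr_ge0 (`|z| - 1); have := normr_ge0 z; nra.
  have := normr_ge0 z; rewrite /m; nra.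
- apply: mult; apply: (le_trans (ler_normB _ _)).
  rewrite normrM (ger0_norm i0) (ger0_norm j0) (ger0_norm z2) /m; nra.
Qed.

(** Away from the diagonal the kernel is flat at [s = 0]. From [X^6 <= 6! exp X] with [X = z^2/(4s)]
    come six powers of [s], and the prefactor, at most [(1 + T)/s], costs one. Of the six factors
    [z^-2], five are bounded by [d^-2] and the last supplies the decay in [y]. *)
Lemma hK_far (d T X : R) : 0 < d -> 0 < T -> exists2 C : R, 0 < C &
  forall x y s, `|x| <= X -> d <= `|x - y| -> 0 < s <= T ->
  hK (x - y) s <= C * s ^+ 5 * (1 + y ^+ 2)^-1.
Proof.
move=> d0 T0.
have [F F0 FP] : exists2 F : R, 0 < F & forall X : R, 0 <= X -> X ^+ 6 <= F * expR X.
  have f0 : 0 < 6`!%:R :> R by rewrite ltr0n.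
  exists (6`!%:R) => // X0 /(expR_ge1Dxn 5); move: (6`!%:R) f0 => f f0 h.
  rewrite mulrC -ler_pdivrMr//; lra.
have d20 : 0 < d ^+ 2 by rewrite exprn_gt0.
pose e := d ^- 2.
have e0 : 0 < e by rewrite invr_gt0.
pose k : R := 4 ^+ 6.
have k0 : 0 < k by rewrite exprn_gt0.
pose C0 := (1 + T) * F * k * (e ^+ 5 * (1 + e)).
have C00 : 0 < C0.
  by rewrite /C0 !mulr_gt0 ?exprn_gt0 ?addr_gt0.
exists (C0 * (2 * (1 + X ^+ 2))).
  by rewrite mulr_gt0// mulr_gt0// ltr_pwDl ?sqr_ge0.
move=> x y s xX; set z := x - y => dz /andP[s0 sT].
have z0 : 0 < `|z| by exact: lt_le_trans dz.
have z20 : 0 < z ^+ 2 by rewrite -[z ^+ 2]real_normK ?num_real// exprn_gt0.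
have dz2 : d ^+ 2 <= z ^+ 2.
  by rewrite -[z ^+ 2]real_normK ?num_real// lerXn2r ?nnegrE// ltW.
have h1 : (Num.sqrt (4 * pi * s))^-1 <= (1 + T) / s.
  have y0 : 0 < 4 * pi * s by rewrite !mulr_gt0 ?pi_gt0.
  rewrite ler_pdivlMr// mulrC ler_pdivrMr ?sqrtr_gt0//.
  have sy : s <= 4 * pi * s.
    by rewrite ler_peMl ?(ltW s0)//; have := @pi_ge2 R; lra.
  have [s1|s1] := leP 1 (4 * pi * s).
    apply: (@le_trans _ _ ((1 + T) * 1)); first by rewrite mulr1; lra.
    rewrite ler_wpM2l ?addr_ge0 ?(ltW T0)//.
    by rewrite -[leLHS]sqrtr1 ler_wsqrtr.
  apply: (@le_trans _ _ (1 * Num.sqrt (4 * pi * s))); last first.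
    by rewrite ler_wpM2r ?sqrtr_ge0// lerDl ltW.
  rewrite mul1r (le_trans sy)//.
  rewrite -[leLHS](sqr_sqrtr (ltW y0)) expr2 ler_piMr ?sqrtr_ge0//.
  by rewrite -[leRHS]sqrtr1 ler_wsqrtr// ltW.
have iz : (z ^+ 2)^-1 <= e by rewrite /e lef_pV2 ?posrE.
have iz0 : 0 < (z ^+ 2)^-1 by rewrite invr_gt0.
have h2 : expR (- (z ^+ 2 / (4 * s))) <= F * (k * s ^+ 6 * (z ^+ 2)^-1 ^+ 6).
  have X0 : 0 < z ^+ 2 / (4 * s) by rewrite divr_gt0// mulr_gt0.
  have := FP _ (ltW X0).
  rewrite expRN => h.
  rewrite -[leLHS]mul1r ler_pdivrMr ?expR_gt0//.
  rewrite mulrAC -ler_pdivrMr; last first.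
    by rewrite !mulr_gt0// exprn_gt0.
  apply: le_trans h.
  rewrite le_eqVlt; apply/orP; left; apply/eqP; rewrite /k.
  move: (z ^+ 2) z20 => w w0.
  by field; rewrite !gt_eqF.
have h3 : (z ^+ 2)^-1 ^+ 6 <= e ^+ 5 * (1 + e) * (1 + z ^+ 2)^-1.
  rewrite exprSr -mulrA; apply: ler_pM; rewrite ?exprn_ge0 ?(ltW iz0)//.
    by rewrite lerXn2r ?nnegrE ?(ltW e0) ?(ltW iz0).
  rewrite ler_pdivlMr ?ltr_pwDl ?sqr_ge0//.
  rewrite mulrDr mulr1 mulVf ?gt_eqF//; lra.
rewrite /hK.
apply: (@le_trans _ _ ((1 + T) / s * (F * (k * s ^+ 6 * (e ^+ 5 * (1 + e) * (1 + z ^+ 2)^-1))))).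
  apply: ler_pM; rewrite ?invr_ge0 ?sqrtr_ge0 ?expR_ge0//.
  apply: (le_trans h2); rewrite ler_wpM2l ?(ltW F0)// ler_wpM2l//.
  by rewrite mulr_ge0 ?exprn_ge0// ltW.
have -> : (1 + T) / s * (F * (k * s ^+ 6 * (e ^+ 5 * (1 + e) * (1 + z ^+ 2)^-1))) =
  C0 * s ^+ 5 * (1 + z ^+ 2)^-1.
  rewrite /C0; move: (1 + z ^+ 2)^-1 => w.
  by field; rewrite gt_eqF.
have -> : C0 * (2 * (1 + X ^+ 2)) * s ^+ 5 * (1 + y ^+ 2)^-1 =
  C0 * s ^+ 5 * (2 * (1 + X ^+ 2) * (1 + y ^+ 2)^-1) by ring.
apply: ler_wpM2l; last exact: oneDsqr_shift.
by apply: mulr_ge0; [exact: ltW|rewrite exprn_ge0// ltW].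
Qed.

Lemma itg_oneDsqrV : itg setT (fun y => (1 + y ^+ 2)^-1).
Proof.
have E := @ge0_symfun_integralT R (fun y => (1 + y ^+ 2)^-1).
apply/integrableP; split.
  apply/measurable_EFinP; apply: continuous_measurable_fun.
  exact: continuous_oneDsqrV.
have p z : 0 < 1 + z ^+ 2 by rewrite ltr_pwDl ?sqr_ge0.
under eq_integral => y _ do rewrite /= ger0_norm ?invr_ge0 ?(ltW (p _))//.
rewrite E.
- have := @integral0y_oneDsqr R; rewrite set_itvcy => ->.
  by rewrite -EFinM ltry.
- by move=> y; rewrite invr_ge0 ltW.
- exact: continuous_oneDsqrV.
- by move=> y /=; rewrite sqrrN.
Qed.

(** As a normal density of mean [x] and variance [2 s], the kernel inherits integrability and total
    mass one. *)
Lemma hK_normal x y s : 0 < s -> hK (x - y) s = normal_pdf x (Num.sqrt (2 * s)) y.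
Proof.
move=> s0; have r0 : Num.sqrt (2 * s) != 0 by rewrite gt_eqF// sqrtr_gt0 mulr_gt0.
rewrite normal_pdfE// /normal_peak /normal_fun sqr_sqrtr ?mulr_ge0 ?(ltW s0)//.
rewrite /hK; congr (_^-1 * expR _).
  by congr (Num.sqrt _); rewrite mulr2n; ring.
by rewrite mulNr mulr2n; congr (- (_ / _)); ring.
Qed.

Lemma itg_hK x s : 0 < s -> itg setT (fun y => hK (x - y) s).
Proof.
move=> s0; apply: eq_itg (integrable_normal_pdf x (Num.sqrt (2 * s))) => //.
by move=> y _; rewrite hK_normal.
Qed.

Lemma Rint_hK x s : 0 < s -> \int[mu]_y hK (x - y) s = 1.
Proof.
move=> s0; under eq_Rintegral do rewrite hK_normal//.
by rewrite /Rintegral integral_normal_pdf.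
Qed.

(** By the mean value theorem. Applied to [x - y] and [- (x + y)], which are [2 x] apart, it makes
    [hG x y s] of order [x] near the boundary. *)
Lemma hK_lip (a b : R) : 0 < a -> exists2 C : R, 0 < C &
  forall z z' s, a <= s <= b -> `|hK z s - hK z' s| <= C * `|z - z'|.
Proof.
move=> a0; have [C C0 CP] := hK_bounds b 0 a0; exists C => // z z' s /[dup] sab /andP[sa _].
have s0 : s != 0 by rewrite gt_eqF// (lt_le_trans a0).
wlog zz : z z' / z' <= z.
  by move=> H; have [/H//|/ltW/H] := leP z' z; rewrite distrC (distrC z').
have [c _ ->] := @MVT_segment R (hK ^~ s) (hKz ^~ s) z' z zz
    (fun w _ => is_derive_hKz w s0)
    (@continuous_subspaceT _ _ _ _ (fun w => @continuous_hK w s s0)).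
rewrite normrM ler_wpM2r//.
have [_ H _] := CP 0 (- c) s ltac:(by rewrite normr0) sab.
rewrite sub0r opprK in H; apply: (le_trans H).
rewrite ger_pMr// invf_le1 ?lerDl ?sqr_ge0// ltr_pwDl ?sqr_ge0//.
Qed.

Definition hG x y s := hK (x - y) s - hK (x + y) s.

(** The image point is never closer than the source: [(x - y)^2 <= (x + y)^2] for nonnegative
    arguments. *)
Lemma hG_ge0 x y s : 0 <= x -> 0 <= y -> 0 <= hG x y s.
Proof.
move=> x0 y0; rewrite /hG subr_ge0.
have [s0|s0] := leP s 0; first by rewrite !hK_le0.
rewrite /hK ler_wpM2l ?invr_ge0 ?sqrtr_ge0// ler_expR lerN2 ler_wpM2r ?invr_ge0 ?mulr_ge0 ?(ltW s0)//.
nra.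
Qed.

Lemma hG_le x y s : 0 <= x -> 0 <= y -> `|hG x y s| <= hK (x - y) s.
Proof.
by move=> x0 y0; rewrite ger0_norm ?hG_ge0// /hG gerBl hK_ge0.
Qed.

Lemma is_derive_hKyN x y s : s != 0 ->
  is_derive y (1 : R) (fun u => hK (x - u) s) (- hKz (x - y) s).
Proof.
move=> s0; have H := is_derive_hKz (x - y) s0.
have H' : is_derive y (1 : R) (fun u : R => x - u) (-1).
  by apply: is_derive_eq; rewrite /GRing.scale /=; ring.
by have := @is_derive1_comp R (hK ^~ s) (fun u => x - u) y _ _ H H'; rewrite mulrN1.
Qed.

Lemma is_derive_hKyD x y s : s != 0 ->
  is_derive y (1 : R) (fun u => hK (x + u) s) (hKz (x + y) s).
Proof.
move=> s0; have H := is_derive_hKz (x + y) s0.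
have H' : is_derive y (1 : R) (fun u : R => x + u) 1.
  by apply: is_derive_eq; rewrite /GRing.scale /=; ring.
rewrite -[hKz _ _]mulr1.
exact: (@is_derive1_comp _ (hK ^~ s) _ _ _ _ H H').
Qed.

Lemma is_derive_hKzyN x y s : s != 0 ->
  is_derive y (1 : R) (fun u => hKz (x - u) s) (- hKzz (x - y) s).
Proof.
move=> s0; have H := is_derive_hKzz (x - y) s0.
have H' : is_derive y (1 : R) (fun u : R => x - u) (-1).
  by apply: is_derive_eq; rewrite /GRing.scale /=; ring.
by have := @is_derive1_comp R (hKz ^~ s) (fun u => x - u) y _ _ H H'; rewrite mulrN1.
Qed.

Lemma is_derive_hKzyD x y s : s != 0 ->
  is_derive y (1 : R) (fun u => hKz (x + u) s) (hKzz (x + y) s).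
Proof.
move=> s0; have H := is_derive_hKzz (x + y) s0.
have H' : is_derive y (1 : R) (fun u : R => x + u) 1.
  by apply: is_derive_eq; rewrite /GRing.scale /=; ring.
rewrite -[hKzz _ _]mulr1.
exact: (@is_derive1_comp _ (hKz ^~ s) _ _ _ _ H H').
Qed.

(** Of these three, [hGyy] plays a triple role: it is the second derivative of [hG] in [y], the
    second derivative in [x], and the derivative in [s]. *)
Definition hGy x y s := - hKz (x - y) s - hKz (x + y) s.
Definition hGx x y s := hKz (x - y) s - hKz (x + y) s.
Definition hGyy x y s := hKzz (x - y) s - hKzz (x + y) s.

Lemma is_derive_hG_y x y s : s != 0 -> is_derive y (1 : R) (hG x ^~ s) (hGy x y s).
Proof.
move=> s0; have h1 := is_derive_hKyN x y s0; have h2 := is_derive_hKyD x y s0.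
exact: is_deriveB.
Qed.

Lemma is_derive_hGy_y x y s : s != 0 -> is_derive y (1 : R) (hGy x ^~ s) (hGyy x y s).
Proof.
move=> s0; have h1 := is_derive_hKzyN x y s0; have h2 := is_derive_hKzyD x y s0.
by apply: is_derive_eq; rewrite opprK.
Qed.

Lemma is_derive_shift (f : R -> R) (x y d : R) : is_derive (x + y) (1 : R) f d ->
  is_derive x (1 : R) (fun u => f (u + y)) d.
Proof.
move=> H; have H' : is_derive x (1 : R) (fun u : R => u + y) 1.
  by apply: is_derive_eq; rewrite /GRing.scale /=; ring.
by have := @is_derive1_comp R f (fun u => u + y) x d 1 H H'; rewrite mulr1.
Qed.

Lemma is_derive_hG_x x y s : s != 0 -> is_derive x (1 : R) (fun u => hG u y s) (hGx x y s).
Proof.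
move=> s0; have h1 := is_derive_shift (is_derive_hKz (x - y) s0).
have h2 := is_derive_shift (is_derive_hKz (x + y) s0).
exact: is_deriveB.
Qed.

Lemma is_derive_hGx_x x y s : s != 0 -> is_derive x (1 : R) (fun u => hGx u y s) (hGyy x y s).
Proof.
move=> s0; have h1 := is_derive_shift (is_derive_hKzz (x - y) s0).
have h2 := is_derive_shift (is_derive_hKzz (x + y) s0).
exact: is_deriveB.
Qed.

Lemma is_derive_hG_s x y s : 0 < s -> is_derive s (1 : R) (hG x y) (hGyy x y s).
Proof.
move=> s0; have h1 := is_derive_hKs (x - y) s0; have h2 := is_derive_hKs (x + y) s0.
exact: is_deriveB.
Qed.

Lemma is_derive_continuous (f : R -> R) (x d : R) : is_derive x (1 : R) f d ->
  {for x, continuous f}.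
Proof.
by move=> H; apply: differentiable_continuous; apply/derivable1_diffP; apply: ex_derive.
Qed.

Lemma continuous_hGyy x y s : s != 0 -> {for y, continuous (hGyy x ^~ s)}.
Proof.
move=> s0; rewrite /hGyy /hKzz.
have h1 := is_derive_hKyN x y s0; have h2 := is_derive_hKyD x y s0.
apply: (@is_derive_continuous _ _ _ _).
Qed.

Lemma measurable_hG x s : measurable_fun setT (hG x ^~ s).
Proof.
have [s0|s0] := leP s 0.
  rewrite (_ : (fun y => _) = cst 0) //; apply/funext => y.
  by rewrite /hG !hK_le0// subrr.
apply: continuous_measurable_fun => y; exact: is_derive_continuous.
Qed.

Lemma measurable_hGx x s : s != 0 -> measurable_fun setT (hGx x ^~ s).
Proof.
move=> s0; apply: continuous_measurable_fun => y; rewrite /hGx.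
have h1 := is_derive_hKzyN x y s0; have h2 := is_derive_hKzyD x y s0.
exact: (is_derive_continuous (is_deriveB h1 h2)).
Qed.

Lemma measurable_hGyy x s : s != 0 -> measurable_fun setT (hGyy x ^~ s).
Proof.
move=> s0; apply: continuous_measurable_fun => y; exact: continuous_hGyy.
Qed.

Lemma hG_bounds (a b X : R) : 0 < a -> exists2 C : R, 0 < C &
  forall x y s, `|x| <= X -> a <= s <= b ->
  [/\ `|hG x y s| <= C * (1 + y ^+ 2)^-1,
      `|hGx x y s| <= C * (1 + y ^+ 2)^-1,
      `|hGy x y s| <= C * (1 + y ^+ 2)^-1 &
      `|hGyy x y s| <= C * (1 + y ^+ 2)^-1].
Proof.
move=> a0; have [C C0 CP] := hK_bounds b X a0; exists (2 * C); first by rewrite mulr_gt0.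
move=> x y s xX sab; have [A1 A2 A3] := CP x y s xX sab.
have [] := CP x (- y) s xX sab; rewrite opprK sqrrN => B1 B2 B3.
have E : 2 * C * (1 + y ^+ 2)^-1 = C * (1 + y ^+ 2)^-1 + C * (1 + y ^+ 2)^-1 by ring.
split; rewrite E; apply: (le_trans (ler_normB _ _)); apply: lerD => //.
- by rewrite ger0_norm ?hK_ge0.
- by rewrite ger0_norm ?hK_ge0.
- by rewrite normrN.
Qed.

End Kernel.

Arguments hK {R} z s.
Arguments hKz {R} z s.
Arguments hKzz {R} z s.
Arguments hG {R} x y s.
Arguments hGx {R} x y s.
Arguments hGy {R} x y s.
Arguments hGyy {R} x y s.

(** * Heat potential of a function on the half-line *)

Section HalfLine.
Variable R : realType.
Notation mu := (@lebesgue_measure R).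
Notation itg D f := (mu.-integrable D (EFin \o f)).
Notation D0 := (`]0, +oo[%classic : set R).
Implicit Types (x y z s c e : R) (v w k B : R -> R).

Lemma D0P y : D0 y = (0 < y) :> Prop.
Proof. by rewrite /= in_itv/= andbT. Qed.

Lemma cvg0_norm_le (T : Type) (F : set_system T) {FF : Filter F} (f g : T -> R) :
  (\forall x \near F, `|f x| <= g x) -> g x @[x --> F] --> 0 -> f x @[x --> F] --> 0.
Proof.
move=> fg g0; apply/cvgr0Pnorm_le => e e0.
apply: filterS2 fg (cvgr0_norm_le _ g0 e e0) => x h1 h2.
exact: le_trans h1 (le_trans (ler_norm _) h2).
Qed.

Lemma cvg_oneDsqrV_y : (1 + y ^+ 2)^-1 @[y --> +oo] --> (0 : R).
Proof.
apply/gtr0_cvgV0.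
  by near=> y; rewrite ltr_pwDl ?sqr_ge0.
apply/cvgryPge => A; near=> y.
have y1 : 1 <= y by near: y; exact: nbhs_pinfty_ge.
have yA : A <= y by near: y; apply: nbhs_pinfty_ge; exact: num_real.
nra.
Unshelve. all: by end_near. Qed.

Lemma itg_oneDsqrV0 : itg D0 (fun y => (1 + y ^+ 2)^-1).
Proof. by apply: integrableS (@itg_oneDsqrV R). Qed.

Lemma oneDsqrV_ge0 y : 0 <= (1 + y ^+ 2)^-1.
Proof. by rewrite invr_ge0 addr_ge0 ?sqr_ge0. Qed.

Lemma oneDsqrV_le1' y : (1 + y ^+ 2)^-1 <= 1.
Proof. by rewrite invf_le1 ?lerDl ?sqr_ge0// ltr_pwDl ?sqr_ge0. Qed.

(** If [|v| <= c + B], then [v] times a kernel of size [C * (1 + y ^+ 2)^-1] is at most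
    [C * weight c B]: the constant part borrows the decay of the kernel, while [B] is integrable by
    itself. *)
Definition weight c B y := c * (1 + y ^+ 2)^-1 + B y.

(** A common class for Schwartz data, with [c = 0], and for time slices of a solution with
    [|v|^2 <= B], where [|v| <= 1 + B] gives [c = 1]. *)
Definition dominated v c B :=
  [/\ measurable_fun D0 v, 0 <= c, itg D0 B, forall y, 0 < y -> 0 <= B y &
      forall y, 0 < y -> `|v y| <= c + B y].

Lemma itg_weight c B : itg D0 B -> itg D0 (weight c B).
Proof.
by move=> Bi; apply: itgD => //; apply: itgZl => //; exact: itg_oneDsqrV0.
Qed.

Lemma weight_ge v c B y C : 0 <= c -> 0 < y -> 0 <= B y -> 0 <= C -> `|v y| <= c + B y ->
  `|v y| * (C * (1 + y ^+ 2)^-1) <= C * weight c B y.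
Proof.
move=> c0 y0 B0 C0 vb; have o0 := oneDsqrV_ge0 y; have o1 := oneDsqrV_le1' y.
rewrite mulrCA ler_wpM2l//; apply: (@le_trans _ _ ((c + B y) * (1 + y ^+ 2)^-1)).
  by rewrite ler_wpM2r.
by rewrite mulrDl /weight lerD2l ler_piMr.
Qed.

Lemma itg_dominatedM v c B k C : dominated v c B -> measurable_fun D0 k -> 0 <= C ->
  (forall y, 0 < y -> `|k y| <= C * (1 + y ^+ 2)^-1) ->
  itg D0 (fun y => v y * k y).
Proof.
move=> [mv c0 Bi B0 vb] mk C0 kb.
apply: (@itg_le _ _ _ (fun y => C * weight c B y)) => //.
- exact: measurable_funM.
- move=> y; rewrite D0P => y0; rewrite normrM.
  apply: le_trans (weight_ge c0 y0 (B0 _ y0) C0 (vb _ y0)).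
  by rewrite ler_wpM2l// kb.
- by apply: itgZl => //; exact: itg_weight.
Qed.

(** The Dirichlet heat semigroup applied to [v]; its time derivative is [hPxx], by the heat equation
    for the kernel. *)
Definition hP v x s := \int[mu]_(y in D0) (v y * hG x y s).
Definition hPx v x s := \int[mu]_(y in D0) (v y * hGx x y s).
Definition hPxx v x s := \int[mu]_(y in D0) (v y * hGyy x y s).

Lemma itg_hP v c B x s : dominated v c B -> 0 < s ->
  [/\ itg D0 (fun y => v y * hG x y s), itg D0 (fun y => v y * hGx x y s) &
      itg D0 (fun y => v y * hGyy x y s)].
Proof.
move=> vd s0; have [C C0 CP] := @hG_bounds R s s `|x| s0.
have s0' : s != 0 by rewrite gt_eqF.
have H y : [/\ `|hG x y s| <= C * (1 + y ^+ 2)^-1,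
      `|hGx x y s| <= C * (1 + y ^+ 2)^-1,
      `|hGy x y s| <= C * (1 + y ^+ 2)^-1 &
      `|hGyy x y s| <= C * (1 + y ^+ 2)^-1] by apply: CP; rewrite ?lexx.
split; apply: (itg_dominatedM vd _ (ltW C0)) => [|y y0].
- by apply: measurable_funTS; exact: measurable_hG.
- by have [] := H y.
- by apply: measurable_funTS; exact: measurable_hGx.
- by have [] := H y.
- by apply: measurable_funTS; exact: measurable_hGyy.
- by have [] := H y.
Qed.

Lemma is_derive_hP_x v c B x s : dominated v c B -> 0 < s ->
  is_derive x (1 : R) (hP v ^~ s) (hPx v x s).
Proof.
move=> vd s0; have [mv c0 Bi B0 vb] := vd.
have s0' : s != 0 by rewrite gt_eqF.
have [C C0 CP] := @hG_bounds R s s (`|x| + 1) s0.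
apply: (@is_derive_under _ D0 (fun x y => v y * hG x y s)
  (fun x y => v y * hGx x y s) x (x - 1) (x + 1) (fun y => C * weight c B y)) => //.
- by apply/andP; split; lra.
- by move=> x' _; have [] := itg_hP x' vd s0.
- move=> x' y _ _; have H := is_derive_hG_x x' y s0'.
  by apply: is_derive_eq; rewrite /GRing.scale /= ?mulr0 ?addr0.
- by apply: itgZl => //; exact: itg_weight.
- move=> x' y /andP[x1 x2]; rewrite D0P => y0; rewrite normrM.
  apply: le_trans (weight_ge c0 y0 (B0 _ y0) (ltW C0) (vb _ y0)).
  rewrite ler_wpM2l//; have [] // := CP x' y s; rewrite ?lexx//.
  have : `|x'| <= `|x| + `|x' - x| by rewrite -{1}[x'](subrK x) addrC ler_normD.
  move=> h; apply: (le_trans h); rewrite lerD2l ler_norml; apply/andP; split; lra.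
Qed.

Lemma is_derive_hP_xx v c B x s : dominated v c B -> 0 < s ->
  is_derive x (1 : R) (hPx v ^~ s) (hPxx v x s).
Proof.
move=> vd s0; have [mv c0 Bi B0 vb] := vd.
have s0' : s != 0 by rewrite gt_eqF.
have [C C0 CP] := @hG_bounds R s s (`|x| + 1) s0.
apply: (@is_derive_under _ D0 (fun x y => v y * hGx x y s)
  (fun x y => v y * hGyy x y s) x (x - 1) (x + 1) (fun y => C * weight c B y)) => //.
- by apply/andP; split; lra.
- by move=> x' _; have [] := itg_hP x' vd s0.
- move=> x' y _ _; have H := is_derive_hGx_x x' y s0'.
  by apply: is_derive_eq; rewrite /GRing.scale /= ?mulr0 ?addr0.
- by apply: itgZl => //; exact: itg_weight.
- move=> x' y /andP[x1 x2]; rewrite D0P => y0; rewrite normrM.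
  apply: le_trans (weight_ge c0 y0 (B0 _ y0) (ltW C0) (vb _ y0)).
  rewrite ler_wpM2l//; have [] // := CP x' y s; rewrite ?lexx//.
  have : `|x'| <= `|x| + `|x' - x| by rewrite -{1}[x'](subrK x) addrC ler_normD.
  move=> h; apply: (le_trans h); rewrite lerD2l ler_norml; apply/andP; split; lra.
Qed.

Lemma is_derive_hP_s v c B x s : dominated v c B -> 0 < s ->
  is_derive s (1 : R) (hP v x) (hPxx v x s).
Proof.
move=> vd s0; have [mv c0 Bi B0 vb] := vd.
have s20 : 0 < s / 2 by rewrite divr_gt0.
have [C C0 CP] := @hG_bounds R (s / 2) (s + 1) `|x| s20.
apply: (@is_derive_under _ D0 (fun s y => v y * hG x y s)
  (fun s y => v y * hGyy x y s) s (s / 2) (s + 1) (fun y => C * weight c B y)) => //.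
- by apply/andP; split; lra.
- by move=> s' /andP[s1 s2]; have [] := itg_hP x vd (lt_trans s20 s1).
- move=> s' y /andP[s1 s2] _; have H := is_derive_hG_s x y (lt_trans s20 s1).
  by apply: is_derive_eq; rewrite /GRing.scale /= ?mulr0 ?addr0.
- by apply: itgZl => //; exact: itg_weight.
- move=> s' y /andP[s1 s2]; rewrite D0P => y0; rewrite normrM.
  apply: le_trans (weight_ge c0 y0 (B0 _ y0) (ltW C0) (vb _ y0)).
  by rewrite ler_wpM2l//; have [] // := CP x y s'; rewrite ?lexx// !ltW.
Qed.

(** [hG] lies between [0] and [hK (x - y) s], which has mass one. The bound carries no power of [s],
    so it survives as [s] tends to [0]. *)
Lemma hP_bound v x s (M : R) : measurable_fun D0 v -> (forall y, 0 < y -> `|v y| <= M) ->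
  0 <= x -> 0 < s -> `|hP v x s| <= M.
Proof.
move=> mv vM x0 s0.
have M0 : 0 <= M by apply: le_trans (vM 1 _).
have Ki := itg_hK x s0.
have Ki0 : itg D0 (fun y => hK (x - y) s) by apply: integrableS Ki.
apply: (@le_trans _ _ (\int[mu]_(y in D0) (M * hK (x - y) s))).
  apply: normRint_le => //.
  - by apply: measurable_funM => //; apply: measurable_funTS; exact: measurable_hG.
  - move=> y; rewrite D0P => y0; rewrite normrM ler_pM// ?vM//.
    by apply: hG_le => //; exact: ltW.
  - exact: itgZl.
rewrite RintegralZl// ler_piMr// -(Rint_hK x s0) Rintegral_mkcond.
apply: le_Rintegral => //.
- by apply: (@itg_le _ _ _ (fun y => hK (x - y) s)) => //;
   [apply/(measurable_restrictT _ _).1 => //; exact: itg_measurable Ki0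
   |move=> y _; rewrite /patch; case: ifP => _; rewrite ?normr0 ?ger0_norm ?hK_ge0].
- by move=> y _; rewrite /patch; case: ifP => _; rewrite ?hK_ge0.
Qed.

(** The unit mass of [hK] turns the difference into one integral over the line. Near [x] the
    oscillation [e] of [w] enters; the far zone, the reflected kernel and the half-line [y <= 0] are
    all of order [s] by [hK_far]. The constant is quantified before [w], because [w] will be a time
    slice that moves together with [s]. *)
Lemma hP_approx x d c B (L0 : R) : 0 < x -> 0 < d -> 0 <= c -> itg D0 B ->
  (forall y, 0 < y -> 0 <= B y) ->
  exists C, forall w L e s, 0 < s <= 1 -> `|L| <= L0 -> 0 <= e ->
  dominated w c B ->
  (forall y, 0 < y -> `|y - x| < d -> `|w y - L| <= e) ->
  `|hP w x s - L| <= e + C * s.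
Proof.
move=> x0 d0 c0 Bi B0.
(* Since [d' <= x], every [y <= 0], and so every reflected point [- y], lies in the far zone. *)
pose d' := Num.min d x.
have d'0 : 0 < d' by rewrite lt_min d0 x0.
have [C1 C10 C1P] := @hK_far R d' 1 x d'0 ltr01.
have {}C1P y s : d' <= `|x - y| -> 0 < s <= 1 -> hK (x - y) s <= C1 * s * (1 + y ^+ 2)^-1.
  move=> h /[dup] s01 /andP[s0 s1].
  have x1 : `|x| <= x by rewrite ger0_norm// ltW.
  apply: (le_trans (C1P _ _ _ x1 h s01)).
  rewrite ler_wpM2r ?oneDsqrV_ge0// ler_wpM2l ?(ltW C10)//.
  by rewrite exprS ler_piMr ?(ltW s0)// exprn_ile1// ltW.
(* The factor [2] serves the direct and the reflected kernel; the [L0] term pays for the subtracted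
   constant, on the negative half-line as well. *)
pose Wt y := ((fun y => 2 * weight c B y) \_ D0) y + L0 * (1 + y ^+ 2)^-1.
have Wi : itg setT Wt.
  apply: itgD => //; last by apply: itgZl => //; exact: itg_oneDsqrV.
  have := (integrable_mkcond (mu := mu) (EFin \o (fun y => 2 * weight c B y)) (measurable_itv `]0, +oo[)).1.
  rewrite restrict_EFin; apply; apply: itgZl => //; exact: itg_weight.
exists (C1 * \int[mu]_y Wt y) => w L e s /[dup] s01 /andP[s0 s1] LL0 e0 wd wL.
have [mw _ _ _ wb] := wd.
have L00 : 0 <= L0 by apply: le_trans LL0.
have Ki := itg_hK x s0.
have [wGi _ _] := itg_hP x wd s0.
have wGi' : itg setT ((fun y => w y * hG x y s) \_ D0).
  have := (integrable_mkcond (mu := mu) (EFin \o (fun y => w y * hG x y s)) (measurable_itv `]0, +oo[)).1.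
  by rewrite restrict_EFin; apply.
have -> : hP w x s - L = \int[mu]_y (((fun y => w y * hG x y s) \_ D0) y - L * hK (x - y) s).
  rewrite RintegralB//; last exact: itgZl.
  by rewrite RintegralZl// Rint_hK// mulr1 -Rintegral_mkcond.
have -> : e + C1 * (\int[mu]_y Wt y) * s = \int[mu]_y (e * hK (x - y) s + C1 * s * Wt y).
  have i1 : itg setT (fun y => e * hK (x - y) s) by apply: itgZl.
  have i2 : itg setT (fun y => C1 * s * Wt y) by apply: itgZl.
  have E1 : \int[mu]_y (e * hK (x - y) s) = e by rewrite RintegralZl// Rint_hK// mulr1.
  have E2 : \int[mu]_y (C1 * s * Wt y) = C1 * (\int[mu]_y Wt y) * s.
    by rewrite RintegralZl// mulrAC.
  by rewrite -[X in X + _ = _]E1 -[X in _ + X = _]E2; symmetry; apply: RintegralD.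
apply: normRint_le => //.
- apply: itg_measurable; apply: itgB => //; exact: itgZl.
- move=> y _; rewrite /Wt /patch.
  have C1s : 0 <= C1 * s by rewrite mulr_ge0 ?ltW.
  have K0 := hK_ge0 (x - y) s; have K0' := hK_ge0 (x + y) s.
  have LK : `|L * hK (x - y) s| <= L0 * hK (x - y) s.
    by rewrite normrM (ger0_norm K0) ler_wpM2r.
  have o0 := oneDsqrV_ge0 y; have o1 := oneDsqrV_le1' y.
  case: ifPn => [/set_mem|/negP]; last first.
    move=> ny; have y0 : y <= 0 by rewrite leNgt; apply/negP => y0; apply: ny; rewrite inE D0P.
    rewrite sub0r normrN add0r (le_trans LK)//.
    have h : hK (x - y) s <= C1 * s * (1 + y ^+ 2)^-1.
      by apply: C1P => //; rewrite ge_min; apply/orP; right; rewrite ger0_norm; lra.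
    apply: (@le_trans _ _ (L0 * (C1 * s * (1 + y ^+ 2)^-1))); first by rewrite ler_wpM2l.
    by rewrite mulrCA lerDr mulr_ge0.
  rewrite D0P => y0; have := wb y y0 => wy; have By := B0 _ y0.
  have h' : hK (x + y) s <= C1 * s * (1 + y ^+ 2)^-1.
    have := @C1P (- y) s; rewrite opprK sqrrN; apply => //.
    by rewrite ge_min; apply/orP; right; rewrite ger0_norm; lra.
  have ww := weight_ge c0 y0 By C1s wy.
  have ww' : `|w y| * hK (x + y) s <= C1 * s * weight c B y.
    by apply: le_trans ww; rewrite ler_wpM2l.
  have W0 : 0 <= weight c B y by rewrite /weight addr_ge0// mulr_ge0.
  have [near|far] := ltP `|y - x| d'.
    have := wL y y0; rewrite (lt_le_trans near) ?ge_min ?lexx// => /(_ isT) h.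
    have -> : w y * hG x y s - L * hK (x - y) s = (w y - L) * hK (x - y) s - w y * hK (x + y) s.
      by rewrite /hG; ring.
    apply: (le_trans (ler_normB _ _)).
    rewrite (normrM (w y - L)) (normrM (w y)) (ger0_norm K0) (ger0_norm K0').
    apply: lerD; first by rewrite ler_wpM2r.
    apply: (le_trans ww'); rewrite ler_wpM2l//.
    have : 0 <= L0 * (1 + y ^+ 2)^-1 by rewrite mulr_ge0.
    lra.
  rewrite distrC in far; have h := C1P y s far s01.
  have ww2 : `|w y| * hK (x - y) s <= C1 * s * weight c B y.
    by apply: le_trans ww; rewrite ler_wpM2l.
  have -> : w y * hG x y s - L * hK (x - y) s = (w y * hK (x - y) s - w y * hK (x + y) s) - L * hK (x - y) s.
    by rewrite /hG; ring.
  apply: (le_trans (ler_normB _ _)).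
  have e1 := ler_normB (w y * hK (x - y) s) (w y * hK (x + y) s).
  rewrite !(normrM (w y)) (ger0_norm K0) (ger0_norm K0') in e1.
  have e2 : L0 * hK (x - y) s <= L0 * (C1 * s * (1 + y ^+ 2)^-1) by rewrite ler_wpM2l.
  have e3 : 0 <= e * hK (x - y) s by rewrite mulr_ge0.
  have -> : C1 * s * (2 * weight c B y + L0 * (1 + y ^+ 2)^-1) =
    C1 * s * weight c B y + C1 * s * weight c B y + L0 * (C1 * s * (1 + y ^+ 2)^-1) by ring.
  lra.
- by apply: itgD => //; exact: itgZl.
Qed.

(** The normal derivative of the Dirichlet kernel at [y = 0], as [hGy0] shows: the Poisson kernel of
    the half-line. *)
Definition hh x s := x / s * hK x s.

Lemma hGy0 x s : s != 0 -> hGy x 0 s = hh x s.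
Proof. by move=> s0; rewrite /hGy /hKz /hh subr0 addr0; field. Qed.

(** [phi * hGyy - phi2 * hG] is the [y]-derivative of [phi * hGy - phi1 * hG]. At infinity the decay
    of the kernel beats the bounded [phi] and [phi1]; at [0] the kernel vanishes and [hGy] becomes
    [hh], so only the trace [l] survives. *)
Lemma hP_green (phi phi1 phi2 : R -> R) (l M : R) x s c B c2 B2 :
  0 < s ->
  (forall y, 0 < y -> is_derive y (1 : R) phi (phi1 y)) ->
  (forall y, 0 < y -> is_derive y (1 : R) phi1 (phi2 y)) ->
  (forall y, 0 < y -> {for y, continuous phi2}) ->
  dominated phi c B -> dominated phi2 c2 B2 ->
  phi y @[y --> 0^'+] --> l ->
  (\forall y \near +oo, `|phi y| <= M) ->
  (forall y, 0 < y -> `|phi1 y| <= M) ->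
  hPxx phi x s = hP phi2 x s - l * hh x s.
Proof.
move=> s0 d1 d2 c2' pd p2d pl pM p1M.
have s0' : s != 0 by rewrite gt_eqF.
have [_ _ I1] := itg_hP x pd s0; have [I2 _ _] := itg_hP x p2d s0.
have [C C0 CP] := @hG_bounds R s s `|x| s0.
have M0 : 0 <= M by apply: le_trans (p1M 1 _).
have cG y : {for y, continuous (hG x ^~ s)}.
  exact: (is_derive_continuous (is_derive_hG_y x y s0')).
have cGy y : {for y, continuous (hGy x ^~ s)}.
  exact: (is_derive_continuous (is_derive_hGy_y x y s0')).
have := @FTC_0y R (fun y => phi y * hGy x y s - phi1 y * hG x y s)
  (fun y => phi y * hGyy x y s - phi2 y * hG x y s) (l * hh x s) 0.
rewrite RintegralB// => H.
suff : \int[mu]_(y in D0) (phi y * hGyy x y s) - \int[mu]_(y in D0) (phi2 y * hG x y s) =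
   0 - l * hh x s by rewrite /hPxx /hP; lra.
apply: H.
- move=> y y0; have h1 := d1 y y0; have h2 := d2 y y0.
  have h3 := is_derive_hG_y x y s0'; have h4 := is_derive_hGy_y x y s0'.
  by apply: is_derive_eq; rewrite /GRing.scale /=; ring.
- move=> y y0; apply: cvgB; apply: cvgM.
  + exact: (is_derive_continuous (d1 y y0)).
  + exact: continuous_hGyy.
  + exact: c2'.
  + exact: cG.
- exact: itgB.
- rewrite -[X in _ --> X]subr0; apply: cvgB.
    apply: cvgM => //; rewrite -hGy0//.
    by apply: cvg_at_right_filter; exact: cGy.
  have G0 : hG x y s @[y --> 0^'+] --> 0.
    rewrite [X in _ --> X](_ : _ = hG x 0 s); last by rewrite /hG subr0 addr0 subrr.
    by apply: cvg_at_right_filter; exact: cG.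
  apply: (@cvg0_norm_le _ _ _ _ (fun y => M * `|hG x y s|)).
    near=> y; rewrite normrM ler_wpM2r//; apply: p1M.
    by near: y; exact: nbhs_right_gt.
  rewrite [X in _ --> X](_ : 0 = M * `|0 : R|); last by rewrite normr0 mulr0.
  apply: cvgM; first exact: cvg_cst.
  exact: cvg_norm.
- apply: (@cvg0_norm_le _ _ _ _ (fun y => (M * C + M * C) * (1 + y ^+ 2)^-1)).
    near=> y; have y0 : 0 < y by near: y; exact: nbhs_pinfty_gt.
    have [h1 h2 h3 h4] := CP x y s (lexx _) ltac:(by rewrite !lexx).
    apply: (le_trans (ler_normB _ _)); rewrite mulrDl !normrM -!mulrA.
    by apply: lerD; apply: ler_pM => //; [near: y|exact: p1M].
  rewrite -[X in _ --> X](mulr0 (M * C + M * C)); apply: cvgM; first exact: cvg_cst.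
  exact: cvg_oneDsqrV_y.
Unshelve. all: by end_near. Qed.

End HalfLine.

Arguments hP {R} v x s.
Arguments hPx {R} v x s.
Arguments hPxx {R} v x s.
Arguments hh {R} x s.

(** * Boundary potential, and limits at the edges of the quadrant *)

Section Boundary.
Variable R : realType.
Notation mu := (@lebesgue_measure R).
Notation itg D f := (mu.-integrable D (EFin \o f)).
Notation D0 := (`]0, +oo[%classic : set R).
Implicit Types (x y z s t c e : R) (v w k B : R -> R).

Lemma is_derive_near (f g : R -> R) (a d : R) : {near a, f =1 g} ->
  is_derive a (1 : R) f d -> is_derive a (1 : R) g d.
Proof.
move=> fg H; apply: DeriveDef.
  by apply: (near_eq_derivable fg); apply: ex_derive.
by rewrite -(near_eq_derive _ fg) derive_val.
Qed.

(** Together with [hhs] below, which is both the [x]-derivative of [hhx] and the [s]-derivative of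
    [hh], it expresses that [hh] solves the heat equation. *)
Definition hhx x s := (s^-1 - x ^+ 2 / (2 * s ^+ 2)) * hK x s.
Definition hhs x s := (x ^+ 3 / (4 * s ^+ 3) - 3 * x / (2 * s ^+ 2)) * hK x s.

Lemma hh_le0 x s : s <= 0 -> hh x s = 0.
Proof. by move=> s0; rewrite /hh hK_le0// mulr0. Qed.

(** For [x] away from [0] the factor [s^5] of [hK_far] absorbs the poles of the prefactors, at most
    [s^-3], and leaves [s^2]. For [s <= 0] everything vanishes, so no lower limit on [s] is
    required. *)
Lemma hh_bounds (d X T : R) : 0 < d -> 0 < X -> 0 < T -> exists2 C : R, 0 < C &
  forall x s, d <= x <= X -> s <= T ->
  [/\ `|hh x s| <= C * s ^+ 2, `|hhx x s| <= C, `|hhs x s| <= C & `|hh x s| <= C].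
Proof.
move=> d0 X0 T0; have [C C0 CP] := @hK_far R d T X d0 T0.
pose m := 1 + X + X ^+ 2 + X ^+ 3.
pose n := 1 + T + T ^+ 2 + T ^+ 3 + T ^+ 4.
have m0 : 0 < m by rewrite /m !addr_gt0 ?exprn_gt0.
have n0 : 0 < n by rewrite /n !addr_gt0 ?exprn_gt0.
have n1 : 1 <= n by rewrite /n; have := exprn_gt0 2 T0; have := exprn_gt0 3 T0; have := exprn_gt0 4 T0; lra.
have m1 : 1 <= m by rewrite /m; have := exprn_gt0 2 X0; have := exprn_gt0 3 X0; lra.
pose p := 2 * (m * n); have p0 : 0 < p by rewrite /p mulr_gt0// mulr_gt0.
exists (p * C * n); first by rewrite mulr_gt0// mulr_gt0.
move=> x s /andP[dx xX] sT.
have C'0 : 0 <= p * C * n by rewrite !mulr_ge0// ltW.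
have [s0|s0] := leP s 0.
  rewrite /hhx /hhs hh_le0// hK_le0// !mulr0 normr0; split => //.
  by rewrite mulr_ge0// sqr_ge0.
have x0 : 0 < x by exact: lt_le_trans dx.
have K5 : hK x s <= C * s ^+ 5.
  have := CP x 0 s; rewrite subr0 expr0n addr0 invr1 mulr1; apply.
  - by rewrite ger0_norm// ltW.
  - by rewrite (le_trans dx)// ler_norm.
  - by rewrite s0.
have K0 := hK_ge0 x s.
have s20 : 0 <= s ^+ 2 by rewrite sqr_ge0.
have Cs : 0 <= C * s ^+ 2 by rewrite mulr_ge0// ltW.
have key (q : R) : `|q| * s ^+ 3 <= p -> `|q * hK x s| <= p * C * s ^+ 2.
  move=> qp; rewrite normrM (ger0_norm K0).
  apply: (@le_trans _ _ (`|q| * (C * s ^+ 5))); first by rewrite ler_wpM2l.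
  have -> : `|q| * (C * s ^+ 5) = (`|q| * s ^+ 3) * (C * s ^+ 2) by ring.
  by rewrite -[leRHS]mulrA ler_wpM2r.
have x2 : x ^+ 2 <= X ^+ 2 by rewrite lerXn2r ?nnegrE// ltW.
have x3 : x ^+ 3 <= X ^+ 3 by rewrite lerXn2r ?nnegrE// ltW.
have s2T : s ^+ 2 <= T ^+ 2 by rewrite lerXn2r ?nnegrE// ltW.
have s3T : s ^+ 3 <= T ^+ 3 by rewrite lerXn2r ?nnegrE// ltW.
have sm : 1 + s + s ^+ 2 + s ^+ 3 <= n by rewrite /n; have := exprn_gt0 4 T0; lra.
have xm : 1 + x + x ^+ 2 + x ^+ 3 <= m by rewrite /m; lra.
have s30 : 0 <= s ^+ 3 by rewrite exprn_ge0// ltW.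
have x20 : 0 <= x ^+ 2 by rewrite sqr_ge0.
have x30 : 0 <= x ^+ 3 by rewrite exprn_ge0// ltW.
have b1 (a b : R) : 0 <= a <= m -> 0 <= b <= n -> a * b <= m * n.
  by move=> /andP[a0 am] /andP[b0 bn]; apply: ler_pM.
have B1 : x * s ^+ 2 <= m * n by apply: b1; apply/andP; split; lra.
have B2 : 1 * s ^+ 2 <= m * n by apply: b1; apply/andP; split; lra.
have B3 : x ^+ 2 * s <= m * n by apply: b1; apply/andP; split; lra.
have B4 : x ^+ 3 * 1 <= m * n by apply: b1; apply/andP; split; lra.
have B5 : x * s <= m * n by apply: b1; apply/andP; split; lra.
have mn0 : 0 < m * n by rewrite mulr_gt0.
have E1 : `|x / s| * s ^+ 3 <= p.
  rewrite ger0_norm ?divr_ge0 ?ltW//.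
  have -> : x / s * s ^+ 3 = x * s ^+ 2 by field; rewrite gt_eqF.
  by rewrite /p; lra.
have E2 : `|s^-1 - x ^+ 2 / (2 * s ^+ 2)| * s ^+ 3 <= p.
  apply: (@le_trans _ _ ((s^-1 + x ^+ 2 / (2 * s ^+ 2)) * s ^+ 3)).
    rewrite ler_wpM2r//; apply: (le_trans (ler_normB _ _)).
    have i1 : 0 <= s^-1 by rewrite invr_ge0 ltW.
    have i2 : 0 <= x ^+ 2 / (2 * s ^+ 2) by apply: divr_ge0 => //; apply: mulr_ge0.
    by rewrite (ger0_norm i1) (ger0_norm i2).
  have -> : (s^-1 + x ^+ 2 / (2 * s ^+ 2)) * s ^+ 3 = s ^+ 2 + x ^+ 2 * s / 2.
    by field; rewrite gt_eqF.
  by rewrite /p; lra.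
have E3 : `|x ^+ 3 / (4 * s ^+ 3) - 3 * x / (2 * s ^+ 2)| * s ^+ 3 <= p.
  apply: (@le_trans _ _ ((x ^+ 3 / (4 * s ^+ 3) + 3 * x / (2 * s ^+ 2)) * s ^+ 3)).
    rewrite ler_wpM2r//; apply: (le_trans (ler_normB _ _)).
    have i1 : 0 <= x ^+ 3 / (4 * s ^+ 3) by apply: divr_ge0 => //; apply: mulr_ge0.
    have i2 : 0 <= 3 * x / (2 * s ^+ 2).
      by apply: divr_ge0; apply: mulr_ge0 => //; exact: ltW.
    by rewrite (ger0_norm i1) (ger0_norm i2).
  have -> : (x ^+ 3 / (4 * s ^+ 3) + 3 * x / (2 * s ^+ 2)) * s ^+ 3 = x ^+ 3 / 4 + 3 / 2 * (x * s).
    by field; rewrite gt_eqF.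
  by rewrite /p; lra.
have pC : 0 <= p * C by rewrite mulr_ge0// ltW.
have fin : p * C * s ^+ 2 <= p * C * n by rewrite ler_wpM2l//; lra.
split.
- apply: (le_trans (key _ E1)); apply: ler_wpM2r => //.
  by rewrite ler_peMr.
- exact: (le_trans (key _ E2)).
- exact: (le_trans (key _ E3)).
- exact: (le_trans (key _ E1)).
Qed.

Lemma is_derive_hh_x x s : is_derive x (1 : R) (hh ^~ s) (hhx x s).
Proof.
have [s0|s0] := leP s 0.
  rewrite /hhx hK_le0// mulr0 (_ : hh ^~ s = cst (0 : R)).
    exact: is_derive_cst.
  by apply/funext => y; rewrite hh_le0.
have s0' : s != 0 by rewrite gt_eqF.
have H := is_derive_hKz x s0'.
by apply: is_derive_eq; rewrite /GRing.scale /= /hhx /hKz; field.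
Qed.

Lemma is_derive_hhx_x x s : is_derive x (1 : R) (hhx ^~ s) (hhs x s).
Proof.
have [s0|s0] := leP s 0.
  rewrite /hhs hK_le0// mulr0 (_ : hhx ^~ s = cst (0 : R)).
    exact: is_derive_cst.
  by apply/funext => y; rewrite /hhx hK_le0// mulr0.
have s0' : s != 0 by rewrite gt_eqF.
have H := is_derive_hKz x s0'.
by apply: is_derive_eq; rewrite /GRing.scale /= /hhs /hKz; field.
Qed.

(** At [s = 0] the quadratic bound of [hh_bounds] forces the derivative [0], which is the junk value
    of [hhs] there: extension by zero to nonpositive times stays differentiable. *)
Lemma is_derive_hh_s x s : 0 < x -> is_derive s (1 : R) (hh x) (hhs x s).
Proof.
move=> x0; have [s0|s0|->] := ltgtP s 0.
- rewrite /hhs hK_le0 ?ltW// mulr0; apply: (@is_derive_near (cst (0 : R))).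
    near=> s'; rewrite hh_le0//; apply: ltW; near: s'; exact: lt_nbhsl.
- have s0' : s != 0 by rewrite gt_eqF.
  have H := is_derive_hKs x s0.
  have H' := @is_deriveV R id s _ 1 s0' (is_derive_id _ _).
  by apply: is_derive_eq; rewrite /GRing.scale /= /hhs /hKzz; field.
- have [C C0 CP] := @hh_bounds x x 1 x0 x0 ltr01.
  rewrite /hhs hK_le0// mulr0.
  have H : h^-1 *: (hh x (h + 0) - hh x 0) @[h --> 0^'] --> (0 : R).
    apply: (@cvg0_norm_le _ _ _ _ _ (fun h => C * `|h|)).
      near=> h; have h0 : h != 0 by near: h; exact: nbhs_dnbhs_neq.
      have h1 : h <= 1.
        near: h; apply: nbhs_dnbhs; near=> h; apply: ltW; near: h; exact: lt_nbhsl.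
      rewrite addr0 (hh_le0 x (lexx 0)) subr0 normrM normfV.
      have [hb _ _ _] := CP x h ltac:(by rewrite !lexx) h1.
      rewrite ler_pdivrMl ?normr_gt0//; apply: (le_trans hb).
      have -> : `|h| * (C * `|h|) = C * `|h| ^+ 2 by ring.
      by rewrite real_normK ?num_real.
    rewrite [X in _ --> X](_ : 0 = C * `|0 : R|); last by rewrite normr0 mulr0.
    apply: cvgM; first exact: cvg_cst.
    apply: cvg_norm; apply: (@cvg_trans _ (nbhs (0 : R))) => //; exact: nbhs_dnbhs.
  apply: DeriveDef.
    apply/cvg_ex; exists 0.
    by under eq_fun do rewrite scaler1.
  apply/cvg_lim => //.
  by under eq_fun do rewrite scaler1.
Unshelve. all: by end_near. Qed.

(** Boundedness is asked on half-lines reaching to minus infinity, which suits a boundary datum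
    frozen before time [0]. *)
Definition bdd_loc (g : R -> R) :=
  measurable_fun setT g /\ forall T, exists M, forall t, t <= T -> `|g t| <= M.

Definition hB (g : R -> R) x t := \int[mu]_(tau in `]0, t[) (g tau * hh x (t - tau)).
Definition hBx (g : R -> R) x t := \int[mu]_(tau in `]0, t[) (g tau * hhx x (t - tau)).
Definition hBt (g : R -> R) x t := \int[mu]_(tau in `]0, t[) (g tau * hhs x (t - tau)).

Lemma Rint_trunc (F : R -> R) t T : t <= T -> (forall tau, t <= tau < T -> F tau = 0) ->
  \int[mu]_(tau in `]0, t[) F tau = \int[mu]_(tau in `]0, T[) F tau.
Proof.
move=> tT F0.
have -> : `]0, t[%classic = `]0, T[ `&` `]0, t[ :> set R.
  apply/seteqP; split => y /=; rewrite !in_itv/=; last by case.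
  by move=> /andP[-> h]; rewrite h (lt_le_trans h).
rewrite Rintegral_mkcondr; apply: eqRint => tau; rewrite /= in_itv/= => /andP[h1 h2].
rewrite /patch; case: ifPn => // /negP h; rewrite F0// h2 andbT leNgt; apply/negP => h'.
by apply: h; rewrite inE/= in_itv/= h1.
Qed.

Lemma measurable_hh_t x t : 0 < x -> measurable_fun setT (fun tau : R => hh x (t - tau)).
Proof.
move=> x0; apply: continuous_measurable_fun => tau.
have H := is_derive_hh_s (t - tau) x0.
apply: (continuous_comp (f := fun tau => t - tau)).
  by apply: cvgB; [exact: cvg_cst|exact: cvg_id].
exact: (is_derive_continuous H).
Qed.

(** The derivative is the limit of the quotients with increment [1/(n+1)]. Increments go to the
    right only, so that [x'] stays positive in the applications. *)
Lemma measurable_derive (D : set R) (F dF : R -> R -> R) (x : R) : measurable D ->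
  (forall x', x <= x' -> measurable_fun D (F x')) ->
  (forall y, D y -> is_derive x (1 : R) (F ^~ y) (dF x y)) ->
  measurable_fun D (dF x).
Proof.
move=> mD mF dFP.
apply: (@measurable_fun_cvg _ _ _ _ (fun n y => n.+1%:R * (F (n.+1%:R^-1 + x) y - F x y))).
  move=> n; apply: measurable_funM => //; apply: measurable_funB; apply: mF => //.
  by rewrite lerDr.
move=> y Dy; have H := dFP y Dy.
have /cvg_ex[l Hl] : derivable (F ^~ y) x 1 by apply: ex_derive.
have E : dF x y = l by rewrite -[LHS](@derive_val _ _ _ _ _ _ _ H); apply/cvg_lim.
rewrite E; move: Hl => /cvgr_dnbhsP /(_ (fun n => n.+1%:R^-1)) h.
apply: cvg_trans (h _).
  by apply: near_eq_cvg; near=> n; rewrite /= scaler1 invrK.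
by split; [move=> n; rewrite invr_neq0// pnatr_eq0|exact: cvg_harmonic].
Unshelve. all: by end_near. Qed.

Lemma measurable_hhx_t x t (D : set R) : 0 < x -> measurable D ->
  measurable_fun D (fun tau : R => hhx x (t - tau)).
Proof.
move=> x0 mD; apply: (@measurable_derive D (fun x tau => hh x (t - tau)) (fun x tau => hhx x (t - tau))) => //.
- by move=> x' xx'; apply: measurable_funTS; apply: measurable_hh_t; exact: lt_le_trans xx'.
- by move=> y _; exact: is_derive_hh_x.
Qed.

(** Because [hh] vanishes at nonpositive times, the upper limit can be fixed at a larger [T];
    differentiation in [t] then never meets a moving endpoint. *)
Lemma hB_trunc g x t T : t <= T ->
  hB g x t = \int[mu]_(tau in `]0, T[) (g tau * hh x (t - tau)).
Proof.
move=> tT; apply: Rint_trunc => // tau /andP[h _].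
by rewrite hh_le0 ?mulr0// subr_le0.
Qed.

Lemma itg_bdd_loc g T : bdd_loc g -> itg `]0, T[ g.
Proof.
move=> [mg /(_ T)[M gM]]; apply: (@itg_bounded_oo _ _ _ M).
  exact: measurable_funTS.
by move=> x /andP[_ /ltW]; exact: gM.
Qed.

Lemma itg_hB g x t : bdd_loc g -> 0 < x -> 0 < t ->
  itg `]0, t[ (fun tau => g tau * hh x (t - tau)) /\
  itg `]0, t[ (fun tau => g tau * hhx x (t - tau)).
Proof.
move=> [mg gb] x0 t0; have [M gM] := gb t.
have [C C0 CP] := hh_bounds x0 x0 t0.
split; apply: (@itg_bounded_oo _ _ _ (M * C)).
- apply: measurable_funM; first exact: measurable_funTS.
  by apply: measurable_funTS; exact: measurable_hh_t.
- move=> tau /andP[t1 t2]; rewrite normrM; apply: ler_pM => //; first by apply: gM; exact: ltW.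
  by have [] := CP x (t - tau) ltac:(by rewrite !lexx) ltac:(by rewrite gerBl ltW).
- by apply: measurable_funM; [exact: measurable_funTS|exact: measurable_hhx_t].
- move=> tau /andP[t1 t2]; rewrite normrM; apply: ler_pM => //; first by apply: gM; exact: ltW.
  by have [] := CP x (t - tau) ltac:(by rewrite !lexx) ltac:(by rewrite gerBl ltW).
Qed.

Lemma is_derive_hB_x g x t : bdd_loc g -> 0 < x -> 0 < t ->
  is_derive x (1 : R) (hB g ^~ t) (hBx g x t).
Proof.
move=> gb x0 t0; have [C C0 CP] := @hh_bounds (x / 2) (x * 2) t ltac:(lra) ltac:(lra) t0.
apply: (@is_derive_under _ _ (fun x tau => g tau * hh x (t - tau))
  (fun x tau => g tau * hhx x (t - tau)) x (x / 2) (x * 2) (fun tau => C * `|g tau|)) => //.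
- by apply/andP; split; lra.
- by move=> x' /andP[h1 h2]; have [] := @itg_hB g x' t gb ltac:(lra) t0.
- move=> x' y _ _; have H := is_derive_hh_x x' (t - y).
  by apply: is_derive_eq; rewrite /GRing.scale /= ?mulr0 ?addr0.
- by apply: itgZl => //; apply: itg_norm; exact: itg_bdd_loc.
- move=> x' tau /andP[h1 h2]; rewrite /= in_itv/= => /andP[t1 t2].
  rewrite normrM mulrC ler_wpM2r//.
  by have [] := CP x' (t - tau) ltac:(by rewrite !ltW) ltac:(by rewrite gerBl ltW).
Qed.

Lemma is_derive_hB_xx g x t : bdd_loc g -> 0 < x -> 0 < t ->
  is_derive x (1 : R) (hBx g ^~ t) (hBt g x t).
Proof.
move=> gb x0 t0; have [C C0 CP] := @hh_bounds (x / 2) (x * 2) t ltac:(lra) ltac:(lra) t0.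
apply: (@is_derive_under _ _ (fun x tau => g tau * hhx x (t - tau))
  (fun x tau => g tau * hhs x (t - tau)) x (x / 2) (x * 2) (fun tau => C * `|g tau|)) => //.
- by apply/andP; split; lra.
- by move=> x' /andP[h1 h2]; have [] := @itg_hB g x' t gb ltac:(lra) t0.
- move=> x' y _ _; have H := is_derive_hhx_x x' (t - y).
  by apply: is_derive_eq; rewrite /GRing.scale /= ?mulr0 ?addr0.
- by apply: itgZl => //; apply: itg_norm; exact: itg_bdd_loc.
- move=> x' tau /andP[h1 h2]; rewrite /= in_itv/= => /andP[t1 t2].
  rewrite normrM mulrC ler_wpM2r//.
  by have [] := CP x' (t - tau) ltac:(by rewrite !ltW) ltac:(by rewrite gerBl ltW).
Qed.

Lemma is_derive_hB_t g x t : bdd_loc g -> 0 < x -> 0 < t ->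
  is_derive t (1 : R) (hB g x) (hBt g x t).
Proof.
move=> gb x0 t0; have T0 : 0 < t + 1 by lra.
have [C C0 CP] := hh_bounds x0 x0 T0.
apply: (@is_derive_near (fun t' => \int[mu]_(tau in `]0, t + 1[) (g tau * hh x (t' - tau)))).
  near=> t'; rewrite -hB_trunc//; apply: ltW; near: t'; apply: lt_nbhsl; lra.
have -> : hBt g x t = \int[mu]_(tau in `]0, t + 1[) (g tau * hhs x (t - tau)).
  apply: Rint_trunc; first lra.
  by move=> tau /andP[h _]; rewrite /hhs hK_le0 ?mulr0 ?mulr0// subr_le0.
apply: (@is_derive_under _ _ (fun t tau => g tau * hh x (t - tau))
  (fun t tau => g tau * hhs x (t - tau)) t 0 (t + 1) (fun tau => C * `|g tau|)) => //.
- by apply/andP; split; lra.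
- move=> t' /andP[h1 h2]; apply: (@itg_le _ _ _ (fun tau => C * `|g tau|)) => //.
  + apply: measurable_funM; first by apply: measurable_funTS; case: gb.
    by apply: measurable_funTS; exact: measurable_hh_t.
  + move=> tau; rewrite /= in_itv/= => /andP[t1 t2]; rewrite normrM mulrC ler_wpM2r//.
    by have [] := CP x (t' - tau) ltac:(by rewrite !lexx) ltac:(lra).
  + by apply: itgZl => //; apply: itg_norm; exact: itg_bdd_loc.
- move=> t' y _ _; have H := is_derive_shift (is_derive_hh_s (t' - y) x0).
  by apply: is_derive_eq; rewrite /GRing.scale /= ?mulr0 ?addr0.
- by apply: itgZl => //; apply: itg_norm; exact: itg_bdd_loc.
- move=> t' tau /andP[h1 h2]; rewrite /= in_itv/= => /andP[t1 t2].
  rewrite normrM mulrC ler_wpM2r//.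
  by have [] := CP x (t' - tau) ltac:(by rewrite !lexx) ltac:(lra).
Unshelve. all: by end_near. Qed.

Lemma Rint_bound_oo (F : R -> R) t M : 0 <= t -> measurable_fun `]0, t[ F ->
  (forall tau, 0 < tau < t -> `|F tau| <= M) ->
  `|\int[mu]_(tau in `]0, t[) F tau| <= M * t.
Proof.
move=> t0 mF FM.
apply: (@le_trans _ _ (\int[mu]_(tau in `]0, t[) M)).
  apply: normRint_le => //; last exact: itg_cst_oo.
rewrite Rintegral_cst//= lebesgue_measure_itv/= lte_fin.
by case: ltgtP t0 => // [t1|<-] _; rewrite /= ?subr0 ?mulr0.
Qed.

Lemma hB_t0 g x : bdd_loc g -> 0 < x -> hB g x t @[t --> 0^'+] --> (0 : R).
Proof.
move=> gb x0; have [mg /(_ 1)[M gM]] := gb.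
have [C C0 CP] := hh_bounds x0 x0 ltr01.
apply: (@cvg0_norm_le _ _ _ _ _ (fun t => M * C * t)).
  near=> t; have t0 : 0 < t by near: t; exact: nbhs_right_gt.
  have t1 : t <= 1 by near: t; exact: nbhs_right_le.
  apply: Rint_bound_oo; first exact: ltW.
    by apply: itg_measurable; have [] := itg_hB gb x0 t0.
  move=> tau /andP[h1 h2]; rewrite normrM; apply: ler_pM => //; first by apply: gM; lra.
  by have [] := CP x (t - tau) ltac:(by rewrite !lexx) ltac:(lra).
rewrite -[X in _ --> X](mulr0 (M * C)); apply: cvgM; first exact: cvg_cst.
apply: cvg_at_right_filter; exact: cvg_id.
Unshelve. all: by end_near. Qed.

(** Evenness of the kernel and [hK_lip] give [|hG x y s| <= 2 C x] uniformly in [y]; with [c = 0]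
    the function [v] is integrable, so the potential is of order [x]. *)
Lemma hP_x0 v B s : dominated v 0 B -> 0 < s -> hP v x s @[x --> 0^'+] --> (0 : R).
Proof.
move=> vd s0; have [mv _ Bi B0 vb] := vd.
have [C C0 CP] := @hK_lip R s s s0.
apply: (@cvg0_norm_le _ _ _ _ _ (fun x => (C * 2 * \int[mu]_(y in D0) B y) * x)).
  near=> x; have x0 : 0 < x by near: x; exact: nbhs_right_gt.
  have -> : C * 2 * (\int[mu]_(y in D0) B y) * x = \int[mu]_(y in D0) (C * (2 * x) * B y).
    by rewrite RintegralZl//; ring.
  apply: normRint_le => //.
  - by apply: itg_measurable; have [] := itg_hP x vd s0.
  - move=> y; rewrite D0P => y0; rewrite normrM mulrC; apply: ler_pM => //.
      rewrite /hG -[hK (x + y) s]hKN (le_trans (CP _ _ _ _))// ?lexx//.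
      rewrite (_ : x - y - _ = 2 * x); last by ring.
      by rewrite ger0_norm// mulr_ge0// ltW.
    by rewrite (le_trans (vb _ y0))// add0r.
  - exact: itgZl.
rewrite -[X in _ --> X](mulr0 (C * 2 * \int[mu]_(y in D0) B y)); apply: cvgM; first exact: cvg_cst.
apply: cvg_at_right_filter; exact: cvg_id.
Unshelve. all: by end_near. Qed.

Lemma hP_t0 v B x : dominated v 0 B -> 0 < x -> {for x, continuous v} ->
  hP v x s @[s --> 0^'+] --> v x.
Proof.
move=> vd x0 cv; have [mv _ Bi B0 vb] := vd.
apply/cvgrPdist_le => e e0.
have e20 : 0 < e / 2 by rewrite divr_gt0.
move/cvgrPdist_le : cv => /(_ _ e20) [d /= d0 dP].
have [C CP] := @hP_approx _ x d 0 B `|v x| x0 d0 (lexx 0) Bi B0.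
near=> s; have s0 : 0 < s by near: s; exact: nbhs_right_gt.
rewrite distrC.
apply: (@le_trans _ _ (e / 2 + C * s)).
  apply: CP => //.
  - by rewrite s0/=; near: s; exact: nbhs_right_le.
  - exact: ltW.
  - by move=> y y0 yx; rewrite distrC; apply: dP; rewrite /ball_ /= distrC.
have : C * s <= e / 2; last by lra.
near: s; apply: (@cvgr_le _ _ _ _ (fun s => C * s) 0).
  rewrite -[X in _ --> X](mulr0 C); apply: cvgM; first exact: cvg_cst.
  apply: cvg_at_right_filter; exact: cvg_id.
exact: e20.
Unshelve. all: by end_near. Qed.

End Boundary.

Arguments hhx {R} x s.
Arguments hhs {R} x s.
Arguments hB {R} g x t.
Arguments hBx {R} g x t.
Arguments hBt {R} g x t.

(** * Source potential *)

Section Source.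
Variable R : realType.
Notation mu := (@lebesgue_measure R).
Notation itg D f := (mu.-integrable D (EFin \o f)).
Notation D0 := (`]0, +oo[%classic : set R).
Implicit Types (x y z s t c e tau : R) (v w k B : R -> R).

(** [f1], [f2] are the first two space derivatives and [f0] is the trace at the boundary. In time
    only continuity is asked, and the bounds cover all [tau <= T], negative ones included, in
    accordance with data frozen before [0]. *)
Definition source (f f1 f2 : R -> R -> R) (f0 : R -> R) : Prop :=
  [/\ forall tau y, 0 < y -> is_derive y (1 : R) (f ^~ tau) (f1 y tau) /\
        is_derive y (1 : R) (f1 ^~ tau) (f2 y tau),
      forall tau y, 0 < y -> {for y, continuous (f2 ^~ tau)},
      forall T : R, exists M : R, forall tau y, tau <= T -> 0 < y ->
        [/\ `|f y tau| <= M * (1 + y ^+ 2)^-1, `|f1 y tau| <= M * (1 + y ^+ 2)^-1 &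
            `|f2 y tau| <= M * (1 + y ^+ 2)^-1],
      forall y, 0 < y -> continuous (f y) &
      forall tau, f y tau @[y --> 0^'+] --> f0 tau].

Variables (f f1 f2 : R -> R -> R) (f0 : R -> R).
Hypothesis fP : source f f1 f2 f0.

Let wM M y := M * (1 + y ^+ 2)^-1.

Lemma itg_wM M : itg D0 (wM M).
Proof. by apply: itgZl => //; exact: itg_oneDsqrV0. Qed.

Lemma source_bound T : exists2 M : R, 0 <= M & forall tau, tau <= T ->
  [/\ dominated (f ^~ tau) 0 (wM M), dominated (f2 ^~ tau) 0 (wM M),
      forall y, 0 < y -> `|f y tau| <= M /\ `|f1 y tau| <= M /\ `|f2 y tau| <= M &
      `|f0 tau| <= M].
Proof.
have [d12 c2 /(_ T)[M MP] _ fl] := fP.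
have M0 : 0 <= M.
  have [h _ _] := MP T 1 (lexx _) ltr01.
  by have := le_trans (normr_ge0 _) h; rewrite pmulr_lge0// invr_gt0 ltr_pwDl.
exists M => // tau tT.
have wM0 y : 0 <= wM M y by rewrite mulr_ge0// oneDsqrV_ge0.
have wMM y : wM M y <= M by rewrite ler_piMr// oneDsqrV_le1'.
split.
- split=> //.
  + apply: open_continuous_measurable_fun; first exact: interval_open.
    move=> y; rewrite inE D0P => y0; have [H _] := d12 tau y y0.
    exact: (is_derive_continuous H).
  + exact: itg_wM.
  + by move=> y y0; rewrite add0r; have [] := MP tau y tT y0.
- split=> //.
  + apply: open_continuous_measurable_fun; first exact: interval_open.
    by move=> y; rewrite inE D0P => y0; exact: c2.
  + exact: itg_wM.
  + by move=> y y0; rewrite add0r; have [] := MP tau y tT y0.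
- move=> y y0; have [h1 h2 h3] := MP tau y tT y0.
  by split; [|split]; apply: le_trans (wMM y).
- apply: (cvgr_to_le (cvg_norm (fl tau))); near=> y.
  have y0 : 0 < y by near: y; exact: nbhs_right_gt.
  by have [h _ _] := MP tau y tT y0; apply: (le_trans h); exact: wMM.
Unshelve. all: by end_near. Qed.

(** Green's identity moves both derivatives from the kernel onto [f]. The right side stays bounded
    as [s] tends to [0], whereas a direct estimate of [hGyy] would cost a factor [1/s]. *)
Lemma hPxx_source x s tau : 0 < s ->
  hPxx (f ^~ tau) x s = hP (f2 ^~ tau) x s - f0 tau * hh x s.
Proof.
move=> s0; have [d12 c2 _ _ fl] := fP; have [M M0 /(_ tau (lexx _))[fd f2d fb _]] := source_bound tau.
apply: (@hP_green _ (f ^~ tau) (f1 ^~ tau) (f2 ^~ tau) (f0 tau) M) fd f2d (fl tau) _ _ => //.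
- by move=> y y0; have [] := d12 tau y y0.
- by move=> y y0; have [] := d12 tau y y0.
- by move=> y y0; exact: c2.
- near=> y; have y0 : 0 < y by near: y; exact: nbhs_pinfty_gt.
  by have [] := fb y y0.
- by move=> y y0; have [_ []] := fb y y0.
Unshelve. all: by end_near. Qed.

(** The first derivative is bounded by interpolation: at some [xi] in [[x, x + 1]] it equals an
    increment of [hP], at most [2 M], and the way back from [xi] to [x] costs at most the bound on
    [hPxx]. This is why [hPxx] is controlled up to [X + 1]. *)
Lemma hP_source_bounds (d X T : R) : 0 < d -> 0 < X -> 0 < T -> exists2 L : R, 0 <= L &
  forall x s tau, d <= x <= X -> 0 < s <= T -> tau <= T ->
  [/\ `|hP (f ^~ tau) x s| <= L, `|hPx (f ^~ tau) x s| <= L &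
      `|hPxx (f ^~ tau) x s| <= L].
Proof.
move=> d0 X0 T0; have [M M0 MP] := source_bound T.
have X10 : 0 < X + 1 by lra.
have [C C0 CP] := hh_bounds d0 X10 T0.
pose L := M + M * C.
have L0 : 0 <= L by rewrite addr_ge0// mulr_ge0// ltW.
have Pb x s tau : 0 <= x -> 0 < s -> tau <= T -> `|hP (f ^~ tau) x s| <= M.
  move=> x0 s0 tT; have [fd f2d fb _] := MP tau tT.
  by apply: hP_bound => //; [case: fd|move=> y y0; have [] := fb y y0].
have Pxxb x s tau : d <= x <= X + 1 -> 0 < s <= T -> tau <= T -> `|hPxx (f ^~ tau) x s| <= L.
  move=> /[dup] dx /andP[dx1 dx2] /andP[s0 sT] tT; have [fd f2d fb f0b] := MP tau tT.
  rewrite hPxx_source//; apply: (le_trans (ler_normB _ _)); apply: lerD.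
    by apply: hP_bound; [case: f2d|move=> y y0; have [_ []] := fb y y0|lra|].
  by rewrite normrM; apply: ler_pM => //; have [] := CP x s dx sT.
exists (2 * M + L); first by rewrite addr_ge0// mulr_ge0.
move=> x s tau /andP[dx xX] /[dup] s0T /andP[s0 sT] tT.
have [fd _ _ _] := MP tau tT.
have x0 : 0 < x by exact: lt_le_trans dx.
split.
- by apply: (le_trans (Pb _ _ _ (ltW x0) s0 tT)); lra.
- have d1 z := is_derive_hP_x z fd s0; have d2 z := is_derive_hP_xx z fd s0.
  have x1 : x <= x + 1 by lra.
  have [xi xiP E1] := @MVT_segment R _ _ x (x + 1) x1
    (fun z _ => d1 z) (@continuous_subspaceT _ _ _ _ (fun z => is_derive_continuous (d1 z))).
  move: xiP; rewrite in_itv/= => /andP[xi1 xi2].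
  have [eta etaP E2] := @MVT_segment R _ _ x xi xi1
    (fun z _ => d2 z) (@continuous_subspaceT _ _ _ _ (fun z => is_derive_continuous (d2 z))).
  move: etaP; rewrite in_itv/= => /andP[et1 et2].
  have E1' : hPx (f ^~ tau) xi s = hP (f ^~ tau) (x + 1) s - hP (f ^~ tau) x s.
    by rewrite E1 addrAC subrr add0r mulr1.
  have E2' : hPx (f ^~ tau) x s = hPx (f ^~ tau) xi s - hPxx (f ^~ tau) eta s * (xi - x).
    by rewrite -E2; ring.
  rewrite E2'; apply: (le_trans (ler_normB _ _)); apply: lerD.
    rewrite E1'; apply: (le_trans (ler_normB _ _)).
    rewrite (_ : 2 * M = M + M); last by rewrite mulr_natl mulr2n.
    by apply: lerD; apply: Pb => //; [exact: addr_ge0 (ltW x0) ler01|exact: ltW].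
  rewrite normrM; apply: (@le_trans _ _ (L * 1)); last by rewrite mulr1.
  apply: ler_pM => //.
    apply: Pxxb => //; rewrite (le_trans dx et1)/= (le_trans et2)// (le_trans xi2)//.
    by rewrite lerD2r.
  by rewrite ger0_norm ?subr_ge0// lerBlDl.
- by apply: (le_trans (Pxxb _ _ _ _ s0T tT)); [rewrite dx/= (le_trans xX)// lerDl|rewrite lerDr mulr_ge0].
Qed.

(* No bound on the time derivative of [f] is available: [hS] is differentiated in
   time through the Lipschitz continuity in [s] of this extension of [hP] by its
   limit at [s = 0]. *)
Definition hPt x s tau := if 0 < s then hP (f ^~ tau) x s else f x tau.

Lemma hPt_cvg0 x tau : 0 < x -> hPt x s tau @[s --> 0^'+] --> f x tau.
Proof.
move=> x0; have [M M0 /(_ tau (lexx _))[fd _ _ _]] := source_bound tau.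
have [d12 _ _ _ _] := fP; have [H _] := d12 tau x x0.
apply: cvg_trans (hP_t0 fd x0 (is_derive_continuous H)).
apply: near_eq_cvg; near=> s; rewrite /hPt ifT//; near: s; exact: nbhs_right_gt.
Unshelve. all: by end_near. Qed.

(** At positive [s] the derivative is [hPxx], bounded by [hP_source_bounds]; at [s <= 0] the
    function is constant; the two branches match by [hPt_cvg0]. *)
Lemma hPt_lip x T : 0 < x -> 0 < T -> exists2 L : R, 0 <= L &
  forall s s' tau, s <= T -> s' <= T -> tau <= T ->
  `|hPt x s tau - hPt x s' tau| <= L * `|s - s'|.
Proof.
move=> x0 T0; have [L L0 LP] := hP_source_bounds x0 x0 T0.
exists L => // s s' tau; wlog ss : s s' / s' <= s.
  by move=> H; have [h|/ltW h] := leP s' s; [exact: H|move=> *; rewrite distrC (distrC s); exact: H].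
move=> sT s'T tT; have [M M0 /(_ tau (lexx _))[fd _ _ _]] := source_bound tau.
have pos r r' : 0 < r' -> r' <= r -> r <= T -> `|hPt x r tau - hPt x r' tau| <= L * (r - r').
  move=> r'0 rr rT; rewrite /hPt r'0 (lt_le_trans r'0 rr).
  have d1 z : 0 < z -> is_derive z 1 (hP (f ^~ tau) x) (hPxx (f ^~ tau) x z).
    by move=> z0; exact: is_derive_hP_s fd z0.
  have [c cP ->] : exists2 c, c \in `[r', r] & hP (f ^~ tau) x r - hP (f ^~ tau) x r' =
      hPxx (f ^~ tau) x c * (r - r').
    apply: MVT_segment => //.
      by move=> z; rewrite in_itv/= => /andP[h _]; apply: d1; exact: lt_trans h.
    apply: continuous_in_subspaceT => z; rewrite inE/= in_itv/= => /andP[h _].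
    by apply: is_derive_continuous; apply: d1; exact: lt_le_trans h.
  move: cP; rewrite in_itv/= => /andP[c1 c2].
  rewrite normrM (ger0_norm (_ : 0 <= r - r')) ?subr_ge0// ler_wpM2r ?subr_ge0//.
  have [_ _] := LP x c tau ltac:(by rewrite !lexx) ltac:(by rewrite (lt_le_trans r'0 c1) (le_trans c2)) tT.
  exact.
have [s0|s0] := leP s 0.
  by rewrite /hPt !ltNge s0 (le_trans ss s0)/= subrr normr0 mulr_ge0.
have [s'0|s'0] := leP s' 0; last by rewrite [`|s - s'|]ger0_norm ?subr_ge0//; exact: pos.
(* Here [s' <= 0 < s]: the estimate between positive times is carried to the left end by letting [r]
   decrease to [0]. *)
have : `|hPt x s tau - f x tau| <= L * s.
  have lim : `|hPt x s tau - hPt x r tau| @[r --> 0^'+] --> `|hPt x s tau - f x tau|.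
    by apply: cvg_norm; apply: cvgB; [exact: cvg_cst|exact: hPt_cvg0].
  apply: (cvgr_to_le lim); near=> r; have r0 : 0 < r by near: r; exact: nbhs_right_gt.
  have rs : r <= s by near: r; exact: nbhs_right_le.
  apply: (le_trans (pos _ _ r0 rs sT)).
  by rewrite ler_wpM2l// gerBl ltW.
rewrite [hPt x s' tau]/hPt ltNge s'0/= => h; apply: (le_trans h).
rewrite ler_wpM2l// ger0_norm ?subr_ge0// lerBrDr gerDl//.
Unshelve. all: by end_near. Qed.

Lemma continuous_hP_tau x s : 0 < s -> continuous (fun tau => hP (f ^~ tau) x s).
Proof.
move=> s0 tau; have [M M0 MP] := source_bound (tau + 1).
have [_ _ _ cf _] := fP.
have [C C0 CP] := @hG_bounds R s s `|x| s0.
suff H : {in (`]tau - 1, tau + 1[%classic : set R), continuous (fun tau => hP (f ^~ tau) x s)}.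
  by apply: H; rewrite inE /= in_itv/= ltrDl ltr01 gtrBl ltr01.
apply: (@continuity_under_integral R _ _ mu (fun tau y => f y tau * hG x y s) D0
  (measurable_itv `]0, +oo[) (tau - 1) (tau + 1) _ _ (fun y => M * C * (1 + y ^+ 2)^-1)).
- move=> tau'; rewrite /= in_itv/= => /andP[_ /ltW h].
  by have [fd _ _ _] := MP tau' h; have [] := itg_hP x fd s0.
- apply: aeW => y; rewrite D0P => y0 tau' _.
  by apply: cvgM; [exact: cf|exact: cvg_cst].
- by apply: itgZl => //; exact: itg_oneDsqrV0.
- move=> tau'; rewrite /= in_itv/= => /andP[_ /ltW h]; apply: aeW => y.
  rewrite /= in_itv/= andbT => y0.
  have [_ _ fb _] := MP tau' h; have [fM _] := fb y y0.
  rewrite normrM -mulrA; apply: ler_pM => //.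
  by have [] := CP x y s (lexx _) ltac:(by rewrite !lexx).
Qed.

Lemma continuous_hPt x s : 0 < x -> continuous (hPt x s).
Proof.
move=> x0; rewrite /hPt; case: (ltP 0 s) => s0; last by have [_ _ _ cf _] := fP; exact: cf.
exact: continuous_hP_tau.
Qed.

(** Both arguments move with [tau]: the Lipschitz bound in the first, uniform in [tau], is combined
    with continuity in the second. It carries the Duhamel integrand continuously through
    [tau = t]. *)
Lemma continuous_hPt_t x t : 0 < x -> continuous (fun tau => hPt x (t - tau) tau).
Proof.
move=> x0 tau; pose T := Num.max 1 (Num.max (t - tau + 1) (tau + 1)).
have T1 : t - tau + 1 <= T by rewrite /T !le_max lexx orbT.
have T2 : tau + 1 <= T by rewrite /T !le_max lexx !orbT.
have T0 : 0 < T by rewrite /T !lt_max ltr01.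
have [L L0 LP] := hPt_lip x0 T0.
apply/cvgrPdist_le => e e0; have e20 : 0 < e / 2 by rewrite divr_gt0.
have /cvgrPdist_le /(_ _ e20) c1 := @continuous_hPt x (t - tau) x0 tau.
have Le : 0 < (e / 2) / (L + 1) by rewrite divr_gt0// ltr_wpDl.
near=> tau'.
have h1 : `|tau - tau'| <= 1.
  near: tau'; have := @cvg_id _ (nbhs tau) => /cvgrPdist_le; apply; exact: ltr01.
have h2 : L * `|tau - tau'| <= e / 2.
  have h : `|tau - tau'| <= (e / 2) / (L + 1).
    near: tau'; have := @cvg_id _ (nbhs tau) => /cvgrPdist_le; apply; exact: Le.
  apply: (@le_trans _ _ ((L + 1) * `|tau - tau'|)); first by rewrite ler_wpM2r// lerDl.
  by rewrite mulrC -ler_pdivlMr// ltr_wpDl.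
have h3 : `|hPt x (t - tau) tau - hPt x (t - tau) tau'| <= e / 2 by near: tau'.
move: h1; rewrite ler_norml => /andP[h11 h12].
have h4 := @LP (t - tau) (t - tau') tau' ltac:(lra) ltac:(lra) ltac:(lra).
have E : t - tau - (t - tau') = - (tau - tau') by ring.
rewrite E normrN in h4.
have -> : hPt x (t - tau) tau - hPt x (t - tau') tau' =
  (hPt x (t - tau) tau - hPt x (t - tau) tau') + (hPt x (t - tau) tau' - hPt x (t - tau') tau') by ring.
apply: (le_trans (ler_normD _ _)); rewrite [leRHS]splitr.
exact: lerD h3 (le_trans h4 h2).
Unshelve. all: by end_near. Qed.

Definition hS x t := \int[mu]_(tau in `]0, t[) hP (f ^~ tau) x (t - tau).
Definition hSx x t := \int[mu]_(tau in `]0, t[) hPx (f ^~ tau) x (t - tau).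
Definition hSxx x t := \int[mu]_(tau in `]0, t[) hPxx (f ^~ tau) x (t - tau).

Lemma hPtE x t tau : tau < t -> hPt x (t - tau) tau = hP (f ^~ tau) x (t - tau).
Proof. by move=> h; rewrite /hPt subr_gt0 h. Qed.

Lemma itg_hPt x t T : 0 < x -> itg `]0, T[ (fun tau => hPt x (t - tau) tau).
Proof.
move=> x0; have mF := continuous_measurable_fun (@continuous_hPt_t x t x0).
have [M M0 MP] := source_bound T.
apply: (@itg_bounded_oo _ _ _ M); first exact: measurable_funTS.
move=> tau /andP[_ /ltW tT]; have [fd _ fb _] := MP tau tT; rewrite /hPt.
case: ifPn => h; last by have [] := fb x x0.
by apply: hP_bound => //; [case: fd|move=> y y0; have [] := fb y y0|exact: ltW].
Qed.

Lemma measurable_hP_t x t (D : set R) : measurable D -> D `<=` `]0, t[ -> 0 < x ->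
  measurable_fun D (fun tau => hP (f ^~ tau) x (t - tau)).
Proof.
move=> mD Dt x0; have mF := continuous_measurable_fun (@continuous_hPt_t x t x0).
apply: (eq_measurable_fun (fun tau => hPt x (t - tau) tau)).
  by move=> tau /set_mem /Dt; rewrite /= in_itv/= => /andP[_ h]; rewrite hPtE.
exact: measurable_funTS.
Qed.

Lemma itg_hP_t x t : 0 < x -> itg `]0, t[ (fun tau => hP (f ^~ tau) x (t - tau)).
Proof.
move=> x0; apply: eq_itg (itg_hPt t t x0) => // tau; rewrite /= in_itv/= => /andP[_ h].
by rewrite hPtE.
Qed.

Lemma itg_hPx_t x t : 0 < x -> 0 < t -> itg `]0, t[ (fun tau => hPx (f ^~ tau) x (t - tau)).
Proof.
move=> x0 t0; have [L L0 LP] := hP_source_bounds x0 x0 t0.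
apply: (@itg_bounded_oo _ _ _ L).
  apply: (@measurable_derive _ _ (fun x tau => hP (f ^~ tau) x (t - tau))
    (fun x tau => hPx (f ^~ tau) x (t - tau))) => //.
    by move=> x' xx'; apply: measurable_hP_t => //; exact: lt_le_trans xx'.
  move=> tau; rewrite /= in_itv/= => /andP[_ h].
  have [M M0 /(_ tau (lexx _))[fd _ _ _]] := source_bound tau.
  by apply: (is_derive_hP_x _ fd); rewrite subr_gt0.
move=> tau /andP[h1 h2].
have [_ ? _] := LP x (t - tau) tau ltac:(by rewrite !lexx) ltac:(by rewrite subr_gt0 h2 gerBl ltW) (ltW h2).
by [].
Qed.

Lemma is_derive_hS_x x t : 0 < x -> 0 < t -> is_derive x (1 : R) (hS ^~ t) (hSx x t).
Proof.
move=> x0 t0; have x20 : 0 < x / 2 by rewrite divr_gt0.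
have [L L0 LP] := @hP_source_bounds (x / 2) (x * 2) t x20 ltac:(by rewrite mulr_gt0) t0.
apply: (@is_derive_under _ _ (fun x tau => hP (f ^~ tau) x (t - tau))
  (fun x tau => hPx (f ^~ tau) x (t - tau)) x (x / 2) (x * 2) (fun=> L)) => //.
- by apply/andP; split; lra.
- by move=> x' /andP[h1 h2]; apply: itg_hP_t; exact: lt_trans h1.
- move=> x' tau _; rewrite /= in_itv/= => /andP[_ h].
  have [M M0 /(_ tau (lexx _))[fd _ _ _]] := source_bound tau.
  by apply: (is_derive_hP_x _ fd); rewrite subr_gt0.
- exact: itg_cst_oo.
- move=> x' tau /andP[x1 x2]; rewrite /= in_itv/= => /andP[h1 h2].
  have [_ ? _] := LP x' (t - tau) tau ltac:(by rewrite !ltW) ltac:(by rewrite subr_gt0 h2 gerBl ltW) (ltW h2).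
  by [].
Qed.

Lemma is_derive_hS_xx x t : 0 < x -> 0 < t -> is_derive x (1 : R) (hSx ^~ t) (hSxx x t).
Proof.
move=> x0 t0; have x20 : 0 < x / 2 by rewrite divr_gt0.
have [L L0 LP] := @hP_source_bounds (x / 2) (x * 2) t x20 ltac:(by rewrite mulr_gt0) t0.
apply: (@is_derive_under _ _ (fun x tau => hPx (f ^~ tau) x (t - tau))
  (fun x tau => hPxx (f ^~ tau) x (t - tau)) x (x / 2) (x * 2) (fun=> L)) => //.
- by apply/andP; split; lra.
- by move=> x' /andP[h1 h2]; apply: itg_hPx_t => //; exact: lt_trans h1.
- move=> x' tau _; rewrite /= in_itv/= => /andP[_ h].
  have [M M0 /(_ tau (lexx _))[fd _ _ _]] := source_bound tau.
  by apply: (is_derive_hP_xx _ fd); rewrite subr_gt0.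
- exact: itg_cst_oo.
- move=> x' tau /andP[x1 x2]; rewrite /= in_itv/= => /andP[h1 h2].
  have [_ _ ?] := LP x' (t - tau) tau ltac:(by rewrite !ltW) ltac:(by rewrite subr_gt0 h2 gerBl ltW) (ltW h2).
  by [].
Qed.

Lemma itg_source_t x T : 0 < x -> itg `]0, T[ (f x).
Proof.
move=> x0; have [_ _ _ cf _] := fP; have [M M0 MP] := source_bound T.
apply: (@itg_bounded_oo _ _ _ M).
  by apply: measurable_funTS; apply: continuous_measurable_fun; exact: cf.
by move=> tau /andP[_ /ltW tT]; have [_ _ fb _] := MP tau tT; have [] := fb x x0.
Qed.

(** Beyond [tau = t] the integrand [hPt] has become [f x tau]. Extending the integral to a fixed [T]
    therefore costs the integral of [f x] from [t] to [T], which confines the moving endpoint to a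
    term covered by the fundamental theorem. *)
Lemma hS_split x t T : 0 < x -> 0 < t < T ->
  hS x t = \int[mu]_(tau in `]0, T[) hPt x (t - tau) tau -
    (\int[mu]_(tau in `]0, T[) f x tau - \int[mu]_(tau in `]0, t]) f x tau).
Proof.
move=> x0 /andP[t0 tT].
have E1 : hS x t = \int[mu]_(tau in `]0, t[) hPt x (t - tau) tau.
  by apply: eqRint => tau; rewrite /= in_itv/= => /andP[_ h]; rewrite hPtE.
have E2 : \int[mu]_(tau in `]0, t]) f x tau = \int[mu]_(tau in `]0, t[) f x tau.
  by symmetry; apply: Rintegral_itv_bndo_bndc; exact: itg_source_t.
have := @Rint_trunc R (fun tau => hPt x (t - tau) tau - f x tau) t T (ltW tT).
rewrite RintegralB//; [|exact: itg_hPt|exact: itg_source_t].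
rewrite RintegralB//; [|exact: itg_hPt|exact: itg_source_t].
rewrite E1 E2 => H; have {}H := H _; rewrite -[LHS](subrK (\int[mu]_(tau in `]0, t[) f x tau)) H; first by ring.
by move=> tau /andP[h _]; rewrite /hPt ltNge subr_le0 h subrr.
Qed.

Lemma Rint_setD1 (D : set R) (a : R) (F : R -> R) : measurable D -> itg D F ->
  \int[mu]_(y in D `\` [set a]) F y = \int[mu]_(y in D) F y.
Proof.
move=> mD iF; rewrite /Rintegral; congr fine.
have mF : measurable_fun (D `\ a) (EFin \o F).
  by apply: (measurable_funS mD) => //; apply: measurable_int iF.
by apply: integral_setD1 => //; exact: measurableD.
Qed.

Lemma is_derive_Rint_oc (F : R -> R) (a t T : R) : a < t -> t < T ->
  itg `]a, T] F -> {for t, continuous F} ->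
  is_derive t (1 : R) (fun t' => \int[mu]_(tau in `]a, t']) F tau) (F t).
Proof.
move=> at_ tT iF cF; have [] := @continuous_FTC1 R F (BRight a) t T tT iF at_ cF.
by move=> d1 d2; apply: DeriveDef; [exact: d1|rewrite -derive1E; exact: d2].
Qed.

Lemma is_derive_hS_t x t : 0 < x -> 0 < t ->
  is_derive t (1 : R) (hS x) (hSxx x t + f x t).
Proof.
move=> x0 t0; pose T := t + 1; have T0 : 0 < T by rewrite /T addr_gt0.
have tT : t < T by rewrite ltrDl.
have [L L0 LP] := hPt_lip x0 T0.
have [_ _ _ cf _] := fP.
(* At [tau = t] the map [t' |-> hPt x (t' - tau) tau] may have a kink at [t' = t], so this null set
   is removed. For [tau > t] the map is locally constant, whence the [0] in [dA]. *)
pose D := (`]0, T[ `\` [set t] : set R).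
have mD : measurable D by exact: measurableD.
pose dA tau := if tau < t then hPxx (f ^~ tau) x (t - tau) else 0.
have dAP : is_derive t (1 : R) (fun t' => \int[mu]_(tau in D) hPt x (t' - tau) tau)
    (\int[mu]_(tau in D) dA tau).
  apply: (@is_derive_under_lip _ _ (fun t' tau => hPt x (t' - tau) tau) dA (fun=> L)) => //.
  - by apply: integrableS (itg_cst_oo 0 T L) => //; exact: subDsetl.
  - by near=> t'; apply: integrableS (itg_hPt t' T x0) => //; exact: subDsetl.
  - near=> t' => tau [/= tau0 _]; move: tau0; rewrite in_itv/= => /andP[tau0 tauT].
    have t'T : t' <= T by apply: ltW; near: t'; exact: lt_nbhsl.
    have := @LP (t' - tau) (t - tau) tau ltac:(lra) ltac:(lra) (ltW tauT).
    by rewrite (_ : t' - tau - (t - tau) = t' - t); last by ring.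
  - move=> tau [/= tau0 taut]; move: tau0; rewrite in_itv/= => /andP[tau0 tauT]; rewrite /dA.
    have [h|h|h] := ltgtP tau t; last by case: taut.
    + apply: (@is_derive_near _ (fun t' => hP (f ^~ tau) x (t' - tau))).
        near=> t'; rewrite hPtE//; near: t'; exact: lt_nbhsr.
      have [M M0 /(_ tau (lexx _))[fd _ _ _]] := source_bound tau.
      apply: is_derive_shift; apply: (is_derive_hP_s _ fd); by rewrite subr_gt0.
    + apply: (@is_derive_near _ (cst (f x tau))).
      near=> t'; rewrite /hPt ifF//; apply/negbTE; rewrite -leNgt subr_le0; apply: ltW.
      near: t'; exact: lt_nbhsl.
have E : \int[mu]_(tau in D) dA tau = hSxx x t.
  transitivity (\int[mu]_(tau in D) ((fun tau => hPxx (f ^~ tau) x (t - tau)) \_ `]0, t[) tau).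
    apply: eqRint => tau [/=]; rewrite in_itv/= => /andP[tau0 _] _.
    rewrite /dA /patch; case: ifPn => h; first by rewrite mem_set//= in_itv/= tau0.
    by rewrite memNset//= in_itv/= => /andP[_]; rewrite (negbTE h).
  rewrite -Rintegral_mkcondr; congr (Rintegral _ _ _); apply/seteqP; split => tau /=.
    by case.
  rewrite in_itv/= => /andP[h1 h2]; split; last by rewrite h1 h2.
  split; first by rewrite /= in_itv/= h1 (lt_trans h2).
  by move=> /= h; rewrite h ltxx in h2.
have FTC : is_derive t (1 : R) (fun t' => \int[mu]_(tau in `]0, t']) f x tau) (f x t).
  apply: (@is_derive_Rint_oc _ 0 t T _ tT) => //; last exact: cf.
  - apply: integrableS (itg_source_t (T + 1) x0) => //.
    move=> tau /=; rewrite !in_itv/= => /andP[-> h]; rewrite (le_lt_trans h)// ltrDl//.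
apply: (@is_derive_near _ (fun t' => \int[mu]_(tau in D) hPt x (t' - tau) tau -
    (\int[mu]_(tau in `]0, T[) f x tau - \int[mu]_(tau in `]0, t']) f x tau))).
  near=> t'; rewrite (@hS_split x t' T)//.
    by rewrite Rint_setD1//; exact: itg_hPt.
  by apply/andP; split; near: t'; [exact: lt_nbhsr|exact: lt_nbhsl].
by apply: is_derive_eq; rewrite E; ring.
Unshelve. all: by end_near. Qed.

Lemma hS_t0 x : 0 < x -> hS x t @[t --> 0^'+] --> (0 : R).
Proof.
move=> x0; have [M M0 MP] := source_bound 1.
apply: (@cvg0_norm_le _ _ _ _ _ (fun t => M * t)).
  near=> t; have t0 : 0 < t by near: t; exact: nbhs_right_gt.
  have t1 : t <= 1 by near: t; exact: nbhs_right_le.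
  apply: Rint_bound_oo; first exact: ltW.
    by apply: itg_measurable; exact: itg_hP_t.
  move=> tau /andP[h1 h2]; have [fd _ fb _] := MP tau (le_trans (ltW h2) t1).
  by apply: hP_bound; [case: fd|move=> y y0; have [] := fb y y0|exact: ltW|rewrite subr_gt0].
rewrite -[X in _ --> X](mulr0 M); apply: cvgM; first exact: cvg_cst.
apply: cvg_at_right_filter; exact: cvg_id.
Unshelve. all: by end_near. Qed.

Lemma hS_x0 t : 0 < t -> hS x t @[x --> 0^'+] --> (0 : R).
Proof.
move=> t0; have [M M0 MP] := source_bound t.
rewrite [X in _ --> X](_ : 0 = \int[mu]_(tau in `]0, t[) (cst 0) tau); last first.
  by rewrite Rintegral_cst// mul0r.
apply: (@cvg_Rint_at_right _ _ (fun x tau => hP (f ^~ tau) x (t - tau)) (cst 0) (fun=> M) 0 1) => //.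
- exact: itg_cst_oo.
- by move=> x /andP[x0 _]; apply: measurable_hP_t.
- move=> x tau /andP[x0 _]; rewrite /= in_itv/= => /andP[h1 h2].
  have [fd _ fb _] := MP tau (ltW h2).
  by apply: hP_bound; [case: fd|move=> y y0; have [] := fb y y0|exact: ltW|rewrite subr_gt0].
- move=> tau; rewrite /= in_itv/= => /andP[h1 h2].
  have [fd _ fb _] := MP tau (ltW h2).
  by apply: (hP_x0 fd); rewrite subr_gt0.
Qed.

End Source.

Arguments hS {R} f x t.
Arguments hSx {R} f x t.
Arguments hSxx {R} f x t.
Arguments hPt {R} f x s tau.

(** * Representation of solutions *)

Section Representation.
Variable R : realType.
Notation mu := (@lebesgue_measure R).
Notation itg D f := (mu.-integrable D (EFin \o f)).
Notation D0 := (`]0, +oo[%classic : set R).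
Implicit Types (x y z s t c e tau : R) (k B : R -> R).

Variables (v vx vxx vt f f1 f2 : R -> R -> R) (u0 g f0 : R -> R).
Hypothesis fP : source f f1 f2 f0.
Hypothesis gb : bdd_loc g.
Hypothesis gc : continuous g.
Hypothesis v_x : forall x t, 0 < x -> 0 < t -> is_derive x (1 : R) (v ^~ t) (vx x t).
Hypothesis v_xx : forall x t, 0 < x -> 0 < t -> is_derive x (1 : R) (vx ^~ t) (vxx x t).
Hypothesis v_t : forall x t, 0 < x -> 0 < t -> is_derive t (1 : R) (v x) (vt x t).
Hypothesis heat : forall x t, 0 < x -> 0 < t -> vt x t - vxx x t = f x t.
Hypothesis vxx_c : forall x t, 0 < x -> 0 < t -> {for x, continuous (vxx ^~ t)}.
Hypothesis v_c : forall x t, 0 < x -> 0 < t -> forall e : R, 0 < e -> exists2 d : R, 0 < d &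
  forall y tau, 0 < y -> 0 < tau -> `|y - x| < d -> `|tau - t| < d -> `|v y tau - v x t| <= e.
Hypothesis v_t0 : forall x, 0 < x -> v x t @[t --> 0^'+] --> u0 x.
Hypothesis v_x0 : forall t, 0 < t -> v x t @[x --> 0^'+] --> g t.
Hypothesis vx_b : forall t, 0 < t -> exists M : R, forall x, 0 < x -> `|vx x t| <= M.
Hypothesis v_y : forall t, 0 < t -> v x t @[x --> +oo] --> (0 : R).
Hypothesis v_B : forall T : R, 0 < T -> exists B : R -> R, [/\ itg D0 B, forall x, 0 < x -> 0 <= B x &
  forall x t, 0 < x -> 0 < t <= T -> `|v x t| ^+ 2 <= B x /\ `|vt x t| ^+ 2 <= B x].

Lemma norm_le_1sqr (a b : R) : `|a| ^+ 2 <= b -> `|a| <= 1 + b.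
Proof. by move=> h; apply: (@le_trans _ _ (1 + `|a| ^+ 2)); [have := sqr_ge0 (`|a| - 1); have := normr_ge0 a; nra|rewrite lerD2l]. Qed.

Lemma continuous_D0_measurable k : (forall y, 0 < y -> {for y, continuous k}) -> measurable_fun D0 k.
Proof.
move=> kc; apply: open_continuous_measurable_fun; first exact: interval_open.
by move=> y; rewrite inE D0P; exact: kc.
Qed.

(** Continuity is read off from the equation [vt = vxx + f]; the conditional only makes this an
    identity of functions on the whole line. *)
Lemma vt_c x t : 0 < x -> 0 < t -> {for x, continuous (vt ^~ t)}.
Proof.
move=> x0 t0; have [d12 _ _ _ _] := fP; have [H _] := d12 t x x0.
have -> : vt ^~ t = (fun y => if 0 < y then vxx y t + f y t else vt y t).
  by apply/funext => y; case: ifPn => // y0; rewrite -heat// addrC subrK.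
have h : {for x, continuous (fun y => vxx y t + f y t)}.
  by apply: cvgD; [exact: vxx_c|exact: (is_derive_continuous H)].
rewrite /prop_for /continuous_at x0; apply: cvg_trans h.
apply: near_eq_cvg; near=> y; rewrite ifT//; near: y; exact: lt_nbhsr.
Unshelve. all: by end_near. Qed.

Lemma dominated_v T : 0 < T -> exists2 B, itg D0 B &
  (forall y, 0 < y -> 0 <= B y) /\
  forall t, 0 < t <= T -> dominated (v ^~ t) 1 B /\ dominated (vt ^~ t) 1 B.
Proof.
move=> T0; have [B [Bi B0 BP]] := v_B T0; exists B => //; split => // t /[dup] tT /andP[t0 _].
split; split => //.
- by apply: continuous_D0_measurable => y y0; apply: is_derive_continuous (v_x y0 t0).
- by move=> y y0; apply: norm_le_1sqr; have [] := BP y t y0 tT.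
- by apply: continuous_D0_measurable => y y0; exact: vt_c.
- by move=> y y0; apply: norm_le_1sqr; have [] := BP y t y0 tT.
Qed.

(** Green's identity for a time slice, with [vxx] replaced by [vt - f]. The boundary limit [g t],
    the decay of [v] and the bound on [vx] enter here. *)
Lemma hPxx_v x s t : 0 < s -> 0 < t ->
  hPxx (v ^~ t) x s = hP (vt ^~ t) x s - hP (f ^~ t) x s - g t * hh x s.
Proof.
move=> s0 t0; have [B Bi [B0 /(_ t)]] := dominated_v t0.
rewrite t0 lexx => /(_ isT)[vd vtd].
have [M M0 /(_ t (lexx _))[fd _ _ _]] := source_bound fP t.
have [M' M'P] := vx_b t0.
have [I1 _ _] := itg_hP x vtd s0; have [I2 _ _] := itg_hP x fd s0.
have vxxE y : 0 < y -> vxx y t = vt y t - f y t by move=> y0; rewrite -heat//; ring.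
have vxxd : dominated (vxx ^~ t) 1 (fun y => B y + M * (1 + y ^+ 2)^-1).
  split => //.
  - by apply: continuous_D0_measurable => y y0; exact: vxx_c.
  - by apply: itgD => //; apply: itgZl => //; exact: itg_oneDsqrV0.
  - by move=> y y0; rewrite addr_ge0 ?B0// mulr_ge0// oneDsqrV_ge0.
  - move=> y y0; rewrite vxxE// addrA (le_trans (ler_normB _ _))//.
    have [_ _ _ _ h1] := vtd; have [_ _ _ _ h2] := fd.
    by apply: lerD; [exact: h1|rewrite (le_trans (h2 _ y0))// add0r].
(* In the common bound, [1] serves [v] near infinity, where it tends to [0], and [M'] serves
   [vx]. *)
rewrite (@hP_green _ (v ^~ t) (vx ^~ t) (vxx ^~ t) (g t) (Num.max 1 M') x s _ _ _ _ s0 _ _ _ vd vxxd)//.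
- congr (_ - _); rewrite /hP -RintegralB//; apply: eqRint => y; rewrite /= in_itv/= andbT => y0.
  by rewrite vxxE// mulrBl.
- by move=> y y0; exact: v_x.
- by move=> y y0; exact: v_xx.
- by move=> y y0; exact: vxx_c.
- exact: v_x0.
- near=> y; have h : `|v y t| <= 1.
    by near: y; exact: (cvgr0_norm_le _ (v_y t0) 1 ltr01).
  by rewrite (le_trans h)// le_max lexx.
- by move=> y y0; rewrite (le_trans (M'P _ y0))// le_max lexx orbT.
Unshelve. all: by end_near. Qed.

(** The kernel time [t - r] runs backwards, so the derivative is [hP] of [vt] minus [hPxx] of [v];
    [hPxx_v] cancels the [vt] terms and leaves source and boundary flux. *)
Lemma is_derive_hP_v x t tau : 0 < x -> 0 < tau < t ->
  is_derive tau (1 : R) (fun r => hP (v ^~ r) x (t - r))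
    (hPt f x (t - tau) tau + g tau * hh x (t - tau)).
Proof.
move=> x0 /andP[tau0 taut]; have t0 : 0 < t by exact: lt_trans taut.
have [B Bi [B0 Bd]] := dominated_v t0.
(* Between [a] and [b] both [r] and the kernel time [t - r] stay away from [0], so one majorant in
   [y] covers the whole interval. *)
pose a := tau / 2; pose b := (tau + t) / 2.
have a0 : 0 < a by rewrite divr_gt0.
have ab : a < tau < b by rewrite /a /b; apply/andP; split; lra.
have bt : b < t by rewrite /b; lra.
have tb : 0 < t - b by rewrite subr_gt0.
have [C C0 CP] := @hG_bounds R (t - b) t `|x| tb.
have Ib r : a < r < b -> 0 < r <= t /\ t - b <= t - r <= t.
  by move=> /andP[h1 h2]; split; apply/andP; split; lra.
have -> : hPt f x (t - tau) tau + g tau * hh x (t - tau) =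
    \int[mu]_(y in D0) (vt y tau * hG x y (t - tau) - v y tau * hGyy x y (t - tau)).
  have s0 : 0 < t - tau by rewrite subr_gt0.
  have [vd vtd] := Bd tau (Ib _ ab).1.
  have [I1 _ _] := itg_hP x vtd s0; have [_ _ I2] := itg_hP x vd s0.
  rewrite RintegralB// hPtE//.
  have := hPxx_v x s0 tau0; rewrite /hPxx => ->.
  by rewrite -/(hP (vt ^~ tau) x (t - tau)); ring.
apply: (@is_derive_under _ _ (fun r y => v y r * hG x y (t - r))
  (fun r y => vt y r * hG x y (t - r) - v y r * hGyy x y (t - r)) tau a b
  (fun y => 2 * C * weight 1 B y)) => //.
- move=> r /Ib [h1 /andP[h2 h3]]; have [vd _] := Bd r h1.
  by have [] := itg_hP x vd (lt_le_trans tb h2).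
- move=> r y /Ib [/andP[h1 _] /andP[h2 _]]; rewrite /= in_itv/= andbT => y0.
  have H1 := v_t y0 h1.
  have H2 := is_derive_hG_s x y (lt_le_trans tb h2).
  have H3 : is_derive r (1 : R) (fun u : R => t - u) (-1).
    by apply: is_derive_eq; rewrite /GRing.scale /=; ring.
  have H4 := @is_derive1_comp R (hG x y) (fun u => t - u) r _ _ H2 H3.
  by apply: is_derive_eq; rewrite /GRing.scale /=; ring.
- by apply: itgZl => //; exact: itg_weight.
- move=> r y /Ib [h1 h2]; rewrite /= in_itv/= andbT => y0.
  have [[_ _ _ _ vb] [_ _ _ _ vtb]] := Bd r h1.
  have [G1 _ _ G2] := CP x y (t - r) (lexx _) h2.
  apply: (le_trans (ler_normB _ _)); rewrite (normrM (vt y r)) (normrM (v y r)).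
  have -> : 2 * C * weight 1 B y = C * weight 1 B y + C * weight 1 B y by ring.
  apply: lerD.
    apply: le_trans (weight_ge (v := vt ^~ r) ler01 y0 (B0 _ y0) (ltW C0) (vtb _ y0)).
    by rewrite ler_wpM2l.
  apply: le_trans (weight_ge (v := v ^~ r) ler01 y0 (B0 _ y0) (ltW C0) (vb _ y0)).
  by rewrite ler_wpM2l.
Qed.

(** For [r < t / 2] the kernel time exceeds [t / 2], so the kernel is regular and dominated
    convergence needs only the pointwise initial limit, without uniformity near the corner. *)
Lemma hP_v_t0 x t : 0 < x -> 0 < t ->
  hP (v ^~ tau) x (t - tau) @[tau --> 0^'+] --> hP u0 x t.
Proof.
move=> x0 t0; have [B Bi [B0 Bd]] := dominated_v t0.
have t20 : 0 < t / 2 by rewrite divr_gt0.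
have [C C0 CP] := @hG_bounds R (t / 2) t `|x| t20.
apply: (@cvg_Rint_at_right _ _ (fun r y => v y r * hG x y (t - r)) _
   (fun y => C * weight 1 B y) 0 (t / 2)) => //.
- by apply: itgZl => //; exact: itg_weight.
- move=> r /andP[r0 rt]; have [vd _] := Bd r ltac:(apply/andP; split; lra).
  by apply: itg_measurable; have [] := itg_hP x vd (ltac:(lra) : 0 < t - r).
- move=> r y /andP[r0 rt]; rewrite /= in_itv/= andbT => y0.
  have [[_ _ _ _ vb] _] := Bd r ltac:(apply/andP; split; lra).
  have [G1 _ _ _] := CP x y (t - r) (lexx _) ltac:(apply/andP; split; lra).
  apply: le_trans (weight_ge (v := v ^~ r) ler01 y0 (B0 _ y0) (ltW C0) (vb _ y0)).
  by rewrite normrM ler_wpM2l.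
- move=> y; rewrite /= in_itv/= andbT => y0; apply: cvgM; first exact: v_t0.
  have H := is_derive_continuous (is_derive_hG_s x y t0).
  have h : t - r @[r --> 0^'+] --> t.
    rewrite -[X in _ --> X]subr0; apply: cvg_at_right_filter.
    by apply: cvgB; [exact: cvg_cst|exact: cvg_id].
  exact: (cvg_comp _ _ h H).
Qed.

(** The kernel time tends to [0] while the slice itself moves; this is where the constant of
    [hP_approx], independent of the slice, is needed. *)
Lemma hP_v_t x t : 0 < x -> 0 < t ->
  hP (v ^~ tau) x (t - tau) @[tau --> t^'-] --> v x t.
Proof.
move=> x0 t0; have [B Bi [B0 Bd]] := dominated_v t0.
apply/cvgrPdist_le => e e0; have e20 : 0 < e / 2 by rewrite divr_gt0.
have [d d0 dP] := v_c x0 t0 e20.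
have [C CP] := @hP_approx R x d 1 B `|v x t| x0 d0 ler01 Bi B0.
have C10 : 0 < (e / 2) / (`|C| + 1) by rewrite divr_gt0// ltr_wpDl.
near=> tau.
have tau0 : 0 < tau by near: tau; exact: nbhs_left_gt.
have taut : tau < t by near: tau; exact: nbhs_left_lt.
have tau1 : t - 1 < tau by near: tau; apply: nbhs_left_gt; rewrite gtrBl.
have taud : t - d < tau by near: tau; apply: nbhs_left_gt; rewrite gtrBl.
have tauC : t - (e / 2) / (`|C| + 1) < tau by near: tau; apply: nbhs_left_gt; rewrite gtrBl.
have [vd _] := Bd tau ltac:(by rewrite tau0 ltW).
rewrite distrC; apply: (le_trans (CP (v ^~ tau) (v x t) (e / 2) (t - tau) _ _ _ vd _)) => //.
- by apply/andP; split; lra.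
- exact: ltW.
- move=> y y0 yx; apply: dP => //.
  by rewrite distrC gtr0_norm ?subr_gt0//; lra.
rewrite [leRHS]splitr lerD2l.
apply: (@le_trans _ _ ((`|C| + 1) * (t - tau))).
  apply: ler_wpM2r; first by rewrite subr_ge0 ltW.
  by rewrite (le_trans (ler_norm _))// lerDl.
by rewrite mulrC -ler_pdivlMr ?ltr_wpDl//; lra.
Unshelve. all: by end_near. Qed.

Theorem heat_representation x t : 0 < x -> 0 < t ->
  v x t = hP u0 x t + hB g x t + hS f x t.
Proof.
move=> x0 t0.
pose Psi tau := hPt f x (t - tau) tau + g tau * hh x (t - tau).
have cPsi : continuous Psi.
  move=> tau; apply: cvgD; first by apply: (continuous_hPt_t fP).
  apply: cvgM; first exact: gc.
  have H := is_derive_continuous (is_derive_hh_s (t - tau) x0).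
  apply: (continuous_comp (f := fun tau => t - tau)) => //.
  by apply: cvgB; [exact: cvg_cst|exact: cvg_id].
have iPsi a b : itg `]a, b] Psi.
  apply: (@integrableS _ _ _ mu `[a, b]) => //.
    by move=> z /=; rewrite !in_itv/= => /andP[/ltW-> ->].
  apply: continuous_compact_integrable; first exact: segment_compact.
  exact: continuous_subspaceT.
(* Starting the primitive at [-1] makes [0] an interior point, so [psi] is continuous there; [Psi]
   is continuous at all real times by the extensions of [hPt], [g] and [hh]. *)
pose psi (r : R) := \int[mu]_(tau in `]-1, r]) Psi tau.
have dpsi (r : R) : -1 < r -> is_derive r (1 : R) psi (Psi r).
  move=> r1; apply: (@is_derive_Rint_oc R Psi (-1) r (r + 1)) => //; [lra|exact: cPsi].
have cpsi (r : R) : -1 < r -> {for r, continuous psi} by move=> r1; exact: is_derive_continuous (dpsi r r1).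
(* [D] has zero derivative on []0, t[], so its one-sided limits at [0] and [t] coincide; this
   equality is the representation once [psi t - psi 0] is evaluated. *)
pose D (r : R) := hP (v ^~ r) x (t - r) - psi r.
have dD (r : R) : 0 < r < t -> is_derive r (1 : R) D 0.
  move=> rt; have h1 := is_derive_hP_v x0 rt.
  have h2 := dpsi r ltac:(lra).
  have := is_deriveB h1 h2; rewrite subrr; exact.
have cstD (a b : R) : 0 < a -> a <= b -> b < t -> D a = D b.
  move=> a0 ab bt; have [c cP E] : exists2 c, c \in `[a, b] & D b - D a = 0 * (b - a).
    apply: (@MVT_segment R D (fun=> 0)) => //.
      by move=> z; rewrite in_itv/= => /andP[h1 h2]; apply: dD; apply/andP; split; lra.
    apply: continuous_in_subspaceT => z; rewrite inE/= in_itv/= => /andP[h1 h2].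
    by apply: is_derive_continuous; apply: dD; apply/andP; split; lra.
  by apply/eqP; rewrite eq_sym -subr_eq0 E mul0r.
have D0 : D r @[r --> 0^'+] --> hP u0 x t - psi 0.
  apply: cvgB; first exact: hP_v_t0.
  by apply: cvg_at_right_filter; apply: cpsi; lra.
have Dt : D r @[r --> t^'-] --> v x t - psi t.
  apply: cvgB; first exact: hP_v_t.
  by apply: cvg_at_left_filter; apply: cpsi; lra.
have t20 : 0 < t / 2 by lra.
have E0 : D (t / 2) = hP u0 x t - psi 0.
  suff h : D r @[r --> 0^'+] --> D (t / 2) by exact: (cvg_unique _ h D0).
  apply: cvg_near_cst; near=> r; apply: cstD; last lra.
    by near: r; exact: nbhs_right_gt.
  by near: r; exact: nbhs_right_le.
have E1 : D (t / 2) = v x t - psi t.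
  suff h : D r @[r --> t^'-] --> D (t / 2) by exact: (cvg_unique _ h Dt).
  apply: cvg_near_cst; near=> r; symmetry; apply: (cstD _ _ t20).
    by near: r; apply: nbhs_left_ge; lra.
  by near: r; exact: nbhs_left_lt.
have E2 : psi t - psi 0 = hS f x t + hB g x t.
  rewrite /psi Rintegral_itvB//; last 2 first.
  - by rewrite bnd_simp; lra.
  - by rewrite bnd_simp; lra.
  rewrite -(Rintegral_itv_bndo_bndc (a := BRight 0)); last first.
    by apply: integrableS (iPsi 0 t) => // z /=; rewrite !in_itv/= => /andP[-> /ltW].
  rewrite RintegralD//; last 2 first.
  - exact: (itg_hPt fP).
  - by have [] := itg_hB gb x0 t0.
  by congr (_ + _); apply: eqRint => tau; rewrite /= in_itv/= => /andP[_ h]; rewrite hPtE.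
lra.
Unshelve. all: by end_near. Qed.

End Representation.

(* The boundary limit of [hB g] is read off the explicit solution [exp (t - x)]:
   representing it gives the limit for [g = exp], and a general [g] is compared
   with a multiple of [exp] near the time [t]. *)
Section BoundaryLimit.
Variable R : realType.
Notation mu := (@lebesgue_measure R).
Notation itg D f := (mu.-integrable D (EFin \o f)).
Notation D0 := (`]0, +oo[%classic : set R).
Implicit Types (x y z s t c e tau : R) (k B : R -> R).

Lemma source0 : source (fun _ _ => 0 : R) (fun _ _ => 0) (fun _ _ => 0) (fun=> 0).
Proof.
split=> //.
- by move=> tau y y0; split; exact: is_derive_cst.
- by move=> tau y y0; exact: cst_continuous.
- by move=> T; exists 0 => tau y _ _; rewrite normr0 mul0r.
- by move=> y _; exact: cst_continuous.
- by move=> tau; exact: cvg_cst.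
Qed.

Lemma bdd_loc_expR : bdd_loc (@expR R).
Proof.
split; first exact: measurable_expR.
by move=> T; exists (expR T) => t tT; rewrite ger0_norm ?expR_ge0// ler_expR.
Qed.

Lemma itg_expRN : itg D0 (fun y => expR (- y)).
Proof.
apply: (@itg_le _ _ _ (fun y => 2 * (1 + y ^+ 2)^-1)) => //.
- apply: continuous_D0_measurable => y _; apply: (continuous_comp (f := -%R)) => //.
    exact: (@cvgN _ R^o).
  exact: continuous_expR.
- move=> y; rewrite D0P => y0; rewrite ger0_norm ?expR_ge0//.
  rewrite ler_pdivlMr ?ltr_pwDl ?sqr_ge0// expRN mulrC ler_pdivrMr ?expR_gt0//.
  have := expR_ge1Dxn 1 (ltW y0); rewrite (_ : 2`!%:R = 2 :> R)//; lra.
- by apply: itgZl => //; exact: itg_oneDsqrV0.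
Qed.

Lemma hB_expR x t : 0 < x -> 0 < t ->
  hB expR x t = expR (t - x) - hP (fun y => expR (- y)) x t.
Proof.
move=> x0 t0.
have dx (y r : R) : is_derive y (1 : R) (fun u => expR (r - u)) (- expR (r - y)).
  by apply: is_derive_eq; rewrite /GRing.scale /=; ring.
have dx' (y r : R) : is_derive y (1 : R) (fun u => - expR (r - u)) (expR (r - y)).
  by apply: is_derive_eq; rewrite /GRing.scale /=; ring.
have dt (y r : R) : is_derive r (1 : R) (fun u => expR (u - y)) (expR (r - y)).
  have h : is_derive r (1 : R) (fun u : R => u - y) 1.
    by apply: is_derive_eq; rewrite oppr0 addr0.
  by have := @is_derive1_comp R expR (fun u => u - y) r _ _ (is_derive_expR (r - y)) h; rewrite mulr1.
have H := @heat_representation R (fun x t => expR (t - x)) (fun x t => - expR (t - x))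
  (fun x t => expR (t - x)) (fun x t => expR (t - x)) (fun _ _ => 0) (fun _ _ => 0) (fun _ _ => 0)
  (fun y => expR (- y)) expR (fun=> 0) source0 bdd_loc_expR (@continuous_expR R).
have S0 : hS (fun _ _ : R => 0) x t = 0.
  rewrite /hS -[RHS](mul0r (fine (mu `]0, t[))) -(Rintegral_cst mu)//.
  apply: eqRint => tau _; rewrite /hP -[RHS](mul0r (fine (mu D0))) -(Rintegral_cst mu)//.
  by apply: eqRint => y _; rewrite mul0r.
suff : expR (t - x) = hP (fun y => expR (- y)) x t + hB expR x t + hS (fun _ _ => 0) x t.
  by rewrite S0 addr0 => ->; rewrite addrAC subrr add0r.
have h1 : forall x t, 0 < x -> 0 < t -> is_derive x (1 : R) (fun x => expR (t - x)) (- expR (t - x)).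
  by move=> y r _ _; exact: dx.
have h2 : forall x t, 0 < x -> 0 < t -> is_derive x (1 : R) (fun x => - expR (t - x)) (expR (t - x)).
  by move=> y r _ _; exact: dx'.
have h3 : forall x t, 0 < x -> 0 < t -> is_derive t (1 : R) (fun t => expR (t - x)) (expR (t - x)).
  by move=> y r _ _; exact: dt.
have h4 : forall x t, 0 < x -> 0 < t -> expR (t - x) - expR (t - x) = 0.
  by move=> y r _ _; rewrite subrr.
have h5 : forall x t, 0 < x -> 0 < t -> {for x, continuous (fun x => expR (t - x))}.
  by move=> y r _ _; exact: (is_derive_continuous (dx y r)).
have h6 : forall x t, 0 < x -> 0 < t -> forall e : R, 0 < e -> exists2 d : R, 0 < d & forall y tau, 0 < y -> 0 < tau -> `|y - x| < d -> `|tau - t| < d -> `|expR (tau - y) - expR (t - x)| <= e.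
  move=> y r _ _ e e0.
  have /cvgrPdist_le /(_ _ e0) [d /= d0 dP] := @continuous_expR R (r - y).
  exists (d / 2); first by rewrite divr_gt0.
  move=> y' r' _ _ k1 k2; rewrite distrC; apply: dP => /=.
  rewrite (_ : r - y - (r' - y') = (y' - y) - (r' - r)); last by ring.
  by rewrite (le_lt_trans (ler_normB _ _))// [ltRHS]splitr ltrD.
have h7 : forall x, 0 < x -> expR (t - x) @[t --> 0^'+] --> expR (- x).
  move=> y _; rewrite -[X in expR X]sub0r; apply: cvg_at_right_filter.
  exact: (is_derive_continuous (dt y 0)).
have h8 : forall t, 0 < t -> expR (t - x) @[x --> 0^'+] --> expR t.
  move=> r _; rewrite -[X in _ --> expR X]subr0; apply: cvg_at_right_filter.
  exact: (is_derive_continuous (dx 0 r)).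
have h9 : forall t, 0 < t -> exists M : R, forall x, 0 < x -> `|- expR (t - x)| <= M.
  move=> r r0; exists (expR r) => y y0; rewrite normrN ger0_norm ?expR_ge0// ler_expR.
  by rewrite gerBl ltW.
have h10 : forall t, 0 < t -> expR (t - x) @[x --> +oo] --> (0 : R).
  move=> r r0; under eq_fun do rewrite expRD.
  have h : expR r * expR (- x) @[x --> +oo] --> expR r * 0.
    by apply: cvgM; [exact: cvg_cst|exact: cvgr_expR].
  by rewrite mulr0 in h.
(* The square has two factors [expR (- y)]; one is bounded by [1], the other makes the majorant
   integrable. *)
have h11 : forall T : R, 0 < T -> exists B : R -> R, [/\ itg D0 B, forall x, 0 < x -> 0 <= B x & forall x t, 0 < x -> 0 < t <= T -> `|expR (t - x)| ^+ 2 <= B x /\ `|expR (t - x)| ^+ 2 <= B x].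
  move=> T T0; exists (fun y => expR T ^+ 2 * expR (- y)); split.
  + by apply: itgZl => //; exact: itg_expRN.
  + by move=> y _; rewrite mulr_ge0 ?sqr_ge0 ?expR_ge0.
  + move=> y r y0 /andP[r0 rT]; suff : `|expR (r - y)| ^+ 2 <= expR T ^+ 2 * expR (- y) by [].
    rewrite ger0_norm ?expR_ge0// expRD exprMn; apply: ler_pM; rewrite ?sqr_ge0//.
      by rewrite lerXn2r ?nnegrE ?expR_ge0// ler_expR.
    by rewrite expr2 ler_piMr ?expR_ge0// expR_le1 oppr_le0 ltW.
exact: (H h1 h2 h3 h4 h5 h6 h7 h8 h9 h10 h11 x t x0 t0).
Qed.

Lemma hB_expR_x0 t : 0 < t -> hB expR x t @[x --> 0^'+] --> expR t.
Proof.
move=> t0; have d : dominated (fun y => expR (- y)) 0 (fun y => expR (- y)).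
  split=> //.
  - exact: itg_measurable itg_expRN.
  - exact: itg_expRN.
  - by move=> y _; rewrite ger0_norm ?expR_ge0// add0r.
have h1 := hP_x0 d t0.
have h2 : expR (t - x) @[x --> 0^'+] --> expR t.
  rewrite -[X in _ --> expR X]subr0; apply: cvg_at_right_filter.
  apply: (continuous_comp (f := fun x => t - x)); last exact: continuous_expR.
  by apply: cvgB; [exact: cvg_cst|exact: cvg_id].
have h : expR (t - x) - hP (fun y => expR (- y)) x t @[x --> 0^'+] --> expR t.
  by rewrite -[X in _ --> X]subr0; exact: cvgB h2 h1.
apply: cvg_trans h; apply: near_eq_cvg.
near=> x; rewrite /= hB_expR//; near: x; exact: nbhs_right_gt.
Unshelve. all: by end_near. Qed.

Lemma hh_ge0 x s : 0 <= x -> 0 <= s -> 0 <= hh x s.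
Proof. by move=> x0 s0; rewrite mulr_ge0 ?hK_ge0// divr_ge0. Qed.

Lemma hB_x0 (g : R -> R) t : bdd_loc g -> continuous g -> 0 < t ->
  hB g x t @[x --> 0^'+] --> g t.
Proof.
move=> gb gc t0; have [mg /(_ t)[Mg gM]] := gb.
(* This multiple of [expR] agrees with [g] at time [t], so the remainder [k] vanishes there. *)
pose q := g t * expR (- t).
have qE : g t = q * expR t by rewrite /q -mulrA -expRD addNr expR0 mulr1.
have Ec := hB_expR_x0 t0.
pose k tau := g tau - q * expR tau.
have kc : continuous k.
  move=> tau; apply: cvgB; first exact: gc.
  by apply: cvgM; [exact: cvg_cst|exact: continuous_expR].
have kt : k t = 0 by rewrite /k -qE subrr.
pose M := Mg + `|q| * expR t.
have kM tau : tau <= t -> `|k tau| <= M.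
  move=> h; rewrite (le_trans (ler_normB _ _))//; apply: lerD; first exact: gM.
  by rewrite normrM ler_wpM2l// ger0_norm ?expR_ge0// ler_expR.
have M0 : 0 <= M by apply: le_trans (kM t _).
suff D0 : hB g x t - q * hB expR x t @[x --> 0^'+] --> (0 : R).
  have h : hB g x t - q * hB expR x t + q * hB expR x t @[x --> 0^'+] --> g t.
    rewrite [X in _ --> X]qE -[X in _ --> X]add0r; apply: cvgD; first exact: D0.
    by apply: cvgM; [exact: cvg_cst|exact: Ec].
  by apply: cvg_trans h; apply: near_eq_cvg; near=> x; rewrite /= subrK.
apply/cvgr0Pnorm_le => e e0.
(* The factor that will multiply [e1] is [hB expR x t], which is at most [expR t + 1] for small [x];
   the near part is then at most [e / 2]. *)
pose e1 := (e / 2) / (expR t + 1).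
have et0 : 0 < expR t + 1 by rewrite addr_gt0 ?expR_gt0.
have e10 : 0 < e1 by rewrite divr_gt0// divr_gt0.
have /cvgrPdist_le /(_ _ e10) [d /= d0 dP] := kc t.
have [C C0 CP] := @hK_bounds R d t 1 d0.
have Kpos : 0 < M * (C / d) * t + 1 by rewrite ltr_wpDl// !mulr_ge0 ?invr_ge0// ltW.
near=> x.
have x0 : 0 < x by near: x; exact: nbhs_right_gt.
have x1 : x <= 1 by near: x; exact: nbhs_right_le.
have x2 : x <= (e / 2) / (M * (C / d) * t + 1).
  by near: x; apply: nbhs_right_le; rewrite divr_gt0// divr_gt0.
have Eb : hB expR x t <= expR t + 1.
  by near: x; apply: (cvgr_le _ Ec); rewrite ltrDl.
have [I1 _] := itg_hB gb x0 t0; have [I2 _] := itg_hB bdd_loc_expR x0 t0.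
have -> : hB g x t - q * hB expR x t = \int[mu]_(tau in `]0, t[) (k tau * hh x (t - tau)).
  rewrite /hB -RintegralZl// -RintegralB//; last exact: itgZl.
  by apply: eqRint => tau _; rewrite /k; ring.
have Ik : itg `]0, t[ (fun tau => k tau * hh x (t - tau)).
  apply: (eq_itg _ _ (itgB _ I1 (itgZl q _ I2))) => // tau _; rewrite /k; ring.
apply: (@le_trans _ _ (\int[mu]_(tau in `]0, t[) (e1 * (expR tau * hh x (t - tau)) + M * (C / d) * x))).
  apply: normRint_le => //.
  - exact: itg_measurable Ik.
  - move=> tau; rewrite /= in_itv/= => /andP[h1 h2].
    have hh0 : 0 <= hh x (t - tau) by apply: hh_ge0; rewrite ?subr_ge0 ltW.
    rewrite normrM (ger0_norm hh0).
    have B0 : 0 <= M * (C / d) * x by rewrite mulr_ge0 ?(ltW x0)// mulr_ge0// divr_ge0// ltW.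
    have A0 : 0 <= e1 * (expR tau * hh x (t - tau)) by apply: mulr_ge0; [exact: ltW|apply: mulr_ge0 => //; exact: expR_ge0].
    (* Near [t], [expR tau >= 1] allows [hh] to be replaced by [expR tau * hh], whose integral is
       the known [hB expR]. Far from [t], the kernel is at most [x * C / d], which vanishes with
       [x]. *)
    have [near|far] := ltP (t - tau) d.
      rewrite -[leLHS]addr0; apply: lerD => //.
      rewrite ler_pM//.
        have := dP tau; rewrite kt sub0r normrN; apply.
        by rewrite /= ger0_norm ?subr_ge0 ?ltW.
      by rewrite ler_peMl// -expR0 ler_expR ltW.
    rewrite -[leLHS]add0r; apply: lerD => //.
    rewrite -mulrA ler_pM ?kM ?(ltW h2)//.
    rewrite /hh; have [] := CP x 0 (t - tau).
    + by rewrite ger0_norm// ltW.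
    + by rewrite far gerBl ltW.
    rewrite subr0 expr0n addr0 invr1 mulr1 => hb _ _.
    have -> : C / d * x = x / d * C by rewrite mulrAC [RHS]mulrAC (mulrC C).
    apply: ler_pM => //; rewrite ?hK_ge0 ?divr_ge0 ?subr_ge0 ?(ltW x0) ?(ltW h2)//.
    by rewrite ler_wpM2l ?(ltW x0)// lef_pV2 ?posrE ?subr_gt0.
  - by apply: itgD => //; [exact: itgZl|exact: itg_cst_oo].
have icst : itg `]0, t[ (fun=> M * (C / d) * x) by exact: itg_cst_oo.
rewrite RintegralD//; last exact: itgZl.
rewrite RintegralZl// -/(hB expR x t).
rewrite [leRHS]splitr; apply: lerD.
  by rewrite /e1 mulrAC -mulrA ler_piMr ?divr_ge0 ?(ltW e0)// ler_pdivrMr// mul1r.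
apply: (le_trans (ler_norm _)).
apply: (le_trans (@Rint_bound_oo _ _ t (M * (C / d) * x) (ltW t0) _ _)) => //.
  by move=> tau _; rewrite ger0_norm// !mulr_ge0 ?invr_ge0// ltW.
apply: (@le_trans _ _ (x * (M * (C / d) * t + 1))); last by rewrite -ler_pdivlMr.
by rewrite mulrDr mulr1 mulrAC mulrC lerDl ltW.
Unshelve. all: by end_near. Qed.

End BoundaryLimit.

(** * Complex-valued integrals *)

Section ComplexToolbox.
Variable R : realType.
Notation mu := (@lebesgue_measure R).
Notation itg D f := (mu.-integrable D (EFin \o f)).
Notation D0 := (`]0, +oo[%classic : set R).
Notation cabs := (@ComplexField.Normc.normc R).
Implicit Types (x y s t : R) (z w : R[i]) (u v : R -> R[i]) (D : set R).

Lemma ReM z w : complex.Re (z * w) = complex.Re z * complex.Re w - complex.Im z * complex.Im w.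
Proof. by case: z w => a b [c d]. Qed.

Lemma ImM z w : complex.Im (z * w) = complex.Re z * complex.Im w + complex.Im z * complex.Re w.
Proof. by case: z w => a b [c d]. Qed.

Lemma ReD z w : complex.Re (z + w) = complex.Re z + complex.Re w.
Proof. by case: z w => a b [c d]. Qed.

Lemma ImD z w : complex.Im (z + w) = complex.Im z + complex.Im w.
Proof. by case: z w => a b [c d]. Qed.

Lemma ReN z : complex.Re (- z) = - complex.Re z.
Proof. by case: z. Qed.

Lemma ImN z : complex.Im (- z) = - complex.Im z.
Proof. by case: z. Qed.

Lemma complexP z w : complex.Re z = complex.Re w -> complex.Im z = complex.Im w -> z = w.
Proof. by case: z w => a b [c d] /= -> ->. Qed.

Lemma cabsE z : `|z| = (cabs z)%:C%C.
Proof. by []. Qed.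

Lemma cabs_ge0 z : 0 <= cabs z.
Proof. by case: z => a b; exact: sqrtr_ge0. Qed.

Lemma cabs_Re z : `|complex.Re z| <= cabs z.
Proof. by case: z => a b /=; rewrite -sqrtr_sqr ler_sqrt ?lerDl ?addr_ge0 ?sqr_ge0. Qed.

Lemma cabs_Im z : `|complex.Im z| <= cabs z.
Proof. by case: z => a b /=; rewrite -sqrtr_sqr ler_sqrt ?lerDr ?addr_ge0 ?sqr_ge0. Qed.

Lemma cabsM z w : cabs (z * w) = cabs z * cabs w.
Proof. exact: ComplexField.Normc.normcM. Qed.

Lemma cabs_real x : cabs x%:C%C = `|x|.
Proof. by rewrite /= expr0n addr0 sqrtr_sqr. Qed.

Lemma cabs_le_add z : cabs z <= `|complex.Re z| + `|complex.Im z|.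
Proof.
case: z => a b /=; rewrite -[leRHS]ger0_norm ?addr_ge0// -sqrtr_sqr.
rewrite ler_sqrt ?sqr_ge0// sqrrD !real_normK ?num_real// addrAC lerDl.
by rewrite mulrn_wge0// mulr_ge0.
Qed.

Lemma cexpD z w : cexp (z + w) = cexp z * cexp w.
Proof.
rewrite /cexp ReD ImD expRD cosD sinD.
by apply: complexP; rewrite !(ReM, ImM) /=; ring.
Qed.

Lemma cabs_cexp z : cabs (cexp z) = expR (complex.Re z).
Proof.
rewrite /cexp cabsM cabs_real ger0_norm ?expR_ge0//.
by rewrite /= cos2Dsin2 sqrtr1 mulr1.
Qed.

Definition cmeas d (T : measurableType d) (D : set T) (u : T -> R[i]) :=
  measurable_fun D (fun p => complex.Re (u p)) /\ measurable_fun D (fun p => complex.Im (u p)).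

Section Cmeas.
Context d (T : measurableType d).
Implicit Types (h k : T -> R[i]) (A : set T).

Lemma cmeas_real A (f : T -> R) : measurable_fun A f -> cmeas A (fun p => (f p)%:C%C).
Proof. by move=> mf; split => //=. Qed.

Lemma cmeas_cst A z : cmeas A (fun=> z).
Proof. by split. Qed.

Lemma cmeasM A h k : cmeas A h -> cmeas A k -> cmeas A (fun p => h p * k p).
Proof.
move=> [h1 h2] [k1 k2]; split.
  under eq_fun do rewrite ReM.
  by apply: measurable_funB; apply: measurable_funM.
under eq_fun do rewrite ImM.
by apply: measurable_funD; apply: measurable_funM.
Qed.

Lemma cmeasD A h k : cmeas A h -> cmeas A k -> cmeas A (fun p => h p + k p).
Proof.
move=> [h1 h2] [k1 k2]; split.
  by under eq_fun do rewrite ReD; exact: measurable_funD.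
by under eq_fun do rewrite ImD; exact: measurable_funD.
Qed.

Lemma cmeasN A h : cmeas A h -> cmeas A (fun p => - h p).
Proof.
move=> [h1 h2]; split.
  by under eq_fun do rewrite ReN; exact: measurableT_comp.
by under eq_fun do rewrite ImN; exact: measurableT_comp.
Qed.

Lemma cmeas_cexp A h : cmeas A h -> cmeas A (fun p => cexp (h p)).
Proof.
move=> [h1 h2]; apply: cmeasM.
  by apply: cmeas_real; apply: measurableT_comp => //; exact: measurable_expR.
split => /=; apply: measurableT_comp => //.
  by apply: continuous_measurable_fun; exact: continuous_cos.
by apply: continuous_measurable_fun; exact: continuous_sin.
Qed.

End Cmeas.

Lemma cmeas_fst (D1 D2 : set R) u : measurable D1 -> cmeas D1 u ->
  cmeas (D1 `*` D2) (fun p : R * R => u p.1).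
Proof.
by move=> mD [u1 u2]; split;
  [apply: (measurable_comp mD _ u1)|apply: (measurable_comp mD _ u2)] => //;
  try (by move=> _ [[a b] [ha _] <-]); apply: measurable_funTS; exact: measurable_fst.
Qed.

Lemma cmeas_snd (D1 D2 : set R) u : measurable D2 -> cmeas D2 u ->
  cmeas (D1 `*` D2) (fun p : R * R => u p.2).
Proof.
by move=> mD [u1 u2]; split;
  [apply: (measurable_comp mD _ u1)|apply: (measurable_comp mD _ u2)] => //;
  try (by move=> _ [[a b] [_ ha] <-]); apply: measurable_funTS; exact: measurable_snd.
Qed.

Definition citg D u := itg D (fun s => complex.Re (u s)) /\ itg D (fun s => complex.Im (u s)).

Lemma citg_le D u (g : R -> R) : measurable D -> cmeas D u ->
  (forall s, D s -> cabs (u s) <= g s) -> itg D g -> citg D u.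
Proof.
move=> mD [m1 m2] ug gi; split; apply: (itg_le mD _ _ gi) => // s Ds.
  exact: le_trans (cabs_Re _) (ug s Ds).
exact: le_trans (cabs_Im _) (ug s Ds).
Qed.

Lemma citg_cmeas D u : citg D u -> cmeas D u.
Proof. by move=> [u1 u2]; split; exact: itg_measurable. Qed.

Lemma eq_cint D u v : (forall s, D s -> u s = v s) -> cint D u = cint D v.
Proof. by move=> uv; rewrite /cint; congr (_ +i* _)%C; apply: eqRint => s Ds; rewrite uv. Qed.

Lemma eq_citg D u v : measurable D -> (forall s, D s -> u s = v s) -> citg D u -> citg D v.
Proof. by move=> mD uv [u1 u2]; split; [apply: eq_itg u1|apply: eq_itg u2] => // s Ds; rewrite uv. Qed.

Lemma citgD D u v : measurable D -> citg D u -> citg D v -> citg D (fun s => u s + v s).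
Proof.
move=> mD [u1 u2] [v1 v2]; split.
  by apply: (eq_itg mD _ (itgD mD u1 v1)) => s _; rewrite ReD.
by apply: (eq_itg mD _ (itgD mD u2 v2)) => s _; rewrite ImD.
Qed.

Lemma citgZ D z u : measurable D -> citg D u -> citg D (fun s => z * u s).
Proof.
move=> mD [u1 u2]; split.
  by apply: (eq_itg mD _ (itgB mD (itgZl (complex.Re z) mD u1) (itgZl (complex.Im z) mD u2))) => s _; rewrite ReM.
by apply: (eq_itg mD _ (itgD mD (itgZl (complex.Re z) mD u2) (itgZl (complex.Im z) mD u1))) => s _; rewrite ImM.
Qed.

Lemma cintD D u v : measurable D -> citg D u -> citg D v ->
  cint D (fun s => u s + v s) = cint D u + cint D v.
Proof.
move=> mD [u1 u2] [v1 v2]; apply: complexP; rewrite ?ReD ?ImD /=.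
  by rewrite -RintegralD//; apply: eqRint => s _; rewrite ReD.
by rewrite -RintegralD//; apply: eqRint => s _; rewrite ImD.
Qed.

Lemma cintZ D z u : measurable D -> citg D u -> cint D (fun s => z * u s) = z * cint D u.
Proof.
move=> mD [u1 u2]; apply: complexP; rewrite ?ReM ?ImM /=.
  rewrite -RintegralZl// -RintegralZl// -RintegralB//; last 2 first.
  - exact: itgZl.
  - exact: itgZl.
  by apply: eqRint => s _; rewrite ReM.
rewrite -RintegralZl// -RintegralZl// -RintegralD//; last 2 first.
- exact: itgZl.
- exact: itgZl.
by apply: eqRint => s _; rewrite ImM.
Qed.

Lemma cintB D u v : measurable D -> citg D u -> citg D v ->
  cint D (fun s => u s - v s) = cint D u - cint D v.
Proof.
move=> mD ui vi; rewrite -[in RHS]mulN1r -cintZ// -cintD//; last exact: citgZ.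
by apply: eq_cint => s _; rewrite mulN1r.
Qed.

Lemma citgB D u v : measurable D -> citg D u -> citg D v -> citg D (fun s => u s - v s).
Proof.
move=> mD ui vi; apply: (eq_citg mD _ (citgD mD ui (citgZ (-1) mD vi))) => s _.
by rewrite mulN1r.
Qed.

Lemma cint_obnd_cbnd (a : R) b u : citg [set` Interval (BRight a) b] u ->
  cint [set` Interval (BLeft a) b] u = cint [set` Interval (BRight a) b] u.
Proof. by move=> [u1 u2]; rewrite /cint -!Rintegral_itv_obnd_cbnd. Qed.

Lemma Rint_cc_oo (a b : R) (f : R -> R) : measurable_fun `]a, b[ f ->
  \int[mu]_(s in `[a, b]) f s = \int[mu]_(s in `]a, b[) f s.
Proof.
move=> mf; rewrite /Rintegral -integral_itv_obnd_cbnd.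
  by rewrite -integral_itv_bndo_bndc//; exact/measurable_EFinP.
by apply/measurable_EFinP; apply/measurable_fun_itv_bndo_bndcP.
Qed.

Lemma cint_cc_oo (a b : R) u : citg `]a, b[ u -> cint `[a, b] u = cint `]a, b[ u.
Proof. by move=> [/itg_measurable u1 /itg_measurable u2]; rewrite /cint !Rint_cc_oo. Qed.

(** Both components are bounded by the modulus, so one majorant [G] serves two applications of the
    real theorem. *)
Lemma cFubini (D1 D2 : set R) (F : R -> R -> R[i]) (G : R -> R -> R) (g : R -> R) :
  measurable D1 -> measurable D2 -> cmeas (D1 `*` D2) (fun p : R * R => F p.1 p.2) ->
  (forall s y, D1 s -> D2 y -> cabs (F s y) <= G s y) ->
  (forall s, D1 s -> itg D2 (G s)) -> (forall y, D2 y -> itg D1 (G ^~ y)) ->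
  itg D1 g -> (forall s, D1 s -> \int[mu]_(y in D2) G s y <= g s) ->
  [/\ citg D1 (fun s => cint D2 (F s)), citg D2 (fun y => cint D1 (F ^~ y)) &
      cint D1 (fun s => cint D2 (F s)) = cint D2 (fun y => cint D1 (F ^~ y))].
Proof.
move=> mD1 mD2 [m1 m2] FG G1 G2 gi Gg.
have sec1 (H : R -> R -> R) : measurable_fun (D1 `*` D2) (fun p : R * R => H p.1 p.2) ->
    (forall s y, D1 s -> D2 y -> `|H s y| <= G s y) ->
    [/\ itg D1 (fun x => \int[mu]_(y in D2) H x y),
      itg D2 (fun y => \int[mu]_(x in D1) H x y) &
      \int[mu]_(x in D1) (\int[mu]_(y in D2) H x y) =
      \int[mu]_(y in D2) (\int[mu]_(x in D1) H x y)].
  move=> mH HG.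
  have s1 s : D1 s -> itg D2 (H s).
    move=> Ds; apply: (itg_le mD2 _ _ (G1 s Ds)) => [|y Dy]; last exact: HG.
    apply: (@measurable_comp _ _ _ _ _ _ (D1 `*` D2) (fun p : R * R => H p.1 p.2) D2 (fun y => (s, y))) => //.
    - exact: measurableX.
    - by move=> _ [y Dy <-].
    - by apply: measurable_funTS; exact: measurable_pair1.
  have s2 y : D2 y -> itg D1 (H ^~ y).
    move=> Dy; apply: (itg_le mD1 _ _ (G2 y Dy)) => [|s Ds]; last exact: HG.
    apply: (@measurable_comp _ _ _ _ _ _ (D1 `*` D2) (fun p : R * R => H p.1 p.2) D1 (fun s => (s, y))) => //.
    - exact: measurableX.
    - by move=> _ [s Ds <-].
    - by apply: measurable_funTS; exact: measurable_pair2.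
  apply: (Fubini_dom mD1 mD2 mH s1 s2 gi) => s Ds.
  apply: le_trans (Gg s Ds); apply: le_Rintegral => //; first exact: itg_norm (s1 s Ds).
    exact: G1.
  by move=> y Dy; exact: HG.
have [a1 a2 a3] := sec1 _ m1 (fun s y Ds Dy => le_trans (cabs_Re _) (FG s y Ds Dy)).
have [b1 b2 b3] := sec1 _ m2 (fun s y Ds Dy => le_trans (cabs_Im _) (FG s y Ds Dy)).
by split; [split|split|rewrite /cint /=; congr (_ +i* _)%C].
Qed.

(** With [Re nu <= 0] and [y > 0] the exponential has modulus at most one, so the double integrand
    is bounded by the product [p s * b y]. The exchange turns a contour integral of a transform into
    an integral of the datum against a kernel. *)
Lemma cint_swap D1 (P nu : R -> R[i]) (p b : R -> R) u : measurable D1 ->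
  cmeas D1 P -> cmeas D1 nu -> (forall s, D1 s -> complex.Re (nu s) <= 0) ->
  itg D1 p -> (forall s, D1 s -> cabs (P s) <= p s) ->
  cmeas D0 u -> itg D0 b -> (forall y, 0 < y -> cabs (u y) <= b y) ->
  [/\ forall s, D1 s -> citg D0 (fun y => cexp (nu s * y%:C%C) * u y),
      citg D1 (fun s => P s * cint D0 (fun y => cexp (nu s * y%:C%C) * u y)),
      citg D0 (fun y => cint D1 (fun s => P s * cexp (nu s * y%:C%C)) * u y) &
      cint D1 (fun s => P s * cint D0 (fun y => cexp (nu s * y%:C%C) * u y)) =
      cint D0 (fun y => cint D1 (fun s => P s * cexp (nu s * y%:C%C)) * u y)].
Proof.
move=> mD1 mP mnu nu0 pi Pp mu_ bi ub.
have y_m : cmeas D0 (fun y => y%:C%C) by apply: cmeas_real.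
have e1 s y : D1 s -> 0 < y -> cabs (cexp (nu s * y%:C%C)) <= 1.
  move=> Ds y0; rewrite cabs_cexp expR_le1 ReM /= mulr0 subr0.
  by rewrite mulr_le0_ge0 ?nu0// ltW.
have I1 s : D1 s -> citg D0 (fun y => cexp (nu s * y%:C%C) * u y).
  move=> Ds; apply: (citg_le _ _ _ bi) => //.
    by apply: cmeasM => //; apply: cmeas_cexp; apply: cmeasM => //; exact: cmeas_cst.
  move=> y; rewrite D0P => y0; rewrite cabsM; apply: le_trans (ub y y0).
  by rewrite ler_piMl ?cabs_ge0// e1.
have I2 y : 0 < y -> citg D1 (fun s => P s * cexp (nu s * y%:C%C)).
  move=> y0; apply: (citg_le _ _ _ pi) => //.
    by apply: cmeasM => //; apply: cmeas_cexp; apply: cmeasM => //; exact: cmeas_cst.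
  move=> s Ds; rewrite cabsM; apply: le_trans (Pp s Ds).
  by rewrite ler_piMr ?cabs_ge0// e1.
have mF : cmeas (D1 `*` D0) (fun q : R * R => P q.1 * (cexp (nu q.1 * q.2%:C%C) * u q.2)).
  apply: cmeasM; first exact: cmeas_fst.
  apply: cmeasM; last exact: cmeas_snd.
  by apply: cmeas_cexp; apply: cmeasM; [exact: cmeas_fst|exact: cmeas_snd].
have mD0 : measurable D0 by [].
have H1 s y : D1 s -> D0 y -> cabs (P s * (cexp (nu s * y%:C%C) * u y)) <= p s * b y.
  move=> Ds; rewrite D0P => y0; rewrite cabsM ler_pM ?cabs_ge0 ?Pp//.
  by rewrite cabsM; apply: le_trans (ub y y0); rewrite ler_piMl ?cabs_ge0 ?e1.
have H2 s : D1 s -> itg D0 (fun y => p s * b y) by move=> Ds; exact: itgZl.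
have H3 y : D0 y -> itg D1 (fun s => p s * b y).
  by move=> _; apply: (eq_itg mD1 _ (itgZl (b y) mD1 pi)) => s _; exact: mulrC.
have H4 : itg D1 (fun s => p s * \int[mu]_(y in D0) b y).
  by apply: (eq_itg mD1 _ (itgZl (\int[mu]_(y in D0) b y) mD1 pi)) => s _; exact: mulrC.
have H5 s : D1 s -> \int[mu]_(y in D0) (p s * b y) <= p s * \int[mu]_(y in D0) b y.
  by move=> Ds; rewrite RintegralZl.
have [F1 F2 F3] := @cFubini D1 D0 _ (fun s y => p s * b y) _ mD1 mD0 mF H1 H2 H3 H4 H5.
have E1 s : D1 s -> cint D0 (fun y => P s * (cexp (nu s * y%:C%C) * u y)) =
    P s * cint D0 (fun y => cexp (nu s * y%:C%C) * u y).
  by move=> Ds; exact: (cintZ (P s) mD0 (I1 s Ds)).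
have E2 y : D0 y -> cint D1 (fun s => P s * (cexp (nu s * y%:C%C) * u y)) =
    cint D1 (fun s => P s * cexp (nu s * y%:C%C)) * u y.
  rewrite D0P => y0; rewrite [RHS]mulrC -(cintZ (u y) mD1 (I2 y y0)).
  by apply: eq_cint => s _; rewrite [LHS]mulrA [LHS]mulrC.
split.
- exact: I1.
- exact: (eq_citg mD1 E1 F1).
- exact: (eq_citg mD0 E2 F2).
- by rewrite -(eq_cint E1) F3; exact: (eq_cint E2).
Qed.

End ComplexToolbox.

(** * Contour deformation *)

Section ContourKernels.
Variable R : realType.
Notation mu := (@lebesgue_measure R).
Notation itg D f := (mu.-integrable D (EFin \o f)).
Notation D0 := (`]0, +oo[%classic : set R).
Implicit Types (x y s t m n : R).

(** A real-variable form of Cauchy's theorem: [dF] is at once the parameter derivative of the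
    integrand and the [s]-derivative of [G], and [G] vanishes at both ends, so the integral has zero
    derivative in the parameter. *)
Lemma homotopy_Rint (F dF G : R -> R -> R) (a b : R) (g : R -> R) :
  (forall m, a < m < b -> itg D0 (F m)) ->
  (forall m s, a < m < b -> 0 < s -> is_derive m (1 : R) (F ^~ s) (dF m s)) ->
  itg D0 g -> (forall m s, a < m < b -> 0 < s -> `|dF m s| <= g s) ->
  (forall m s, a < m < b -> 0 < s -> is_derive s (1 : R) (G m) (dF m s)) ->
  (forall m s, a < m < b -> 0 < s -> {for s, continuous (dF m)}) ->
  (forall m, a < m < b -> G m s @[s --> 0^'+] --> (0 : R)) ->
  (forall m, a < m < b -> G m s @[s --> +oo] --> (0 : R)) ->
  forall m1 m2, a < m1 < b -> a < m2 < b ->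
  \int[mu]_(s in D0) F m1 s = \int[mu]_(s in D0) F m2 s.
Proof.
move=> Fi dFP gi gP dGP dFc G0 Gy m1 m2 h1 h2.
have dFi m : a < m < b -> itg D0 (dF m).
  move=> mab; apply: (itg_le _ _ _ gi) => //.
    by apply: continuous_D0_measurable => s s0; exact: dFc.
  by move=> s; rewrite D0P => s0; exact: gP.
have J m : a < m < b -> is_derive m (1 : R) (fun m => \int[mu]_(s in D0) F m s) 0.
  move=> mab; have : is_derive m (1 : R) (fun m => \int[mu]_(s in D0) F m s)
      (\int[mu]_(s in D0) dF m s).
    apply: (is_derive_under _ mab Fi _ gi) => //.
      by move=> x y xab; rewrite D0P => y0; exact: dFP.
    by move=> x y xab; rewrite D0P => y0; exact: gP.
  suff -> : \int[mu]_(s in D0) dF m s = 0 by [].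
  rewrite -[RHS](subr0 (0 : R)); apply: (@FTC_0y R (G m)).
  - by move=> y y0; exact: dGP.
  - by move=> y y0; exact: dFc.
  - exact: dFi.
  - exact: G0.
  - exact: Gy.
wlog h : m1 m2 h1 h2 / m1 <= m2.
  by move=> H; have [/H->|/ltW/H->] := leP m1 m2.
move/andP: h1 => [h1 _]; move/andP: h2 => [_ h2].
have [||c _ E] := @MVT_segment R (fun m => \int[mu]_(s in D0) F m s) (fun=> 0) m1 m2 h.
- by move=> z; rewrite in_itv/= => /andP[k1 k2]; apply: J; apply/andP; split; lra.
- apply: continuous_in_subspaceT => z; rewrite inE/= in_itv/= => /andP[k1 k2].
  by apply: (is_derive_continuous (J z _)); apply/andP; split; lra.
- by apply/eqP; rewrite eq_sym -subr_eq0 E mul0r.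
Qed.

Lemma Rint_opp (f : R -> R) : itg setT f ->
  \int[mu]_(s in `]-oo, 0]) f s = \int[mu]_(s in D0) f (- s) /\ itg D0 (fun s => f (- s)).
Proof.
move=> fi; have mf := itg_measurable fi.
have sub (h : R -> R) : measurable_fun setT h -> (forall s, 0 <= h s) ->
    (\int[mu]_(s in `]-oo, 0%R]) (h s)%:E = \int[mu]_(s in `]0%R, +oo[) (h (- s))%:E)%E.
  move=> mh h0.
  have mhN : measurable_fun setT (fun s => (h (- s))%:E).
    by apply/measurable_EFinP; exact: measurableT_comp.
  have -> : (\int[mu]_(s in `]-oo, 0%R]) (h s)%:E = \int[mu]_(s in `]-oo, 0%R]) (h (- - s))%:E)%E.
    by apply: eq_integral => s _; rewrite opprK.
  rewrite -(@ge0_integration_by_substitution0 R (fun s => (h (- s))%:E) mhN); last first.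
    by move=> r; rewrite lee_fin.
  by rewrite -integral_itv_obnd_cbnd//; exact: measurable_funTS.
have mfN : measurable_fun setT (fun s => f (- s)) by exact: measurableT_comp.
have fNi : itg D0 (fun s => f (- s)).
  apply/integrableP; split; first by apply/measurable_EFinP; exact: measurable_funTS.
  have := sub (fun s => `|f s|) (measurableT_comp (@normr_measurable _ _) mf) (fun s => normr_ge0 _).
  move=> /= <-; have /integrableP[_] := fi; apply: le_lt_trans.
  apply: ge0_subset_integral => //=.
  by apply/measurable_EFinP; apply: measurableT_comp.
split => //.
have fiN : itg `]-oo, 0] f by exact: integrableS fi.
(* [sub] treats nonnegative functions; a signed [f] is the difference of the nonnegative [|f| + f]
   and [|f|]. *)
pose p (s : R) := `|f s| + f s.
have p0 s : 0 <= p s by rewrite /p -lerBlDr sub0r -normrN ler_norm.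
have mp : measurable_fun setT p by apply: measurable_funD => //; exact: measurableT_comp.
have H (h : R -> R) : measurable_fun setT h -> (forall s, 0 <= h s) ->
    \int[mu]_(s in `]-oo, 0]) h s = \int[mu]_(s in D0) h (- s).
  by move=> mh h0; rewrite /Rintegral sub.
have E1 := H p mp p0.
have E2 := H (fun s => `|f s|) (measurableT_comp (@normr_measurable _ _) mf) (fun s => normr_ge0 _).
rewrite /p RintegralD// in E1; last exact: itg_norm.
rewrite RintegralD// in E1; last exact: itg_norm.
by move: E1; rewrite E2 => /addrI.
Qed.

Lemma Rint_setT (f : R -> R) : itg setT f ->
  \int[mu]_s f s = \int[mu]_(s in D0) (f s + f (- s)).
Proof.
move=> fi; have [E I] := Rint_opp fi.
have fi' : itg D0 f by exact: integrableS fi.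
rewrite RintegralD// -E -set_itvNyy addrC.
rewrite -(@Rintegral_itvB R f -oo%O +oo%O 0) ?set_itvNyy//; first by rewrite addrC subrK.
Qed.

(** From [exp X >= 1 + X^4/24] with [X = b s], and [(1 + s^2)^2 <= 2 + 2 s^4]: in the constant, [2]
    matches the first term, and [48/b^4] turns [b^4 s^4/24] into [2 s^4]. *)
Lemma expR_decay (b : R) : 0 < b -> exists2 C : R, 0 < C &
  forall s, 0 <= s -> (1 + s ^+ 2) * expR (- (b * s)) <= C * (1 + s ^+ 2)^-1.
Proof.
move=> b0; exists (2 + 48 / b ^+ 4).
  by rewrite ltr_pwDl// divr_ge0// exprn_ge0// ltW.
move=> s s0; have b4 : 0 < b ^+ 4 by rewrite exprn_gt0.
have h := @expR_ge1Dxn R (b * s) 3 ltac:(by rewrite mulr_ge0// ltW).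
rewrite expRN ler_pdivrMr ?expR_gt0// mulrAC ler_pdivlMr ?ltr_pwDl ?sqr_ge0//.
apply: (@le_trans _ _ ((2 + 48 / b ^+ 4) * (1 + (b * s) ^+ 4 / 4`!%:R))); last first.
  by rewrite ler_wpM2l// addr_ge0// divr_ge0 ?(ltW b4).
rewrite (_ : 4`!%:R = 24 :> R)// exprMn.
have -> : (2 + 48 / b ^+ 4) * (1 + b ^+ 4 * s ^+ 4 / 24) =
  2 + 2 * s ^+ 4 + (48 / b ^+ 4 + b ^+ 4 * s ^+ 4 / 12) by field; rewrite gt_eqF.
apply: (@le_trans _ _ (2 + 2 * s ^+ 4)).
  by have := sqr_ge0 (1 - s ^+ 2); nra.
by rewrite lerDl addr_ge0 ?divr_ge0 ?mulr_ge0 ?exprn_ge0// ltW.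
Qed.

(** The Fourier transform of the Gaussian, by homotopy in the frequency [k]: after multiplication by
    [expR (r * k ^+ 2)] the [k]-derivative is the [s]-derivative of [G], because
    [s * hK s r = - 2 r * hKz s r]. At frequency [0] the value is half the mass. *)
Lemma hK_cos_D0 (r m : R) : 0 < r ->
  \int[mu]_(s in D0) (hK s r * cos (s * m)) = expR (- (r * m ^+ 2)) / 2.
Proof.
move=> r0; have r00 : r != 0 by rewrite gt_eqF.
have r20 : 0 <= 2 * r by rewrite mulr_ge0// ltW.
have hKi : itg D0 (hK ^~ r).
  apply: (eq_itg _ _ (integrableS _ _ _ (itg_hK 0 r0))) => // s _.
  by rewrite sub0r hKN.
have [C C0 CP] := @hK_bounds R r r 0 r0.
have CP' s : hK s r <= C * (1 + s ^+ 2)^-1 /\ `|hKz s r| <= C * (1 + s ^+ 2)^-1.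
  have [h1 h2 _] := CP 0 (- s) r ltac:(by rewrite normr0) ltac:(by rewrite lexx).
  by rewrite sub0r opprK sqrrN in h1 h2.
have cosi (k : R) : itg D0 (fun s => hK s r * cos (s * k)).
  apply: (itg_le _ _ _ hKi) => //.
    apply: continuous_D0_measurable => s _; apply: cvgM; first exact: continuous_hK.
    apply: (continuous_comp (f := fun s => s * k)); last exact: continuous_cos.
    by apply: cvgM; [exact: cvg_id|exact: cvg_cst].
  move=> s _; rewrite normrM (ger0_norm (hK_ge0 _ _)) ler_piMr ?hK_ge0//.
  by rewrite ler_norml cos_geN1 cos_le1.
pose F k s := expR (r * k ^+ 2) * (hK s r * cos (s * k)).
pose G k s := expR (r * k ^+ 2) * (2 * r * (hK s r * sin (s * k))).
pose dF k s := expR (r * k ^+ 2) * (2 * r * (hKz s r * sin (s * k) + k * (hK s r * cos (s * k)))).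
have hKzE s : hKz s r = - (s / (2 * r)) * hK s r by [].
have dcos (s k : R) : is_derive k (1 : R) (fun k => cos (s * k)) (- (s * sin (s * k))).
  by apply: is_derive_eq; rewrite /GRing.scale /=; ring.
have dsin (s k : R) : is_derive s (1 : R) (fun s => sin (s * k)) (k * cos (s * k)).
  by apply: is_derive_eq; rewrite /GRing.scale /=; ring.
have dcos' (s k : R) : is_derive s (1 : R) (fun s => cos (s * k)) (- (k * sin (s * k))).
  by apply: is_derive_eq; rewrite /GRing.scale /=; ring.
have dexp (k : R) : is_derive k (1 : R) (fun k => expR (r * k ^+ 2)) (2 * r * k * expR (r * k ^+ 2)).
  by apply: is_derive_eq; rewrite /GRing.scale /=; ring.
pose b := `|m| + 1.
have b0 : 0 <= b by rewrite addr_ge0.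
pose A := expR (r * b ^+ 2) * (2 * r * (C + b * C)).
suff H : \int[mu]_(s in D0) F m s = \int[mu]_(s in D0) F 0 s.
  move: H; rewrite /F RintegralZl//.
  have -> : \int[mu]_(s in D0) (expR (r * 0 ^+ 2) * (hK s r * cos (s * 0))) = 2^-1.
    under eq_Rintegral do rewrite expr0n mulr0 expR0 mul1r mulr0 cos0 mulr1.
    have := Rint_hK 0 r0; rewrite Rint_setT; last exact: itg_hK.
    under eq_Rintegral do rewrite sub0r hKN opprK add0r.
    rewrite RintegralD// => h; lra.
  by move=> <-; rewrite mulrA -expRD addNr expR0 mul1r.
have bk k : - b < k < b -> `|k| <= b by move=> /andP[h1 h2]; rewrite ler_norml !ltW.
apply: (@homotopy_Rint F dF G (- b) b (fun s => A * (1 + s ^+ 2)^-1)).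
- by move=> k _; exact: itgZl.
- move=> k s _ s0; have H1 := dexp k; have H2 := dcos s k; rewrite /F /dF.
  by apply: is_derive_eq; rewrite /GRing.scale /= hKzE; field.
- by apply: itgZl => //; exact: itg_oneDsqrV0.
- move=> k s /bk kb s0; rewrite /dF /A -(mulrA (expR (r * b ^+ 2))).
  rewrite normrM (ger0_norm (expR_ge0 _)); apply: ler_pM; rewrite ?expR_ge0//.
    by rewrite ler_expR ler_pM2l// -real_normK ?num_real// lerXn2r ?nnegrE.
  rewrite (normrM (2 * r)) (ger0_norm r20) -(mulrA (2 * r)).
  apply: (ler_wpM2l r20); rewrite mulrDl; have [h1 h2] := CP' s.
  apply: (le_trans (ler_normD _ _)); apply: lerD.
    rewrite normrM -[leRHS]mulr1 ler_pM// ler_norml sin_geN1 sin_le1//.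
  rewrite normrM -(mulrA b); apply: ler_pM => //.
  rewrite normrM -[leRHS]mulr1; apply: ler_pM => //; first by rewrite (ger0_norm (hK_ge0 _ _)).
  by rewrite ler_norml cos_geN1 cos_le1.
- move=> k s _ s0; have H1 := is_derive_hKz s r00; have H2 := dsin s k; rewrite /G /dF.
  by apply: is_derive_eq; rewrite /GRing.scale /=; ring.
- move=> k s _ s0; have H1 := is_derive_hKz s r00; have H2 := dsin s k.
  have H3 := is_derive_hKzz s r00; have H4 := dcos' s k.
  apply: (@is_derive_continuous R (dF k) s (expR (r * k ^+ 2) * (2 * r *
    (hKzz s r * sin (s * k) + hKz s r * (k * cos (s * k)) +
     k * (hKz s r * cos (s * k) - hK s r * (k * sin (s * k))))))); rewrite /dF.
  by apply: is_derive_eq; rewrite /GRing.scale /=; ring.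
- move=> k _; rewrite [X in _ --> X](_ : 0 = G k 0); last by rewrite /G mul0r sin0 !mulr0.
  apply: cvg_at_right_filter; have H1 := is_derive_hKz 0 r00; have H2 := dsin 0 k.
  apply: (@is_derive_continuous R (G k) 0 (dF k 0)); rewrite /G /dF.
  by apply: is_derive_eq; rewrite /GRing.scale /=; ring.
- move=> k _; apply: (@cvg0_norm_le R R (pinfty_nbhs R) _ (G k) (fun s => expR (r * k ^+ 2) * (2 * r * C) * (1 + s ^+ 2)^-1)).
    near=> s; rewrite /G -(mulrA (expR _)) normrM (ger0_norm (expR_ge0 _)).
    apply: (ler_wpM2l (expR_ge0 _)); rewrite (normrM (2 * r)) (ger0_norm r20) -(mulrA (2 * r)).
    apply: (ler_wpM2l r20); have [h1 h2] := CP' s.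
    rewrite normrM -[leRHS]mulr1; apply: ler_pM => //; first by rewrite (ger0_norm (hK_ge0 _ _)).
    by rewrite ler_norml sin_geN1 sin_le1.
  rewrite -[X in _ --> X](mulr0 (expR (r * k ^+ 2) * (2 * r * C))).
  by apply: cvgM; [exact: cvg_cst|exact: cvg_oneDsqrV_y].
- by rewrite /b; have := ler_norm m; have := ler_norm (- m); rewrite normrN => h1 h2; apply/andP; split; lra.
- by apply/andP; split; rewrite /b; have := normr_ge0 m; lra.
Unshelve. all: by end_near. Qed.

Lemma is_derive_exp_trig (rho psi : R -> R) (s dr dp : R) :
  is_derive s (1 : R) rho dr -> is_derive s (1 : R) psi dp ->
  is_derive s (1 : R) (fun s => expR (rho s) * sin (psi s))
    (expR (rho s) * (dr * sin (psi s) + dp * cos (psi s))) /\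
  is_derive s (1 : R) (fun s => expR (rho s) * cos (psi s))
    (expR (rho s) * (dr * cos (psi s) - dp * sin (psi s))).
Proof.
move=> H1 H2; split; apply: is_derive_eq; rewrite /GRing.scale /=;
  by move: (expR _) (sin _) (cos _) => E S Q; ring.
Qed.

(* The homotopy parameter is reparametrised as [n = m (2 - m)], so that [n = 1] is
   reached at an interior point while [|n| <= 1] on a neighbourhood. *)
Lemma ray_param (m : R) : - 4^-1 < m < 2 -> `|m * (2 - m)| <= 1 /\ `|2 - 2 * m| <= 4.
Proof.
move=> /andP[h1 h2]; have h3 := sqr_ge0 (1 - m).
have h4 : 0 <= (m + 4^-1) * (2 - m) by rewrite mulr_ge0//; lra.
by rewrite !ler_norml; split; apply/andP; split; nra.
Qed.

(** The two terms are the coefficients [c1] and [c2] of [ray_homotopy] at [w = al * s]. Their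
    quadratic growth is what the exponential has to absorb there. *)
Lemma ray_coef (t w b n : R) : 0 < t -> 0 <= w -> 0 < b -> `|n| <= 1 ->
  `|2 * t * n * (w - b) * (2 * w - b)| + `|2 * t * (w - b) * (w - n ^+ 2 * (w - b)) - 1|
  <= 8 * t * (w + b) ^+ 2 + 1.
Proof.
move=> t0 w0 b0 n1; have t2 : 0 <= 2 * t by rewrite mulr_ge0// ltW.
have wb : `|w - b| <= w + b.
  by rewrite (le_trans (ler_normB _ _))// (ger0_norm w0) (gtr0_norm b0).
have wb0 : 0 <= w + b by rewrite addr_ge0// ltW.
have h1 : `|2 * w - b| <= 2 * (w + b).
  by rewrite (le_trans (ler_normB _ _))// (gtr0_norm b0) ger0_norm ?mulr_ge0//; lra.
have n2 : `|n ^+ 2 * (w - b)| <= w + b.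
  rewrite normrM normrX -[leRHS]mul1r; apply: ler_pM; rewrite ?exprn_ge0//.
  exact: exprn_ile1.
have h2 : `|w - n ^+ 2 * (w - b)| <= 2 * (w + b).
  rewrite (le_trans (ler_normB _ _))// (ger0_norm w0); lra.
have e1 : `|2 * t * n * (w - b) * (2 * w - b)| <= 2 * t * 1 * (w + b) * (2 * (w + b)).
  rewrite normrM; apply: ler_pM => //; rewrite normrM; apply: ler_pM => //.
  by rewrite normrM; apply: ler_pM => //; rewrite ger0_norm.
have e2 : `|2 * t * (w - b) * (w - n ^+ 2 * (w - b)) - 1| <= 2 * t * (w + b) * (2 * (w + b)) + 1.
  rewrite (le_trans (ler_normB _ _))// normr1 lerD2r normrM; apply: ler_pM => //.
  by rewrite normrM; apply: ler_pM => //; rewrite ger0_norm.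
rewrite (le_trans (lerD e1 e2))// [leRHS](_ : _ = 2 * t * 1 * (w + b) * (2 * (w + b)) +
  (2 * t * (w + b) * (2 * (w + b)) + 1))//; ring.
Qed.

(* With [b := a / (2 t)] and [l := al * s + i (b + n (al * s - b))], the integrand
   is the real part of [exp (i l a - l ^ 2 t) dl]: [n = 1] is the ray through
   [al + i al] and [n = 0] a horizontal half-line through the saddle point [i b]. *)
Lemma ray_homotopy (al a t : R) : 0 < al -> 0 < a -> 0 < t ->
  \int[mu]_(s in D0) (expR (- (al * a * s)) *
    (al * (cos (al * a * s - 2 * t * (al * s) ^+ 2) - sin (al * a * s - 2 * t * (al * s) ^+ 2)))) =
  \int[mu]_(s in D0) (expR (- (t * (al * s) ^+ 2) - a ^+ 2 / (4 * t)) * al).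
Proof.
move=> al0 a0 t0; pose b := a / (2 * t).
have t00 : t != 0 by rewrite gt_eqF.
have aE : a = 2 * t * b by rewrite /b; field.
have b0 : 0 < b by rewrite divr_gt0// mulr_gt0.
have ala : 0 < al * a by rewrite mulr_gt0.
(* [rho] and [psi] are the real and imaginary parts of [i l a - l^2 t]. The relation [a = 2 t b]
   cancels the terms linear in [n] from [rho] and those free of [n] from [psi]. *)
pose rho (n s : R) := - (t * ((al * s) ^+ 2 - n ^+ 2 * (al * s - b) ^+ 2 + b ^+ 2)).
pose psi (n s : R) := - (2 * t * n * (al * s * (al * s - b))).
pose nn (m : R) := m * (2 - m).
pose F (m s : R) := expR (rho (nn m) s) * (al * (cos (psi (nn m) s) - nn m * sin (psi (nn m) s))).
(* The real part of the exponential times [dl/dm], with [dl/dn = i (al * s - b)]; symmetry of mixed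
   derivatives makes its [s]-derivative equal to [dF]. At [s = 0] the point [l] moves along the
   imaginary axis, where the exponential is real, so [G] vanishes. *)
pose G (m s : R) := (2 - 2 * m) * (- (al * s - b) * (expR (rho (nn m) s) * sin (psi (nn m) s))).
pose c1 (n s : R) := 2 * t * n * (al * s - b) * (2 * (al * s) - b).
pose c2 (n s : R) := 2 * t * (al * s - b) * (al * s - n ^+ 2 * (al * s - b)) - 1.
pose dF (m s : R) := (2 - 2 * m) * (expR (rho (nn m) s) *
  (al * (c1 (nn m) s * cos (psi (nn m) s) + c2 (nn m) s * sin (psi (nn m) s)))).
have [C C0 CP] := expR_decay ala.
have n1 (m : R) : - 4^-1 < m < 2 -> `|nn m| <= 1 /\ `|2 - 2 * m| <= 4.
  exact: ray_param.
(* Since [n ^+ 2 <= 1], the decay is at least that of the ray [n = 1], where [rho] equals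
   [- al * a * s]. *)
have rhoP (m s : R) : - 4^-1 < m < 2 -> expR (rho (nn m) s) <= expR (- (al * a * s)).
  move=> /n1[h _]; rewrite ler_expR /rho aE.
  have h2 : nn m ^+ 2 <= 1 by rewrite -real_normK ?num_real// exprn_ile1.
  have h3 : nn m ^+ 2 * (al * s - b) ^+ 2 <= (al * s - b) ^+ 2.
    by rewrite ler_piMl ?sqr_ge0.
  have h4 : 0 <= t * ((al * s - b) ^+ 2 - nn m ^+ 2 * (al * s - b) ^+ 2).
    by rewrite mulr_ge0 ?subr_ge0// ltW.
  rewrite -subr_ge0; move: h4; set N := nn m ^+ 2 * _; set E := (X in _ -> 0 <= X).
  by rewrite (_ : E = t * ((al * s - b) ^+ 2 - N)) // /E; ring.
have sP (s : R) : 0 <= s -> expR (- (al * a * s)) <= C * (1 + s ^+ 2)^-1 /\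
    (1 + s ^+ 2) * expR (- (al * a * s)) <= C * (1 + s ^+ 2)^-1.
  move=> s0; have h := CP s s0; split => //; apply: le_trans h.
  by rewrite ler_peMl ?expR_ge0// lerDl sqr_ge0.
have cs (x : R) : `|cos x| <= 1 /\ `|sin x| <= 1.
  by rewrite !ler_norml cos_geN1 cos_le1 sin_geN1 sin_le1.
have drho (n s : R) : is_derive s (1 : R) (rho n)
    (- (2 * t * al * (al * s - n ^+ 2 * (al * s - b)))).
  by rewrite /rho; apply: is_derive_eq; rewrite /GRing.scale /=; ring.
have dpsi (n s : R) : is_derive s (1 : R) (psi n) (- (2 * t * n * al * (2 * (al * s) - b))).
  by rewrite /psi; apply: is_derive_eq; rewrite /GRing.scale /=; ring.
have dnn (m : R) : is_derive m (1 : R) nn (2 - 2 * m).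
  by rewrite /nn; apply: is_derive_eq; rewrite /GRing.scale /=; ring.
have drhom (m s : R) : is_derive m (1 : R) (fun m => rho (nn m) s)
    ((2 - 2 * m) * (2 * t * nn m * (al * s - b) ^+ 2)).
  by rewrite /rho; have H := dnn m; apply: is_derive_eq; rewrite /GRing.scale /=; ring.
have dpsim (m s : R) : is_derive m (1 : R) (fun m => psi (nn m) s)
    ((2 - 2 * m) * - (2 * t * (al * s * (al * s - b)))).
  by rewrite /psi; have H := dnn m; apply: is_derive_eq; rewrite /GRing.scale /=; ring.
have dlin (s : R) : is_derive s (1 : R) (fun s => al * s - b) al.
  by apply: is_derive_eq; rewrite /GRing.scale /=; ring.
have dFm (m s : R) : is_derive m (1 : R) (F ^~ s) (dF m s).
  rewrite /F; have [H1 H2] := is_derive_exp_trig (drhom m s) (dpsim m s).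
  have -> : (fun m => expR (rho (nn m) s) * (al * (cos (psi (nn m) s) - nn m * sin (psi (nn m) s)))) =
    (fun m => al * (expR (rho (nn m) s) * cos (psi (nn m) s)
              - nn m * (expR (rho (nn m) s) * sin (psi (nn m) s)))).
    by apply/funext => k; move: (expR _) (sin _) (cos _) => E S Q; clear; ring.
  have H3 := dnn m; clear drho dpsi dnn drhom dpsim; apply: is_derive_eq.
  rewrite /GRing.scale /= /dF /c1 /c2; move: (expR _) (sin _) (cos _) => E S Q.
  by move: (nn m) => N; clear; ring.
have dGs (m s : R) : is_derive s (1 : R) (G m) (dF m s).
  rewrite /G; have [H1 _] := is_derive_exp_trig (drho (nn m) s) (dpsi (nn m) s).
  have H3 := dlin s; clear drho dpsi dnn drhom dpsim dFm dlin; apply: is_derive_eq.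
  rewrite /GRing.scale /= /dF /c1 /c2; move: (expR _) (sin _) (cos _) => E S Q.
  by move: (nn m) => N; clear; ring.
have Fc (m s : R) : {for s, continuous (F m)}.
  have c1' := is_derive_continuous (drho (nn m) s); have c2' := is_derive_continuous (dpsi (nn m) s).
  apply: cvgM; first by apply: (continuous_comp c1'); exact: continuous_expR.
  apply: cvgM; first exact: cvg_cst.
  apply: cvgB; first by apply: (continuous_comp c2'); exact: continuous_cos.
  apply: cvgM; first exact: cvg_cst.
  by apply: (continuous_comp c2'); exact: continuous_sin.
have dFc (m s : R) : {for s, continuous (dF m)}.
  have c1' := is_derive_continuous (drho (nn m) s); have c2' := is_derive_continuous (dpsi (nn m) s).
  have c3 := is_derive_continuous (dlin s).
  have c4 : {for s, continuous (fun s : R => al * s)} by apply: cvgM; [exact: cvg_cst|exact: cvg_id].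
  apply: cvgM; first exact: cvg_cst.
  apply: cvgM; first by apply: (continuous_comp c1'); exact: continuous_expR.
  apply: cvgM; first exact: cvg_cst.
  have c5 : {for s, continuous (c1 (nn m))}.
    apply: cvgM; first by apply: cvgM; [exact: cvg_cst|exact: c3].
    by apply: cvgB; [apply: cvgM; [exact: cvg_cst|exact: c4]|exact: cvg_cst].
  have c6 : {for s, continuous (c2 (nn m))}.
    apply: cvgB; last exact: cvg_cst.
    apply: cvgM; first by apply: cvgM; [exact: cvg_cst|exact: c3].
    by apply: cvgB; [exact: c4|apply: cvgM; [exact: cvg_cst|exact: c3]].
  apply: cvgD; apply: cvgM => //.
    by apply: (continuous_comp c2'); exact: continuous_cos.
  by apply: (continuous_comp c2'); exact: continuous_sin.
pose K := 16 * t * (al ^+ 2 + b ^+ 2) + 1.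
have F0E : \int[mu]_(s in D0) F 0 s =
    \int[mu]_(s in D0) (expR (- (t * (al * s) ^+ 2) - a ^+ 2 / (4 * t)) * al).
  apply: eqRint => s _; rewrite /F /nn /rho /psi mul0r mulr0 mul0r oppr0 cos0 sin0 mul0r subr0 mulr1.
  by rewrite expr0n mul0r subr0 aE; congr (expR _ * _); field.
rewrite -F0E; have -> : \int[mu]_(s in D0) (expR (- (al * a * s)) *
    (al * (cos (al * a * s - 2 * t * (al * s) ^+ 2) - sin (al * a * s - 2 * t * (al * s) ^+ 2)))) =
    \int[mu]_(s in D0) F 1 s.
  apply: eqRint => s _; rewrite /F /nn /rho /psi aE.
  by congr (expR _ * (al * (cos _ - _))); [ring|ring|rewrite mul1r; set x := (2 - 1 : R);
    rewrite (_ : x = 1) ?mul1r; [congr (sin _)|]; rewrite /x; ring].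
apply: (@homotopy_Rint F dF G (- 4^-1) 2 (fun s => 4 * (al * K * C) * (1 + s ^+ 2)^-1)).
- move=> m mI; apply: (itg_le (g := fun s => 2 * al * C * (1 + s ^+ 2)^-1)) => //.
  + by apply: continuous_D0_measurable => s _; exact: Fc.
  + move=> s; rewrite D0P => s0; rewrite /F normrM (ger0_norm (expR_ge0 _)).
    have [h1 _] := sP s (ltW s0); rewrite [leRHS](_ : _ = (C * (1 + s ^+ 2)^-1) * (al * 2)); last by ring.
    apply: ler_pM; rewrite ?expR_ge0 ?(le_trans (rhoP _ _ mI) h1)//.
    rewrite normrM (gtr0_norm al0) ler_wpM2l ?(ltW al0)//.
    have [k1 k2] := cs (psi (nn m) s); have [k3 _] := n1 m mI.
    apply: (le_trans (ler_normB _ _)); rewrite (_ : 2 = 1 + 1 * 1 :> R); last by ring.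
    by apply: lerD => //; rewrite normrM ler_pM.
  + by apply: itgZl => //; exact: itg_oneDsqrV0.
- by apply: itgZl => //; exact: itg_oneDsqrV0.
- move=> m s mI s0; have [k3 k4] := n1 m mI; have [_ h2] := sP s (ltW s0).
  have [k1 k2] := cs (psi (nn m) s).
  have w0 : 0 <= al * s by rewrite mulr_ge0 ?(ltW s0)// ltW.
  have cK : `|c1 (nn m) s| + `|c2 (nn m) s| <= K * (1 + s ^+ 2).
    have V0 : 0 <= (al * s + b) ^+ 2 by exact: sqr_ge0.
    apply: (le_trans (ray_coef t0 w0 b0 k3)).
    have V1 : (al * s + b) ^+ 2 <= 2 * (al ^+ 2 + b ^+ 2) * (1 + s ^+ 2).
      have := sqr_ge0 (al * s - b); have := sqr_ge0 (b * s); have := sqr_ge0 al.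
      by nra.
    rewrite /K [leRHS]mulrDl mul1r; apply: lerD; last by rewrite lerDl sqr_ge0.
    rewrite (_ : 16 * t * _ * _ = 8 * t * (2 * (al ^+ 2 + b ^+ 2) * (1 + s ^+ 2))); last by ring.
    by apply: ler_wpM2l => //; rewrite mulr_ge0// ltW.
  rewrite /dF (normrM (2 - 2 * m)) -(mulrA 4); apply: ler_pM => //.
  rewrite normrM (ger0_norm (expR_ge0 _)) (normrM al) (gtr0_norm al0).
  rewrite [leLHS]mulrCA -(mulrA al) -(mulrA al); apply: (ler_wpM2l (ltW al0)).
  apply: (@le_trans _ _ (expR (- (al * a * s)) * (K * (1 + s ^+ 2)))).
    apply: ler_pM; rewrite ?expR_ge0 ?rhoP//; apply: le_trans cK.
    apply: (le_trans (ler_normD _ _)); rewrite !normrM.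
    by apply: lerD; rewrite ler_piMr.
  rewrite [leLHS]mulrC -(mulrA K) -(mulrA K); apply: ler_wpM2l => //.
  by rewrite /K addr_ge0// mulr_ge0 ?addr_ge0 ?sqr_ge0// mulr_ge0// ltW.
- by move=> m s _ _; exact: dFc.
- move=> m _; rewrite [X in _ --> X](_ : 0 = G m 0); last first.
    by rewrite /G /psi mulr0 mul0r mulr0 oppr0 sin0 !mulr0.
  apply: cvg_at_right_filter; exact: (is_derive_continuous (dGs m 0)).
- move=> m mI; apply: (@cvg0_norm_le R R (pinfty_nbhs R) _ (G m) (fun s => 4 * ((al + b) * C) * (1 + s ^+ 2)^-1)).
    near=> s; have s0 : 0 <= s by near: s; apply: nbhs_pinfty_ge; exact: num_real.
    have [k3 k4] := n1 m mI; have [_ h2] := sP s s0.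
    have [k1 k2] := cs (psi (nn m) s).
    rewrite /G (normrM (2 - 2 * m)) -(mulrA 4); apply: ler_pM => //.
    rewrite normrM normrN; apply: (@le_trans _ _ ((al + b) * (1 + s ^+ 2) * expR (- (al * a * s)))).
      apply: ler_pM => //; last first.
        rewrite normrM (ger0_norm (expR_ge0 _)) -[leRHS]mulr1.
        by apply: ler_pM; rewrite ?expR_ge0 ?rhoP.
      apply: (le_trans (ler_normB _ _)); rewrite (gtr0_norm b0) normrM (gtr0_norm al0) (ger0_norm s0) mulrDl.
      apply: lerD; first by rewrite ler_wpM2l ?(ltW al0)//; have := sqr_ge0 (s - 1); nra.
      by rewrite ler_peMr ?(ltW b0)// lerDl sqr_ge0.
    by rewrite -(mulrA (al + b)) -(mulrA (al + b)); apply: ler_wpM2l => //; rewrite addr_ge0// ltW.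
  rewrite -[X in _ --> X](mulr0 (4 * ((al + b) * C))).
  by apply: cvgM; [exact: cvg_cst|exact: cvg_oneDsqrV_y].
- by apply/andP; split; lra.
- by apply/andP; split; lra.
Unshelve. all: by end_near. Qed.

Lemma sqrt_pi_div (t : R) : 0 < t -> Num.sqrt (pi / t) = 2 * pi * (Num.sqrt (4 * pi * t))^-1.
Proof.
move=> t0; have p0 := pi_gt0 R.
have s0 : Num.sqrt (4 * pi * t) != 0 by rewrite gt_eqF// sqrtr_gt0 !mulr_gt0.
apply: (mulIf s0); rewrite mulfVK// -sqrtrM ?divr_ge0 ?(ltW p0) ?(ltW t0)//.
rewrite (_ : pi / t * (4 * pi * t) = (2 * pi) ^+ 2); last by field; rewrite gt_eqF.
by rewrite sqrtr_sqr ger0_norm// mulr_ge0// ltW.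
Qed.

(** The Gaussian weight is a multiple of the heat kernel at the reciprocal time [1/(4t)], so Fourier
    integrals over the line reduce to [hK_cos_D0]. *)
Lemma gauss_hK (t s : R) : 0 < t ->
  expR (- (t * s ^+ 2)) = Num.sqrt (pi / t) * hK s (4 * t)^-1.
Proof.
move=> t0; have t00 : t != 0 by rewrite gt_eqF.
rewrite /hK (_ : 4 * pi * (4 * t)^-1 = pi / t); last by field.
rewrite [RHS]mulrA mulfV; last by rewrite gt_eqF// sqrtr_gt0 divr_gt0// pi_gt0.
by rewrite mul1r; congr (expR (- _)); field.
Qed.

Lemma itg_gauss (t : R) : 0 < t -> itg setT (fun s => expR (- (t * s ^+ 2))).
Proof.
move=> t0; have r0 : 0 < (4 * t)^-1 by rewrite invr_gt0 mulr_gt0.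
apply: (eq_itg _ _ (itgZl (Num.sqrt (pi / t)) _ (itg_hK 0 r0))) => // s _.
by rewrite sub0r hKN gauss_hK.
Qed.

Lemma itg_gauss_trig (t z : R) : 0 < t ->
  itg setT (fun s => expR (- (t * s ^+ 2)) * cos (s * z)) /\
  itg setT (fun s => expR (- (t * s ^+ 2)) * sin (s * z)).
Proof.
move=> t0; have gi := itg_gauss t0.
have zc : continuous (fun s : R => s * z) by move=> s; apply: cvgM; [exact: cvg_id|exact: cvg_cst].
split; apply: (itg_le _ _ _ gi) => //.
- apply: measurable_funM; first exact: itg_measurable gi.
  apply: continuous_measurable_fun => s.
  by apply: (continuous_comp (zc s)); exact: continuous_cos.
- move=> s _; rewrite normrM (ger0_norm (expR_ge0 _)) ler_piMr ?expR_ge0//.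
  by rewrite ler_norml cos_geN1 cos_le1.
- apply: measurable_funM; first exact: itg_measurable gi.
  apply: continuous_measurable_fun => s.
  by apply: (continuous_comp (zc s)); exact: continuous_sin.
- move=> s _; rewrite normrM (ger0_norm (expR_ge0 _)) ler_piMr ?expR_ge0//.
  by rewrite ler_norml sin_geN1 sin_le1.
Qed.

Lemma Rint_gauss_cos (t z : R) : 0 < t ->
  \int[mu]_s (expR (- (t * s ^+ 2)) * cos (s * z)) = 2 * pi * hK z t.
Proof.
move=> t0; have r0 : 0 < (4 * t)^-1 by rewrite invr_gt0 mulr_gt0.
have [ci _] := itg_gauss_trig z t0; have t00 : t != 0 by rewrite gt_eqF.
rewrite Rint_setT//.
have -> : \int[mu]_(s in D0) (expR (- (t * s ^+ 2)) * cos (s * z) + expR (- (t * (- s) ^+ 2)) * cos (- s * z)) =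
    \int[mu]_(s in D0) (2 * Num.sqrt (pi / t) * (hK s (4 * t)^-1 * cos (s * z))).
  apply: eqRint => s _; rewrite sqrrN mulNr cosN gauss_hK//.
  by move: (hK _ _) => k; ring.
rewrite RintegralZl//; last first.
  have := integrableS _ _ _ ci => /(_ D0) h.
  have {}h : itg D0 (fun s => expR (- (t * s ^+ 2)) * cos (s * z)) by exact: h.
  apply: (eq_itg _ _ (itgZl (Num.sqrt (pi / t))^-1 _ h)) => // s _.
  rewrite gauss_hK// mulrA (mulrA _^-1) mulVf ?mul1r//.
  by rewrite gt_eqF// sqrtr_gt0 divr_gt0// pi_gt0.
rewrite hK_cos_D0// sqrt_pi_div// /hK.
rewrite (_ : - ((4 * t)^-1 * z ^+ 2) = - (z ^+ 2 / (4 * t))); last by field.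
by move: (expR _) (_^-1) => E S; field.
Qed.

Lemma Rint_gauss_sin (t z : R) : 0 < t ->
  \int[mu]_s (expR (- (t * s ^+ 2)) * sin (s * z)) = 0.
Proof.
move=> t0; have [_ si] := itg_gauss_trig z t0; rewrite Rint_setT//.
rewrite -[RHS](mul0r (fine (mu D0))) -(Rintegral_cst mu)//; apply: eqRint => s _.
by rewrite sqrrN mulNr sinN mulrN subrr.
Qed.

Lemma itg_ray_poly (al : R) : 0 < al ->
  itg D0 (fun s => expR (- (al * s))) /\ itg D0 (fun s => s * expR (- (al * s))).
Proof.
move=> al0; have [C C0 CP] := expR_decay al0.
have gi : itg D0 (fun s => C * (1 + s ^+ 2)^-1) by apply: itgZl => //; exact: itg_oneDsqrV0.
have ec : continuous (fun s : R => expR (- (al * s))).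
  move=> s; have H : is_derive s (1 : R) (fun s => expR (- (al * s))) (- al * expR (- (al * s))).
    by apply: is_derive_eq; rewrite /GRing.scale /=; ring.
  exact: is_derive_continuous H.
split; apply: (itg_le _ _ _ gi) => //.
- by apply: continuous_D0_measurable => s _; exact: ec.
- move=> s; rewrite D0P => s0; rewrite (ger0_norm (expR_ge0 _)).
  apply: le_trans (CP s (ltW s0)); by rewrite ler_peMl ?expR_ge0// lerDl sqr_ge0.
- by apply: continuous_D0_measurable => s _; apply: cvgM; [exact: cvg_id|exact: ec].
- move=> s; rewrite D0P => s0; rewrite normrM (ger0_norm (expR_ge0 _)) (gtr0_norm s0).
  apply: le_trans (CP s (ltW s0)); rewrite ler_wpM2r ?expR_ge0//.
  by have := sqr_ge0 (s - 1); nra.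
Qed.

Section Ray.
Variables (al a t : R).
Hypotheses (al0 : 0 < al) (al2 : al ^+ 2 = 2^-1) (a0 : 0 < a) (t0 : 0 < t).
Let ph (s : R) := al * a * s - t * s ^+ 2.

Lemma itg_ray_trig :
  [/\ itg D0 (fun s => expR (- (al * a * s)) * cos (ph s)),
      itg D0 (fun s => expR (- (al * a * s)) * sin (ph s)),
      itg D0 (fun s => s * expR (- (al * a * s)) * cos (ph s)) &
      itg D0 (fun s => s * expR (- (al * a * s)) * sin (ph s))].
Proof.
have [e1 e2] := itg_ray_poly (mulr_gt0 al0 a0).
have phc : continuous ph.
  move=> s; have H : is_derive s (1 : R) ph (al * a - 2 * t * s).
    by rewrite /ph; apply: is_derive_eq; rewrite /GRing.scale /=; ring.
  exact: is_derive_continuous H.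
have mc : measurable_fun D0 (fun s => cos (ph s)).
  apply: continuous_D0_measurable => s _.
  by apply: (continuous_comp (phc s)); exact: continuous_cos.
have ms : measurable_fun D0 (fun s => sin (ph s)).
  apply: continuous_D0_measurable => s _.
  by apply: (continuous_comp (phc s)); exact: continuous_sin.
have H (k h : R -> R) : itg D0 k -> (forall s, 0 < s -> 0 <= k s) -> measurable_fun D0 h ->
    (forall s, `|h s| <= 1) -> itg D0 (fun s => k s * h s).
  move=> ki k0 mh h1; apply: (itg_le _ _ _ ki) => //.
    by apply: measurable_funM => //; exact: itg_measurable ki.
  move=> s; rewrite D0P => s0; rewrite normrM (ger0_norm (k0 _ s0)).
  by rewrite ler_piMr ?k0.
have c1 (s : R) : `|cos (ph s)| <= 1 by rewrite ler_norml cos_geN1 cos_le1.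
have s1 (s : R) : `|sin (ph s)| <= 1 by rewrite ler_norml sin_geN1 sin_le1.
have p1 (s : R) : 0 < s -> 0 <= expR (- (al * a * s)) by move=> _; exact: expR_ge0.
have p2 (s : R) : 0 < s -> 0 <= s * expR (- (al * a * s)).
  by move=> s0; apply: mulr_ge0; [exact: ltW|exact: expR_ge0].
by split; apply: H.
Qed.

(** The homotopy trades the oscillating integral for [exp(- a^2/(4t))] times a Gaussian one with
    exponent [- t s^2/2], by [al^2 = 1/2]. The factor [2 * al] is the combined real contribution of
    the two rays. *)
Lemma Rint_ray :
  2 * al * \int[mu]_(s in D0) (expR (- (al * a * s)) * (cos (ph s) - sin (ph s))) =
  2 * pi * hK a t.
Proof.
have [ci si _ _] := itg_ray_trig.
have t00 : t != 0 by rewrite gt_eqF.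
have r0 : 0 < t / 2 by rewrite divr_gt0.
have E := ray_homotopy al0 a0 t0.
have E1 : \int[mu]_(s in D0) (expR (- (al * a * s)) * (cos (ph s) - sin (ph s))) * al =
    \int[mu]_(s in D0) (expR (- (t * (al * s) ^+ 2) - a ^+ 2 / (4 * t)) * al).
  rewrite -E mulrC -RintegralZl//; last first.
    by apply: (eq_itg _ _ (itgB _ ci si)) => // s _; rewrite mulrBr.
  apply: eqRint => s _; rewrite mulrCA /ph (_ : 2 * t * (al * s) ^+ 2 = t * s ^+ 2)//.
  by rewrite exprMn al2; field.
rewrite -mulrA (mulrC al) E1.
have -> : \int[mu]_(s in D0) (expR (- (t * (al * s) ^+ 2) - a ^+ 2 / (4 * t)) * al) =
    \int[mu]_(s in D0) (expR (- (a ^+ 2 / (4 * t))) * al * Num.sqrt (pi / (t / 2)) *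
       (hK s (4 * (t / 2))^-1 * cos (s * 0))).
  apply: eqRint => s _; rewrite mulr0 cos0 mulr1 -[RHS]mulrA -gauss_hK// [RHS]mulrAC -expRD.
  by congr (expR _ * _); rewrite exprMn al2; field.
have hi : itg D0 (fun s => hK s (4 * (t / 2))^-1 * cos (s * 0)).
  have q0 : 0 < (4 * (t / 2))^-1 by rewrite invr_gt0 mulr_gt0.
  apply: (eq_itg _ _ (integrableS _ _ _ (itg_hK 0 q0))) => // s _.
  by rewrite sub0r hKN mulr0 cos0 mulr1.
rewrite RintegralZl// hK_cos_D0; last by rewrite invr_gt0 mulr_gt0.
rewrite expr0n mulr0 oppr0 expR0 /hK (mulrA (2 * pi)) -sqrt_pi_div//.
have -> : Num.sqrt (pi / (t / 2)) = Num.sqrt (pi / t) * Num.sqrt 2.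
  by rewrite -sqrtrM ?divr_ge0 ?pi_ge0 ?(ltW t0)//; congr Num.sqrt; field.
have -> : al = (Num.sqrt 2)^-1.
  by rewrite -sqrtrV// -al2 sqrtr_sqr gtr0_norm.
have s2 : Num.sqrt 2 != 0 :> R by rewrite gt_eqF// sqrtr_gt0.
move: (expR _) (Num.sqrt (pi / t)) => e q.
by move: (Num.sqrt 2) s2 => z z0; field.
Qed.

(** The derivative of [A s] has zero integral over the half-line. This expresses the integral
    weighted by [s] as [al * a / (2 t)] times that of [Rint_ray], and the quotient [a / t] is what
    separates [hh] from [hK]. *)
Lemma Rint_ray_mul :
  4 * \int[mu]_(s in D0) (s * expR (- (al * a * s)) * cos (ph s)) = 2 * pi * hh a t.
Proof.
have [ci si sci ssi] := itg_ray_trig.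
have t00 : t != 0 by rewrite gt_eqF.
have [C C0 CP] := expR_decay (mulr_gt0 al0 a0).
pose A (s : R) := expR (- (al * a * s)) * sin (ph s).
pose dA (s : R) := al * a * (expR (- (al * a * s)) * cos (ph s) - expR (- (al * a * s)) * sin (ph s))
   - 2 * t * (s * expR (- (al * a * s)) * cos (ph s)).
have dph (s : R) : is_derive s (1 : R) ph (al * a - 2 * t * s).
  by rewrite /ph; apply: is_derive_eq; rewrite /GRing.scale /=; ring.
have dl (s : R) : is_derive s (1 : R) (fun s => - (al * a * s)) (- (al * a)).
  by apply: is_derive_eq; rewrite /GRing.scale /=; ring.
have dAP (s : R) : is_derive s (1 : R) A (dA s).
  have [H _] := is_derive_exp_trig (dl s) (dph s); apply: is_derive_eq.
  by rewrite /dA; move: (expR _) (sin _) (cos _) => E S Q; ring.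
have I : itg D0 dA.
  apply: itgB => //; last exact: itgZl.
  by apply: itgZl => //; exact: itgB.
have : \int[mu]_(s in D0) dA s = (0 : R) - 0.
  apply: (@FTC_0y R A) => //.
  - move=> s _; have c1 := is_derive_continuous (dl s); have c2 := is_derive_continuous (dph s).
    have e1 : {for s, continuous (fun s => expR (- (al * a * s)))}.
      by apply: (continuous_comp c1); exact: continuous_expR.
    have e2 : {for s, continuous (fun s => cos (ph s))}.
      by apply: (continuous_comp c2); exact: continuous_cos.
    have e3 : {for s, continuous (fun s => sin (ph s))}.
      by apply: (continuous_comp c2); exact: continuous_sin.
    apply: cvgB.
      apply: cvgM; first exact: cvg_cst.
      by apply: cvgB; apply: cvgM; [exact: e1|exact: e2|exact: e1|exact: e3].
    apply: cvgM; first exact: cvg_cst.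
    apply: cvgM; last exact: e2.
    by apply: cvgM; [exact: cvg_id|exact: e1].
  - rewrite [X in _ --> X](_ : 0 = A 0).
      by apply: cvg_at_right_filter; exact: (is_derive_continuous (dAP 0)).
    by rewrite /A /ph mulr0 expr0n mulr0 subrr sin0 mulr0.
  - apply: (@cvg0_norm_le R R (pinfty_nbhs R) _ A (fun s => C * (1 + s ^+ 2)^-1)).
      near=> s; have s0 : 0 <= s by near: s; apply: nbhs_pinfty_ge; exact: num_real.
      rewrite /A normrM (ger0_norm (expR_ge0 _)); apply: le_trans (CP s s0).
      rewrite mulrC; apply: ler_pM; rewrite ?expR_ge0//.
      apply: (@le_trans _ _ 1); first by rewrite ler_norml sin_geN1 sin_le1.
      by rewrite lerDl sqr_ge0.
    rewrite -[X in _ --> X](mulr0 C).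
    by apply: cvgM; [exact: cvg_cst|exact: cvg_oneDsqrV_y].
rewrite subr0 /dA RintegralB//; last 2 first.
- by apply: itgZl => //; exact: itgB.
- exact: itgZl.
rewrite RintegralZl//; last exact: itgB.
rewrite RintegralZl// => E.
have E2 := Rint_ray.
have E3 : \int[mu]_(s in D0) (expR (- (al * a * s)) * (cos (ph s) - sin (ph s))) =
  \int[mu]_(s in D0) (expR (- (al * a * s)) * cos (ph s) - expR (- (al * a * s)) * sin (ph s)).
  by apply: eqRint => s _; rewrite mulrBr.
rewrite E3 in E2; rewrite /hh mulrCA -E2.
move: E; set I1 := (\int[mu]_(_ in _) _) ; set I2 := (\int[mu]_(_ in _) _) => E.
have -> : I2 = al * a * I1 / (2 * t).
  by apply: (mulIf (_ : 2 * t != 0)); rewrite ?mulf_neq0// divfK ?mulf_neq0//; lra.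
by field.
Unshelve. all: by end_near. Qed.

End Ray.

End ContourKernels.

(** * The unified transform *)

(* One piece of the contour: [lam s] with [s] in [D1] parametrises it, [w] is the
   remaining factor of the integrand and [nu] the exponent of the transform in [y]. *)
Section Piece.
Variable R : realType.
Notation mu := (@lebesgue_measure R).
Notation itg D f := (mu.-integrable D (EFin \o f)).
Notation D0 := (`]0, +oo[%classic : set R).
Notation cabs := (@ComplexField.Normc.normc R).

Lemma cmeas_sec1 (D1 D2 : set R) (F : R -> R -> R[i]) s : measurable D1 -> measurable D2 ->
  cmeas (D1 `*` D2) (fun p : R * R => F p.1 p.2) -> D1 s -> cmeas D2 (F s).
Proof.
move=> mD1 mD2 [m1 m2] Ds.
have H (h : R -> R -> R) : measurable_fun (D1 `*` D2) (fun p : R * R => h p.1 p.2) -> measurable_fun D2 (h s).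
  move=> mh; apply: (@measurable_comp _ _ _ _ _ _ (D1 `*` D2) (fun p : R * R => h p.1 p.2) D2 (fun y => (s, y))) => //.
  - exact: measurableX.
  - by move=> _ [y Dy <-].
  - by apply: measurable_funTS; exact: measurable_pair1.
by split; apply: (H (fun s y => _ (F s y))).
Qed.

Definition ctransform (nu : R -> R[i]) (u : R -> R[i]) s :=
  cint D0 (fun y => cexp (nu s * y%:C%C) * u y).

Lemma cabs_cint_le D (u : R -> R[i]) (b : R -> R) : measurable D -> cmeas D u -> itg D b ->
  (forall y, D y -> cabs (u y) <= b y) -> cabs (cint D u) <= 2 * \int[mu]_(y in D) b y.
Proof.
move=> mD [m1 m2] bi ub; rewrite (le_trans (cabs_le_add _))// (_ : 2 = 1 + 1 :> R)// mulrDl mul1r.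
by apply: lerD; apply: normRint_le => // y Dy; rewrite (le_trans _ (ub y Dy))// ?cabs_Re ?cabs_Im.
Qed.

(** Measurability in [s] at each time and right continuity in time at each [s] give joint
    measurability. Time is clipped at [t] so that the majorant [b] is valid for every [tau], since
    [measurable_caratheodory] looks to the right of each point. *)
Lemma cmeas_ctransform (nu : R -> R[i]) (f : R -> R -> R[i]) (b : R -> R) (t : R) (D1 : set R) :
  measurable D1 -> cmeas setT nu -> (forall s, complex.Re (nu s) <= 0) ->
  (forall tau, cmeas D0 (f ^~ tau)) -> itg D0 b ->
  (forall y tau, 0 < y -> tau <= t -> cabs (f y tau) <= b y) ->
  (forall y, 0 < y -> continuous (fun tau => complex.Re (f y tau)) /\
                      continuous (fun tau => complex.Im (f y tau))) ->
  cmeas (D1 `*` `]0, t[) (fun p : R * R => ctransform nu (f ^~ p.2) p.1).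
Proof.
move=> mD1 mnu nu0 mf bi fb fc.
pose H s tau := ctransform nu (f ^~ (Num.min tau t)) s.
have y_m : cmeas D0 (fun y => y%:C%C) by apply: cmeas_real.
have mnuy s : cmeas D0 (fun y => cexp (nu s * y%:C%C)).
  by apply: cmeas_cexp; apply: cmeasM => //; exact: cmeas_cst.
have e1 s y : 0 < y -> cabs (cexp (nu s * y%:C%C)) <= 1.
  move=> y0; rewrite cabs_cexp expR_le1 ReM /= mulr0 subr0.
  by rewrite mulr_le0_ge0 ?nu0// ltW.
have Hb s y tau : 0 < y -> cabs (cexp (nu s * y%:C%C) * f y (Num.min tau t)) <= b y.
  move=> y0; rewrite cabsM; apply: le_trans (fb y (Num.min tau t) y0 _); last by rewrite ge_min lexx orbT.
  by rewrite ler_piMl ?cabs_ge0 ?e1.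
have m1 tau : cmeas setT (H ^~ tau).
  have h0 s : 0 < 1 + s ^+ 2 :> R by rewrite ltr_pwDl ?sqr_ge0.
  have mP : cmeas setT (fun s : R => ((1 + s ^+ 2)^-1)%:C%C).
    by apply: cmeas_real; exact: itg_measurable (@itg_oneDsqrV R).
  (* Measurability in [s] is extracted from the exchange lemma by inserting the integrable factor
     [(1 + s^2)^-1], which is multiplied away afterwards. *)
  have [] := @cint_swap R setT (fun s => ((1 + s ^+ 2)^-1)%:C%C) nu (fun s => (1 + s ^+ 2)^-1) b
    (f ^~ (Num.min tau t)) measurableT mP mnu (fun s _ => nu0 s) (@itg_oneDsqrV R).
  - by move=> s _; rewrite cabs_real ger0_norm// invr_ge0 ltW.
  - exact: mf.
  - exact: bi.
  - by move=> y y0; apply: fb => //; rewrite ge_min lexx orbT.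
  move=> _ /citg_cmeas m _ _.
  have mQ : cmeas setT (fun s : R => (1 + s ^+ 2)%:C%C).
    by apply: cmeas_real; apply: measurable_funD => //; exact: measurable_funX.
  have := cmeasM mQ m; congr (cmeas _ _); apply/funext => s.
  rewrite mulrA -rmorphM/= mulfV ?mul1r//; by rewrite gt_eqF.
have c1 (s tau : R) : complex.Re (H s tau') @[tau' --> tau^'+] --> complex.Re (H s tau) /\
    complex.Im (H s tau') @[tau' --> tau^'+] --> complex.Im (H s tau).
  have fmin (y : R) : 0 < y -> complex.Re (f y (Num.min tau' t)) @[tau' --> tau^'+] --> complex.Re (f y (Num.min tau t)) /\
      complex.Im (f y (Num.min tau' t)) @[tau' --> tau^'+] --> complex.Im (f y (Num.min tau t)).
    move=> y0; have [k1 k2] := fc y y0.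
    have mc : {for tau, continuous (fun tau' : R => Num.min tau' t)}.
      by apply: continuous_min; [exact: cvg_id|exact: cvg_cst].
    split; apply: cvg_at_right_filter; first exact: (continuous_comp mc (k1 _)).
    exact: (continuous_comp mc (k2 _)).
  split; apply: (@cvg_Rint_at_right R _ _ _ b tau (tau + 1)) => //; try lra.
  - by move=> tau' _; have [] := cmeasM (mnuy s) (mf (Num.min tau' t)).
  - move=> tau' y _; rewrite D0P => y0; exact: le_trans (cabs_Re _) (Hb _ _ _ y0).
  - move=> y; rewrite D0P => /fmin [k1 k2]; under eq_fun do rewrite ReM; rewrite ReM.
    by apply: cvgB; apply: cvgM => //; exact: cvg_cst.
  - by move=> tau' _; have [] := cmeasM (mnuy s) (mf (Num.min tau' t)).
  - move=> tau' y _; rewrite D0P => y0; exact: le_trans (cabs_Im _) (Hb _ _ _ y0).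
  - move=> y; rewrite D0P => /fmin [k1 k2]; under eq_fun do rewrite ImM; rewrite ImM.
    by apply: cvgD; apply: cvgM => //; exact: cvg_cst.
have mD : measurable (D1 `*` `]0, t[ : set (R * R)) by exact: measurableX.
have sub : D1 `*` `]0, t[ `<=` [set p : R * R | 0 <= p.2].
  by move=> [s tau] [_ /=]; rewrite in_itv/= => /andP[/ltW].
have mS : measurable [set p : R * R | 0 <= p.2].
  have -> : [set p : R * R | 0 <= p.2] = setT `*` `[0, +oo[%classic.
    by apply/seteqP; split => [[s tau]/=|[s tau] [_]/=]; rewrite in_itv/= andbT.
  exact: measurableX.
have E (p : R * R) : (D1 `*` `]0, t[) p -> H p.1 p.2 = ctransform nu (f ^~ p.2) p.1.
  by move=> [_]; rewrite /= in_itv/= => /andP[_ h]; rewrite /H min_l// ltW.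
split.
  apply: (eq_measurable_fun (fun p => complex.Re (H p.1 p.2))).
    by move=> p /set_mem /E ->.
  apply: (measurable_funS mS sub).
  apply: (measurable_caratheodory (F := fun s tau => complex.Re (H s tau))) => [tau _|s tau _]; first by have [] := m1 tau.
  by have [] := c1 s tau.
apply: (eq_measurable_fun (fun p => complex.Im (H p.1 p.2))).
  by move=> p /set_mem /E ->.
apply: (measurable_funS mS sub).
apply: (measurable_caratheodory (F := fun s tau => complex.Im (H s tau))) => [tau _|s tau _]; first by have [] := m1 tau.
by have [] := c1 s tau.
Qed.

Definition heat_exp (x r : R) (lam : R[i]) := cexp ('i%C * lam * x%:C%C - lam ^+ 2 * r%:C%C).

(** The factor [cexp (lam ^+ 2 * tau)], unbounded along the real line, is merged with the heat
    exponential at time [t], so that only the positive time [t - tau] remains. *)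
Lemma heat_expM x t tau (lam : R[i]) :
  heat_exp x t lam * cexp (lam ^+ 2 * tau%:C%C) = heat_exp x (t - tau) lam.
Proof. by rewrite /heat_exp -cexpD; congr cexp; rewrite rmorphB/=; ring. Qed.

(** [G s r] bounds the integrand at time [r], and [g] bounds the time integral of [G]. On the real
    line [G s r = exp(- r s^2)] has no integrable majorant uniform as [r] tends to [0], while its
    time integral decays like [(1 + s^2)^-1]. *)
Variables (D1 : set R) (lam nu w : R -> R[i]) (x t : R) (G : R -> R -> R) (g : R -> R).
Hypothesis mD1 : measurable D1.
Hypothesis mlam : cmeas D1 lam.
Hypothesis mnu : cmeas setT nu.
Hypothesis nu0 : forall s, complex.Re (nu s) <= 0.
Hypothesis mw : cmeas D1 w.
Hypothesis t0 : 0 < t.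
Hypothesis GP : forall s (r : R), D1 s -> 0 < r -> cabs (heat_exp x r (lam s) * w s) <= G s r.
Hypothesis Gi : forall r : R, 0 < r -> itg D1 (G ^~ r).
Hypothesis Gt : forall s, D1 s -> itg `]0, t[ (fun tau => G s (t - tau)).
Hypothesis Gg : forall s, D1 s -> \int[mu]_(tau in `]0, t[) G s (t - tau) <= g s.
Hypothesis gi : itg D1 g.

Let K y r := cint D1 (fun s => heat_exp x r (lam s) * w s * cexp (nu s * y%:C%C)).

Let cmeas_nu : cmeas D1 nu.
Proof. by have [m1 m2] := mnu; split; exact: measurable_funTS. Qed.

Lemma cmeas_heat_exp r : cmeas D1 (fun s => heat_exp x r (lam s)).
Proof.
apply: cmeas_cexp; apply: cmeasD.
  by do ![apply: cmeasM => //]; exact: cmeas_cst.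
by apply: cmeasN; do ![apply: cmeasM => //]; exact: cmeas_cst.
Qed.

Lemma piece_swap (r : R) (u : R -> R[i]) (b : R -> R) : 0 < r -> cmeas D0 u -> itg D0 b -> (forall y, 0 < y -> cabs (u y) <= b y) ->
  [/\ forall s, D1 s -> citg D0 (fun y => cexp (nu s * y%:C%C) * u y),
      citg D1 (fun s => heat_exp x r (lam s) * w s * ctransform nu u s),
      citg D0 (fun y => K y r * u y) &
      cint D1 (fun s => heat_exp x r (lam s) * w s * ctransform nu u s) =
      cint D0 (fun y => K y r * u y)].
Proof.
move=> r0 mu_ bi ub.
apply: (cint_swap mD1 _ cmeas_nu (fun s _ => nu0 s) (Gi r0) _ mu_ bi ub).
  by apply: cmeasM; [exact: cmeas_heat_exp|exact: mw].
by move=> s Ds; exact: GP.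
Qed.

(** With the exponentials merged, the double integrand is at most [G s (t - tau) * M], and the
    time-integrated bound [g] admits Fubini's theorem. *)
Lemma piece_time (h : R -> R -> R[i]) (M : R) : cmeas (D1 `*` `]0, t[) (fun p : R * R => h p.1 p.2) ->
  (forall (s tau : R), D1 s -> 0 < tau < t -> cabs (h s tau) <= M) ->
  [/\ forall s, D1 s -> heat_exp x t (lam s) * w s * cint `[0, t] (fun tau => cexp (lam s ^+ 2 * tau%:C%C) * h s tau) =
        cint `]0, t[ (fun tau => heat_exp x (t - tau) (lam s) * w s * h s tau),
      citg D1 (fun s => cint `]0, t[ (fun tau => heat_exp x (t - tau) (lam s) * w s * h s tau)),
      citg `]0, t[ (fun tau => cint D1 (fun s => heat_exp x (t - tau) (lam s) * w s * h s tau)) &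
      cint D1 (fun s => cint `]0, t[ (fun tau => heat_exp x (t - tau) (lam s) * w s * h s tau)) =
      cint `]0, t[ (fun tau => cint D1 (fun s => heat_exp x (t - tau) (lam s) * w s * h s tau))].
Proof.
move=> mh hM.
have mI : measurable (`]0, t[ : set R) by [].
have M0 s : D1 s -> 0 <= M.
  have tt : (0 < t / 2 < t)%R by apply/andP; split; have := t0; lra.
  by move=> Ds; exact: le_trans (cabs_ge0 _) (hM s (t / 2) Ds tt).
have mtau A : cmeas A (fun tau : R => tau%:C%C) by apply: cmeas_real.
have mF : cmeas (D1 `*` `]0, t[) (fun p : R * R => heat_exp x (t - p.2) (lam p.1) * w p.1 * h p.1 p.2).
  have ml : cmeas (D1 `*` `]0, t[) (fun p : R * R => lam p.1) by exact: cmeas_fst.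
  have mt : cmeas (D1 `*` `]0, t[) (fun p : R * R => (t - p.2)%:C%C).
    apply: (@cmeas_snd R D1 `]0, t[%classic (fun tau : R => (t - tau)%:C%C) mI).
    by apply: cmeas_real; exact: measurable_funB.
  apply: cmeasM => //; apply: cmeasM; last exact: cmeas_fst.
  apply: cmeas_cexp; apply: cmeasD; last apply: cmeasN.
    by do ![apply: cmeasM => //]; exact: cmeas_cst.
  by do ![apply: cmeasM => //].
have inI tau : `]0, t[%classic tau -> 0 < tau < t by rewrite /= in_itv.
have F1 s tau : D1 s -> `]0, t[%classic tau ->
    cabs (heat_exp x (t - tau) (lam s) * w s * h s tau) <= G s (t - tau) * M.
  move=> Ds /inI tI; rewrite cabsM; apply: ler_pM; rewrite ?cabs_ge0 ?hM//.
  by apply: GP => //; rewrite subr_gt0; case/andP: tI.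
have F2 s : D1 s -> itg `]0, t[ (fun tau => G s (t - tau) * M).
  by move=> Ds; apply: (eq_itg mI _ (itgZl M mI (Gt Ds))) => tau _; exact: mulrC.
have F3 tau : `]0, t[%classic tau -> itg D1 (fun s => G s (t - tau) * M).
  move=> /inI /andP[_ h1]; apply: (eq_itg mD1 _ (itgZl M mD1 (Gi _))) => [s _|]; first exact: mulrC.
  by rewrite subr_gt0.
have F4 : itg D1 (fun s => M * g s) by exact: itgZl.
have F5 s : D1 s -> \int[mu]_(tau in `]0, t[) (G s (t - tau) * M) <= M * g s.
  move=> Ds; have -> : \int[mu]_(tau in `]0, t[) (G s (t - tau) * M) = M * \int[mu]_(tau in `]0, t[) G s (t - tau).
    by rewrite -RintegralZl//; [apply: eqRint => tau _; exact: mulrC|exact: Gt].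
  by rewrite ler_wpM2l ?Gg ?(M0 s).
have [I1 I2 I3] := cFubini (g := fun s => M * g s) mD1 mI mF F1 F2 F3 F4 F5.
apply: And4; [move=> s Ds|exact: I1|exact: I2|exact: I3].
clear I1 I2 I3 mF.
have mhs : cmeas `]0, t[ (h s) by exact: (cmeas_sec1 mD1 mI mh Ds).
have mes : cmeas `]0, t[ (fun tau => cexp (lam s ^+ 2 * tau%:C%C) * h s tau).
  apply: cmeasM; last exact: mhs.
  by apply: cmeas_cexp; apply: cmeasM; [exact: cmeas_cst|exact: mtau].
have ies : citg `]0, t[ (fun tau => cexp (lam s ^+ 2 * tau%:C%C) * h s tau).
  (* Here [s] is fixed and the interval finite, so this crude bound is enough; pulling a constant
     under the integral needs no uniformity in [s]. *)
  apply: (citg_le mI mes (g := fun=> expR (`|complex.Re (lam s ^+ 2)| * t) * M)) => [tau tI|]; last exact: itg_cst_oo.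
  have /andP[h1 h2] := inI _ tI; rewrite (cabsM (cexp _)).
  apply: ler_pM; [exact: cabs_ge0|exact: cabs_ge0| |exact: (hM s tau Ds (inI _ tI))].
  rewrite cabs_cexp ler_expR ReM /= mulr0 subr0.
  move: (complex.Re _) => r; apply: (le_trans (ler_norm _)).
  by rewrite normrM (gtr0_norm h1) ler_wpM2l// ltW.
rewrite (cint_cc_oo ies) -(cintZ _ mI ies); apply: eq_cint => tau _.
rewrite -heat_expM; move: (heat_exp _ _ _) (cexp _) (h _ _) (w s) => e1 e2 e3 e4; clear; ring.
Qed.

(** Two exchanges in succession: [piece_time] brings the time integral outside, then [piece_swap] at
    the time [t - tau] trades the contour integral for one over [y]. *)
Lemma piece_source (f : R -> R -> R[i]) (b : R -> R) :
  (forall tau, cmeas D0 (f ^~ tau)) -> itg D0 b ->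
  (forall y tau, 0 < y -> tau <= t -> cabs (f y tau) <= b y) ->
  (forall y, 0 < y -> continuous (fun tau => complex.Re (f y tau)) /\
                      continuous (fun tau => complex.Im (f y tau))) ->
  [/\ citg D1 (fun s => heat_exp x t (lam s) * w s *
          cint `[0, t] (fun tau => cexp (lam s ^+ 2 * tau%:C%C) * ctransform nu (f ^~ tau) s)),
      citg `]0, t[ (fun tau => cint D0 (fun y => K y (t - tau) * f y tau)),
      forall tau : R, 0 < tau < t -> citg D0 (fun y => K y (t - tau) * f y tau) &
      cint D1 (fun s => heat_exp x t (lam s) * w s *
          cint `[0, t] (fun tau => cexp (lam s ^+ 2 * tau%:C%C) * ctransform nu (f ^~ tau) s)) =
      cint `]0, t[ (fun tau => cint D0 (fun y => K y (t - tau) * f y tau))].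
Proof.
move=> mf bi fb fc.
have mh := cmeas_ctransform mD1 mnu nu0 mf bi fb fc.
have [||T1 T2 T3 T4] := @piece_time (fun s tau => ctransform nu (f ^~ tau) s) (2 * \int[mu]_(y in D0) b y).
- exact: mh.
- move=> s tau Ds /andP[_ /ltW tt]; apply: cabs_cint_le => //.
    apply: cmeasM => //; apply: cmeas_cexp; apply: cmeasM; first exact: cmeas_cst.
    exact: cmeas_real.
  move=> y; rewrite D0P => y0; rewrite cabsM; apply: le_trans (fb y tau y0 tt).
  rewrite ler_piMl ?cabs_ge0// cabs_cexp expR_le1 ReM /= mulr0 subr0.
  by rewrite mulr_le0_ge0 ?nu0// ltW.
have S (tau : R) : 0 < tau < t -> citg D0 (fun y => K y (t - tau) * f y tau) /\
    cint D1 (fun s => heat_exp x (t - tau) (lam s) * w s * ctransform nu (f ^~ tau) s) =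
    cint D0 (fun y => K y (t - tau) * f y tau).
  move=> /andP[h1 h2]; have r0 : 0 < t - tau by rewrite subr_gt0.
  have [_ _ A B] := @piece_swap (t - tau) (f ^~ tau) b r0 (mf tau) bi (fun y y0 => fb y tau y0 (ltW h2)).
  exact: (conj A B).
have inI tau : `]0, t[%classic tau -> 0 < tau < t by rewrite /= in_itv.
have S' tau : `]0, t[%classic tau ->
    cint D1 (fun s => heat_exp x (t - tau) (lam s) * w s * ctransform nu (f ^~ tau) s) =
    cint D0 (fun y => K y (t - tau) * f y tau) by move=> tI; exact: (S tau (inI _ tI)).2.
split.
- by apply: (eq_citg mD1 _ T2) => s Ds; rewrite T1.
- exact: (eq_citg _ S' T3).
- by move=> tau tI; exact: (S tau tI).1.
- by rewrite (eq_cint T1) T4; exact: eq_cint S'.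
Qed.

End Piece.

(** * Contour terms on the two rays *)

Section RayPiece.
Variable R : realType.
Notation mu := (@lebesgue_measure R).
Notation itg D f := (mu.-integrable D (EFin \o f)).
Notation D0 := (`]0, +oo[%classic : set R).
Notation cabs := (@ComplexField.Normc.normc R).
Implicit Types (s y r tau : R) (u : R -> R[i]) (b : R -> R).

Lemma heat_exp_mul (x y r : R) (lam : R[i]) :
  heat_exp x r lam * cexp ('i%C * lam * y%:C%C) = heat_exp (x + y) r lam.
Proof. by rewrite /heat_exp -cexpD; congr cexp; rewrite rmorphD/=; ring. Qed.

Lemma fhat_open u lam : citg D0 (fun y => cexp (- 'i%C * lam * y%:C%C) * u y) ->
  fhat u lam = cint D0 (fun y => cexp (- 'i%C * lam * y%:C%C) * u y).
Proof. by move=> ui; rewrite /fhat (cint_obnd_cbnd ui). Qed.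

Lemma Rint_cst_oo (t k : R) : 0 <= t -> \int[mu]_(tau in `]0, t[) k = k * t.
Proof.
move=> t0; rewrite Rintegral_cst//= lebesgue_measure_itv/= lte_fin.
by case: ltP => [_|h]; rewrite ?oppr0 ?addr0//= ?subr0//; have -> : t = 0 by apply/eqP; rewrite eq_le h.
Qed.

Variables (c : R[i]) (al x t : R).
Hypotheses (al0 : 0 < al) (cIm : complex.Im c = al) (cRe : complex.Re c ^+ 2 = al ^+ 2)
  (c1 : cabs c <= 1) (x0 : 0 < x) (t0 : 0 < t).

Definition kray (z : R[i]) a r := cint D0 (fun s => heat_exp a r (s%:C%C * z) * z).
Definition dray (z : R[i]) a r :=
  cint D0 (fun s => heat_exp a r (s%:C%C * z) * (2 * 'i%C * (s%:C%C * z) * z)).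

Let lam s := s%:C%C * c.
(** On the positive half-line this is [i * lam s]; the absolute value extends the sign condition on
    the real part to the whole line, where [cmeas_ctransform] asks for it. *)
Let nu s := 'i%C * (`|s|%:C%C * c).
Let G (s r : R) := expR (- (al * x * s)).
Let g s := t * expR (- (al * x * s)).

(** On a diagonal ray [lam ^+ 2] is purely imaginary, so time drops out of the modulus and the decay
    comes from [a] alone. *)
Lemma cabs_heat_exp_ray (a r s : R) : cabs (heat_exp a r (lam s)) = expR (- (al * a * s)).
Proof.
rewrite cabs_cexp; congr expR; rewrite !(ReD, ReN, ReM, ImM, ImN) /=.
rewrite cIm; move: (complex.Re c) cRe => rc; rewrite !expr2 => h.
apply/eqP; rewrite -subr_eq0; apply/eqP.
by transitivity (- (s * s * r) * (rc * rc - al * al)); [ring|rewrite h subrr mulr0].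
Qed.

Let mD0 : measurable D0. Proof. by []. Qed.

Let m_real A : cmeas A (fun s : R => s%:C%C). Proof. exact: cmeas_real. Qed.

Let m_lam A : cmeas A lam.
Proof. by apply: cmeasM; [exact: m_real|exact: cmeas_cst]. Qed.

Let m_nu : cmeas setT nu.
Proof.
apply: cmeasM; first exact: cmeas_cst.
by apply: cmeasM; [apply: cmeas_real; exact: normr_measurable|exact: cmeas_cst].
Qed.

Let nu_le0 s : complex.Re (nu s) <= 0.
Proof.
rewrite /nu !(ReM, ImM) /= cIm (_ : _ - _ = - (`|s| * al)); last by ring.
by rewrite oppr_le0 mulr_ge0// ltW.
Qed.

Let nuE s y : 0 < s -> cexp (nu s * y%:C%C) = cexp (- 'i%C * - lam s * y%:C%C).
Proof. by move=> s0; rewrite /nu gtr0_norm// mulrNN. Qed.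

Let nuE' s y : 0 < s -> cexp (nu s * y%:C%C) = cexp ('i%C * lam s * y%:C%C).
Proof. by move=> s0; rewrite /nu gtr0_norm. Qed.

Let Gi (r : R) : 0 < r -> itg D0 (G ^~ r).
Proof. by move=> _; have [] := itg_ray_poly (mulr_gt0 al0 x0). Qed.

Let GP (w : R -> R[i]) s r : cabs (w s) <= 1 -> D0 s -> 0 < r ->
  cabs (heat_exp x r (lam s) * w s) <= G s r.
Proof.
by move=> w1 _ _; rewrite cabsM cabs_heat_exp_ray ler_piMr ?expR_ge0.
Qed.

Let Gt s : D0 s -> itg `]0, t[ (fun tau => G s (t - tau)).
Proof. by move=> _; exact: itg_cst_oo. Qed.

Let Gg s : D0 s -> \int[mu]_(tau in `]0, t[) G s (t - tau) <= g s.
Proof. by move=> _; rewrite /G /g Rint_cst_oo ?(ltW t0)// mulrC. Qed.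

Let gi : itg D0 g.
Proof. by apply: itgZl => //; have [] := itg_ray_poly (mulr_gt0 al0 x0). Qed.

Let krayE y r : cint D0 (fun s => heat_exp x r (lam s) * c * cexp (nu s * y%:C%C)) = kray c (x + y) r.
Proof.
apply: eq_cint => s; rewrite D0P => s0; rewrite nuE'// mulrAC heat_exp_mul.
by [].
Qed.

(** [fhat u (- lam)] carries [exp(i lam y)], which merges with [exp(i lam x)]: the datum is paired
    with the ray kernel at the reflected distance [x + y]. *)
Lemma ray_fhat u b : cmeas D0 u -> itg D0 b -> (forall y, 0 < y -> cabs (u y) <= b y) ->
  citg D0 (fun y => kray c (x + y) t * u y) /\
  cint `[0, +oo[ (fun s => heat_exp x t (lam s) * fhat u (- lam s) * c) =
  cint D0 (fun y => kray c (x + y) t * u y).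
Proof.
move=> mu_ bi ub.
have [S1 S2 S3 S4] := @piece_swap R D0 lam nu (fun=> c) x G mD0 (m_lam _) m_nu nu_le0
  (cmeas_cst _ _) (fun s r => GP c1) Gi t u b t0 mu_ bi ub.
have E s : D0 s -> heat_exp x t (lam s) * c * ctransform nu u s =
    heat_exp x t (lam s) * fhat u (- lam s) * c.
  move=> Ds; rewrite [RHS]mulrAC; congr (_ * _); have s0 : 0 < s by move: Ds; rewrite D0P.
  have H y : D0 y -> cexp (nu s * y%:C%C) * u y = cexp (- 'i%C * - lam s * y%:C%C) * u y.
    by move=> _; rewrite nuE.
  by rewrite fhat_open; [exact: (eq_cint H)|exact: (eq_citg mD0 H (S1 s Ds))].
have E2 y : D0 y -> cint D0 (fun s => heat_exp x t (lam s) * c * cexp (nu s * y%:C%C)) * u y =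
    kray c (x + y) t * u y by move=> _; rewrite krayE.
split; first exact: (eq_citg mD0 E2 S3).
rewrite cint_obnd_cbnd; last exact: (eq_citg mD0 E S2).
by rewrite -(eq_cint E) S4; exact: (eq_cint E2).
Qed.

Lemma ray_fhat_tilde (f : R -> R -> R[i]) b :
  (forall tau, cmeas D0 (f ^~ tau)) -> itg D0 b ->
  (forall y tau, 0 < y -> tau <= t -> cabs (f y tau) <= b y) ->
  (forall y, 0 < y -> continuous (fun tau => complex.Re (f y tau)) /\
                      continuous (fun tau => complex.Im (f y tau))) ->
  [/\ citg `]0, t[ (fun tau => cint D0 (fun y => kray c (x + y) (t - tau) * f y tau)),
      forall tau, 0 < tau < t -> citg D0 (fun y => kray c (x + y) (t - tau) * f y tau) &
      cint `[0, +oo[ (fun s => heat_exp x t (lam s) * fhat_tilde f (- lam s) t * c) =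
      cint `]0, t[ (fun tau => cint D0 (fun y => kray c (x + y) (t - tau) * f y tau))].
Proof.
move=> mf bi fb fc.
have [S2 S3 S3' S4] := @piece_source R D0 lam nu (fun=> c) x t G g mD0 (m_lam _) m_nu nu_le0
  (cmeas_cst _ _) t0 (fun s r => GP c1) Gi Gt Gg gi f b mf bi fb fc.
have E s : D0 s -> heat_exp x t (lam s) * c *
     cint `[0, t] (fun tau => cexp (lam s ^+ 2 * tau%:C%C) * ctransform nu (f ^~ tau) s) =
    heat_exp x t (lam s) * fhat_tilde f (- lam s) t * c.
  move=> Ds; have s0 : 0 < s by move: Ds; rewrite D0P.
  suff -> : fhat_tilde f (- lam s) t =
      cint `[0, t] (fun tau => cexp (lam s ^+ 2 * tau%:C%C) * ctransform nu (f ^~ tau) s).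
    by move: (heat_exp _ _ _) (cint _ _) => e1 e2; clear; ring.
  apply: eq_cint => tau; rewrite /= in_itv/= => /andP[h1 h2].
  have fbt (y : R) : 0 < y -> cabs (f y tau) <= b y by move=> y0; exact: fb.
  have [S1 _ _ _] := @piece_swap R D0 lam nu (fun=> c) x G mD0 (m_lam _) m_nu nu_le0
    (cmeas_cst _ _) (fun s r => GP c1) Gi t (f ^~ tau) b t0 (mf tau) bi fbt.
  have H y : D0 y -> cexp (nu s * y%:C%C) * f y tau = cexp (- 'i%C * - lam s * y%:C%C) * f y tau.
    by move=> _; rewrite nuE.
  rewrite sqrrN fhat_open; last exact: (eq_citg mD0 H (S1 s Ds)).
  by rewrite /ctransform (eq_cint H).
have E2 tau y : D0 y -> cint D0 (fun s => heat_exp x (t - tau) (lam s) * c * cexp (nu s * y%:C%C)) * f y tau =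
    kray c (x + y) (t - tau) * f y tau by move=> _; rewrite krayE.
have E3 tau : `]0, t[%classic tau ->
    cint D0 (fun y => cint D0 (fun s => heat_exp x (t - tau) (lam s) * c * cexp (nu s * y%:C%C)) * f y tau) =
    cint D0 (fun y => kray c (x + y) (t - tau) * f y tau) by move=> _; exact: (eq_cint (E2 tau)).
split.
- exact: (eq_citg _ E3 S3).
- by move=> tau tI; exact: (eq_citg mD0 (E2 tau) (S3' tau tI)).
- rewrite cint_obnd_cbnd; last exact: (eq_citg mD0 E S2).
  by rewrite -(eq_cint E) S4; exact: (eq_cint E3).
Qed.

(** The factor [2 i lam] adds at most [2 s] to the majorant, which stays integrable against
    [exp(- al x s)]. *)
Lemma ray_ftilde (h : R -> R[i]) (M : R) : cmeas `]0, t[ h ->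
  (forall tau, 0 < tau < t -> cabs (h tau) <= M) ->
  citg `]0, t[ (fun tau => dray c x (t - tau) * h tau) /\
  cint `[0, +oo[ (fun s => heat_exp x t (lam s) * (2 * 'i%C * lam s) * ftilde h (lam s) t * c) =
  cint `]0, t[ (fun tau => dray c x (t - tau) * h tau).
Proof.
move=> mh hM; pose w s := 2 * 'i%C * lam s * c.
pose G1 (s r : R) := 2 * (s * expR (- (al * x * s))).
have mw : cmeas D0 w.
  apply: cmeasM; last exact: cmeas_cst.
  by apply: cmeasM; [exact: cmeas_cst|exact: m_lam].
have w2 s : 0 < s -> cabs (w s) <= 2 * s.
  move=> s0; rewrite /w /lam !cabsM cabs_real (gtr0_norm s0).
  have -> : cabs 2 = 2.
    rewrite (_ : (2 : R[i]) = (2 : R)%:C%C); first by rewrite cabs_real ger0_norm.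
    by rewrite (rmorph_nat (real_complex R) 2).
  have -> : cabs 'i%C = 1 by rewrite /= expr0n expr1n add0r sqrtr1.
  rewrite mulr1 -!mulrA; apply: ler_wpM2l => //; apply: ler_piMr; first exact: ltW.
  by apply: mulr_ile1 => //; exact: cabs_ge0.
have G1P s r : D0 s -> 0 < r -> cabs (heat_exp x r (lam s) * w s) <= G1 s r.
  rewrite D0P => s0 _; rewrite cabsM cabs_heat_exp_ray /G1 mulrA mulrC.
  by apply: ler_wpM2r; [exact: expR_ge0|exact: w2].
have pi2 := (itg_ray_poly (mulr_gt0 al0 x0)).2.
have G1i r : 0 < r -> itg D0 (G1 ^~ r) by move=> _; exact: itgZl.
have G1t s : D0 s -> itg `]0, t[ (fun tau => G1 s (t - tau)) by move=> _; exact: itg_cst_oo.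
have G1g s : D0 s -> \int[mu]_(tau in `]0, t[) G1 s (t - tau) <= t * (2 * (s * expR (- (al * x * s)))).
  by move=> _; rewrite /G1 Rint_cst_oo ?(ltW t0)// [leRHS]mulrC.
have g1i : itg D0 (fun s => t * (2 * (s * expR (- (al * x * s))))) by apply: itgZl => //; exact: itgZl.
have mI : measurable (`]0, t[ : set R) by [].
have [T1 T2 T3 T4] := @piece_time R D0 lam w x t G1 _ mD0 (m_lam _) mw t0 G1P G1i G1t G1g g1i
  (fun _ tau => h tau) M (@cmeas_snd R D0 _ h mI mh) (fun s tau _ tI => hM tau tI).
have E s : D0 s -> cint `]0, t[ (fun tau => heat_exp x (t - tau) (lam s) * w s * h tau) =
    heat_exp x t (lam s) * (2 * 'i%C * lam s) * ftilde h (lam s) t * c.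
  move=> Ds; rewrite -(T1 s Ds) -/(ftilde h (lam s) t) /w.
  have H4 (z1 z2 z3 z4 : R[i]) : z1 * (z2 * z3) * z4 = z1 * z2 * z4 * z3 by ring.
  exact: H4.
have E3 tau : `]0, t[%classic tau -> cint D0 (fun s => heat_exp x (t - tau) (lam s) * w s * h tau) =
    dray c x (t - tau) * h tau.
  rewrite /= in_itv/= => /andP[_ h2]; have r0 : 0 < t - tau by rewrite subr_gt0.
  have di : citg D0 (fun s => heat_exp x (t - tau) (lam s) * w s).
    apply: (citg_le mD0 _ (g := G1 ^~ (t - tau))).
    - by apply: cmeasM; [exact: (cmeas_heat_exp _ (m_lam _))|exact: mw].
    - by move=> s Ds; exact: (G1P s (t - tau) Ds r0).
    - exact: (G1i _ r0).
  have H5 s : D0 s -> heat_exp x (t - tau) (lam s) * w s * h tau = h tau * (heat_exp x (t - tau) (lam s) * w s).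
    by move=> _; exact: mulrC.
  by rewrite (eq_cint H5) (cintZ (h tau) mD0 di); exact: mulrC.
split; first exact: (eq_citg mI E3 T3).
rewrite cint_obnd_cbnd; last exact: (eq_citg mD0 E T2).
by rewrite -(eq_cint E) T4; exact: (eq_cint E3).
Qed.

End RayPiece.

(** * Contour terms on the real line *)

Section LinePiece.
Variable R : realType.
Notation mu := (@lebesgue_measure R).
Notation itg D f := (mu.-integrable D (EFin \o f)).
Notation D0 := (`]0, +oo[%classic : set R).
Notation cabs := (@ComplexField.Normc.normc R).
Implicit Types (s y r tau : R) (u : R -> R[i]) (b : R -> R).

Lemma Rint_exp_time (k t : R) : 0 < t ->
  itg `]0, t[ (fun tau => expR (- ((t - tau) * k))) /\
  \int[mu]_(tau in `]0, t[) (k * expR (- ((t - tau) * k))) = 1 - expR (- (t * k)).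
Proof.
move=> t0; pose F (tau : R) := expR (- ((t - tau) * k)).
have dF (tau : R) : is_derive tau (1 : R) F (k * expR (- ((t - tau) * k))).
  by rewrite /F; apply: is_derive_eq; rewrite /GRing.scale /=; ring.
have Fc : continuous F by move=> tau; exact: is_derive_continuous (dF tau).
have kFc : continuous (fun tau => k * F tau).
  by move=> tau; apply: cvgM; [exact: cvg_cst|exact: Fc].
split.
  apply: (@integrableS _ _ _ mu `[0, t]) => //.
    by move=> z /=; rewrite !in_itv/= => /andP[/ltW-> /ltW].
  apply: continuous_compact_integrable; first exact: segment_compact.
  exact: continuous_subspaceT.
rewrite -Rint_cc_oo; last by apply: measurable_funTS; exact: continuous_measurable_fun.
rewrite /Rintegral (@continuous_FTC2 R _ F 0 t t0) //=.
- have F1 : F t = 1 by rewrite /F subrr mul0r oppr0 expR0.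
  have F0 : F 0 = expR (- (t * k)) by rewrite /F subr0.
  by rewrite F1 F0.
- exact: continuous_subspaceT.
- split.
  + by move=> tau _; have H := dF tau; exact: ex_derive.
  + by apply: cvg_at_right_filter; exact: Fc.
  + by apply: cvg_at_left_filter; exact: Fc.
- by move=> tau _; rewrite derive1E; have H := dF tau; rewrite derive_val.
Qed.

Variables (x t : R).
Hypotheses (x0 : 0 < x) (t0 : 0 < t).

Definition kline a r := cint setT (fun s : R => heat_exp a r s%:C%C).

Let lam (s : R) := s%:C%C.
Let nu (s : R) := - 'i%C * s%:C%C.
Let G (s r : R) := expR (- (r * s ^+ 2)).
Let g (s : R) := (1 + t) * (1 + s ^+ 2)^-1.

Lemma cabs_heat_exp_line (a r s : R) : cabs (heat_exp a r s%:C%C) = expR (- (r * s ^+ 2)).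
Proof. by rewrite cabs_cexp; congr expR; rewrite !(ReD, ReN, ReM, ImM, ImN) /=; ring. Qed.

Let mD0 : measurable D0. Proof. by []. Qed.

Let m_lam : cmeas setT lam. Proof. exact: cmeas_real. Qed.

Let m_nu : cmeas setT nu. Proof. by apply: cmeasM; [exact: cmeas_cst|exact: m_lam]. Qed.

Let nu_le0 s : complex.Re (nu s) <= 0.
Proof. by rewrite /nu !(ReM, ImM, ReN, ImN) /= (_ : _ - _ = 0)//; ring. Qed.

Let Gi r : 0 < r -> itg setT (G ^~ r).
Proof. exact: itg_gauss. Qed.

Let GP (s r : R) : setT s -> 0 < r -> cabs (heat_exp x r (lam s) * 1) <= G s r.
Proof. by move=> _ _; rewrite mulr1 cabs_heat_exp_line. Qed.

Let Gt s : setT s -> itg `]0, t[ (fun tau => G s (t - tau)).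
Proof. by move=> _; have [] := Rint_exp_time (s ^+ 2) t0. Qed.

Let Gg s : setT s -> \int[mu]_(tau in `]0, t[) G s (t - tau) <= g s.
Proof.
move=> _; have [I E] := Rint_exp_time (s ^+ 2) t0.
(* After multiplication by [1 + s^2], the part with [s^2] integrates exactly to [1 - exp(- t s^2)],
   at most [1], and the part with [1] is at most [t]. *)
rewrite /g ler_pdivlMr ?ltr_pwDl ?sqr_ge0// mulrC mulrDl mul1r.
rewrite RintegralZl// in E; rewrite E addrC; apply: lerD.
  by rewrite gerBl expR_ge0.
apply: (le_trans (ler_norm _)); rewrite -[leRHS]mul1r.
apply: Rint_bound_oo; [exact: ltW|exact: itg_measurable I|].
move=> tau /andP[_ h]; rewrite ger0_norm ?expR_ge0// expR_le1 oppr_le0.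
by rewrite mulr_ge0 ?sqr_ge0// subr_ge0 ltW.
Qed.

Let gi : itg setT g.
Proof. by apply: itgZl => //; exact: itg_oneDsqrV. Qed.

Let nuE s y : cexp (nu s * y%:C%C) = cexp ('i%C * lam s * (- y)%:C%C).
Proof. by congr cexp; rewrite /nu /lam rmorphN/=; ring. Qed.

Let klineE y r : cint setT (fun s => heat_exp x r (lam s) * 1 * cexp (nu s * y%:C%C)) = kline (x - y) r.
Proof.
apply: eq_cint => s _; rewrite nuE mulr1; exact: heat_exp_mul.
Qed.

Lemma line_fhat u b : cmeas D0 u -> itg D0 b -> (forall y, 0 < y -> cabs (u y) <= b y) ->
  citg D0 (fun y => kline (x - y) t * u y) /\
  line_int (fun lam => heat_exp x t lam * fhat u lam) =
  cint D0 (fun y => kline (x - y) t * u y).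
Proof.
move=> mu_ bi ub.
have [S1 S2 S3 S4] := @piece_swap R setT lam nu (fun=> 1) x G measurableT m_lam m_nu nu_le0
  (cmeas_cst _ _) GP Gi t u b t0 mu_ bi ub.
have E s : setT s -> heat_exp x t (lam s) * 1 * ctransform nu u s =
    heat_exp x t (lam s) * fhat u (lam s).
  by move=> Ds; rewrite mulr1 fhat_open; [|exact: (S1 s Ds)].
have E2 y : D0 y -> cint setT (fun s => heat_exp x t (lam s) * 1 * cexp (nu s * y%:C%C)) * u y =
    kline (x - y) t * u y by move=> _; rewrite klineE.
split; first exact: (eq_citg mD0 E2 S3).
by rewrite /line_int -(eq_cint E) S4; exact: (eq_cint E2).
Qed.

Lemma line_fhat_tilde (f : R -> R -> R[i]) b :
  (forall tau, cmeas D0 (f ^~ tau)) -> itg D0 b ->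
  (forall y tau, 0 < y -> tau <= t -> cabs (f y tau) <= b y) ->
  (forall y, 0 < y -> continuous (fun tau => complex.Re (f y tau)) /\
                      continuous (fun tau => complex.Im (f y tau))) ->
  [/\ citg `]0, t[ (fun tau => cint D0 (fun y => kline (x - y) (t - tau) * f y tau)),
      forall tau, 0 < tau < t -> citg D0 (fun y => kline (x - y) (t - tau) * f y tau) &
      line_int (fun lam => heat_exp x t lam * fhat_tilde f lam t) =
      cint `]0, t[ (fun tau => cint D0 (fun y => kline (x - y) (t - tau) * f y tau))].
Proof.
move=> mf bi fb fc.
have [S2 S3 S3' S4] := @piece_source R setT lam nu (fun=> 1) x t G g measurableT m_lam m_nu nu_le0
  (cmeas_cst _ _) t0 GP Gi Gt Gg gi f b mf bi fb fc.
have E s : setT s -> heat_exp x t (lam s) * 1 *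
     cint `[0, t] (fun tau => cexp (lam s ^+ 2 * tau%:C%C) * ctransform nu (f ^~ tau) s) =
    heat_exp x t (lam s) * fhat_tilde f (lam s) t.
  move=> Ds; suff -> : fhat_tilde f (lam s) t =
      cint `[0, t] (fun tau => cexp (lam s ^+ 2 * tau%:C%C) * ctransform nu (f ^~ tau) s).
    by rewrite mulr1.
  apply: eq_cint => tau; rewrite /= in_itv/= => /andP[h1 h2].
  have fbt (y : R) : 0 < y -> cabs (f y tau) <= b y by move=> y0; exact: fb.
  have [S1 _ _ _] := @piece_swap R setT lam nu (fun=> 1) x G measurableT m_lam m_nu nu_le0
    (cmeas_cst _ _) GP Gi t (f ^~ tau) b t0 (mf tau) bi fbt.
  by rewrite fhat_open; [|exact: (S1 s Ds)].
have E2 tau y : D0 y -> cint setT (fun s => heat_exp x (t - tau) (lam s) * 1 * cexp (nu s * y%:C%C)) * f y tau =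
    kline (x - y) (t - tau) * f y tau by move=> _; rewrite klineE.
have E3 tau : `]0, t[%classic tau ->
    cint D0 (fun y => cint setT (fun s => heat_exp x (t - tau) (lam s) * 1 * cexp (nu s * y%:C%C)) * f y tau) =
    cint D0 (fun y => kline (x - y) (t - tau) * f y tau) by move=> _; exact: (eq_cint (E2 tau)).
split.
- exact: (eq_citg _ E3 S3).
- by move=> tau tI; exact: (eq_citg mD0 (E2 tau) (S3' tau tI)).
- by rewrite /line_int -(eq_cint E) S4; exact: (eq_cint E3).
Qed.

End LinePiece.

(** * Closed forms of the contour kernels *)

Section KernelValues.
Variable R : realType.
Notation mu := (@lebesgue_measure R).
Notation itg D f := (mu.-integrable D (EFin \o f)).
Notation D0 := (`]0, +oo[%classic : set R).

Lemma Re_cint D (u : R -> R[i]) : complex.Re (cint D u) = \int[mu]_(s in D) complex.Re (u s).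
Proof. by []. Qed.

Lemma Im_cint D (u : R -> R[i]) : complex.Im (cint D u) = \int[mu]_(s in D) complex.Im (u s).
Proof. by []. Qed.

Lemma ReZ (k : R) (z : R[i]) : complex.Re (k%:C%C * z) = k * complex.Re z.
Proof. by rewrite ReM /= mul0r subr0. Qed.

Lemma ImZ (k : R) (z : R[i]) : complex.Im (k%:C%C * z) = k * complex.Im z.
Proof. by rewrite ImM /= mul0r addr0. Qed.

Lemma kline_val (a r : R) : 0 < r -> kline a r = (2 * pi * hK a r)%:C%C.
Proof.
move=> r0; apply: complexP; rewrite ?Re_cint ?Im_cint [RHS]/=.
  rewrite -(Rint_gauss_cos a r0); apply: eqRint => s _.
  rewrite /heat_exp /cexp ReZ; congr (expR _ * _); last congr (cos _);
    by rewrite !(ReM, ImM, ReD, ReN, ImD, ImN) /=; ring.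
rewrite -(Rint_gauss_sin a r0); apply: eqRint => s _.
rewrite /heat_exp /cexp ImZ; congr (expR _ * _); last congr (sin _);
  by rewrite !(ReM, ImM, ReD, ReN, ImD, ImN) /=; ring.
Qed.

Lemma heat_exp_ray_val (al p a r s : R) : al ^+ 2 = 2^-1 -> p ^+ 2 = al ^+ 2 ->
  heat_exp a r (s%:C%C * (p +i* al)%C) =
  (expR (- (al * a * s)))%:C%C *
  (cos (p * a * s - 2 * p * al * (r * s ^+ 2)) +i* sin (p * a * s - 2 * p * al * (r * s ^+ 2)))%C.
Proof.
move=> al2; rewrite !expr2 => pE; rewrite /heat_exp /cexp.
rewrite !(ReM, ImM, ReD, ReN, ImD, ImN) /=.
congr (_%:C%C * _).
  congr expR; apply/eqP; rewrite -subr_eq0; apply/eqP.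
  by transitivity (- (s * s * r) * (p * p - al * al)); [ring|rewrite pE subrr mulr0].
by congr (cos _ +i* sin _)%C; ring.
Qed.

Variables (al a r : R).
Hypotheses (al0 : 0 < al) (al2 : al ^+ 2 = 2^-1) (a0 : 0 < a) (r0 : 0 < r).
Let ph (s : R) := al * a * s - r * s ^+ 2.

Let e1 (s : R) : al * a * s - 2 * al * al * (r * s ^+ 2) = ph s.
Proof. by rewrite /ph -(mulrA 2) -(expr2 al) al2 divff// mul1r. Qed.

Let e3 (s : R) : - al * a * s - 2 * - al * al * (r * s ^+ 2) = - ph s.
Proof. by rewrite -e1; ring. Qed.

(** The two directions are mirror images in the imaginary axis, so their kernels have opposite real
    parts and equal imaginary parts. The difference is twice the real part, known from [Rint_ray];
    the imaginary integral is never evaluated. *)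
Lemma kray_val : kray (al +i* al)%C a r - kray (- al +i* al)%C a r = (2 * pi * hK a r)%:C%C.
Proof.
have [ci si _ _] := @itg_ray_trig R al a r al0 a0.
have E1 : kray (al +i* al)%C a r =
    (al * (\int[mu]_(s in D0) (expR (- (al * a * s)) * (cos (ph s) - sin (ph s)))) +i*
     (\int[mu]_(s in D0) (al * expR (- (al * a * s)) * (cos (ph s) + sin (ph s)))))%C.
  apply: complexP; rewrite ?Re_cint ?Im_cint [RHS]/=.
    rewrite -RintegralZl//; last by apply: (eq_itg _ _ (itgB _ ci si)) => // s _; rewrite mulrBr.
    apply: eqRint => s _; rewrite heat_exp_ray_val// e1 !(ReM, ImM) /=; ring.
  by apply: eqRint => s _; rewrite heat_exp_ray_val// e1 !(ReM, ImM) /=; ring.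
have E3 : kray (- al +i* al)%C a r =
    (- al * (\int[mu]_(s in D0) (expR (- (al * a * s)) * (cos (ph s) - sin (ph s)))) +i*
     (\int[mu]_(s in D0) (al * expR (- (al * a * s)) * (cos (ph s) + sin (ph s)))))%C.
  apply: complexP; rewrite ?Re_cint ?Im_cint [RHS]/=.
    rewrite -RintegralZl//; last by apply: (eq_itg _ _ (itgB _ ci si)) => // s _; rewrite mulrBr.
    apply: eqRint => s _; rewrite heat_exp_ray_val ?sqrrN// e3 cosN sinN !(ReM, ImM) /=; ring.
  by apply: eqRint => s _; rewrite heat_exp_ray_val ?sqrrN// e3 cosN sinN !(ReM, ImM) /=; ring.
rewrite E1 E3; apply: complexP; rewrite !(ReD, ReN, ImD, ImN) /=; last by rewrite subrr.
by rewrite -(Rint_ray al0 al2 a0 r0) -/ph; ring.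
Qed.

(** The squared directions are [i] and [- i], so [2 i lam] times the direction is the real weight
    [- 2 s] on one ray and [2 s] on the other. The imaginary parts cancel again and [Rint_ray_mul]
    gives the rest. *)
Lemma dray_val : dray (al +i* al)%C a r - dray (- al +i* al)%C a r = (- (2 * pi * hh a r))%:C%C.
Proof.
have [_ _ ci si] := @itg_ray_trig R al a r al0 a0.
have al2' : 2 * (al * al) = 1 by rewrite -expr2 al2 divff.
have E1 : dray (al +i* al)%C a r =
    (- 2 * (\int[mu]_(s in D0) (s * expR (- (al * a * s)) * cos (ph s))) +i*
     (\int[mu]_(s in D0) (- 2 * (s * expR (- (al * a * s)) * sin (ph s)))))%C.
  apply: complexP; rewrite ?Re_cint ?Im_cint [RHS]/=.
    rewrite -RintegralZl//.
    apply: eqRint => s _; rewrite heat_exp_ray_val// e1 !(ReM, ImM) /=.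
    move: (expR _) (cos _) (sin _) => E C S.
    by transitivity (- 2 * (s * E * C) * (2 * (al * al))); [ring|rewrite al2' mulr1].
  apply: eqRint => s _; rewrite heat_exp_ray_val// e1 !(ReM, ImM) /=.
  move: (expR _) (cos _) (sin _) => E C S.
  by transitivity (- 2 * (s * E * S) * (2 * (al * al))); [ring|rewrite al2' mulr1].
have E3 : dray (- al +i* al)%C a r =
    (2 * (\int[mu]_(s in D0) (s * expR (- (al * a * s)) * cos (ph s))) +i*
     (\int[mu]_(s in D0) (- 2 * (s * expR (- (al * a * s)) * sin (ph s)))))%C.
  apply: complexP; rewrite ?Re_cint ?Im_cint [RHS]/=.
    rewrite -RintegralZl//.
    apply: eqRint => s _; rewrite heat_exp_ray_val ?sqrrN// e3 cosN sinN !(ReM, ImM) /=.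
    move: (expR _) (cos _) (sin _) => E C S.
    by transitivity (2 * (s * E * C) * (2 * (al * al))); [ring|rewrite al2' mulr1].
  apply: eqRint => s _; rewrite heat_exp_ray_val ?sqrrN// e3 cosN sinN !(ReM, ImM) /=.
  move: (expR _) (cos _) (sin _) => E C S.
  by transitivity (- 2 * (s * E * S) * (2 * (al * al))); [ring|rewrite al2' mulr1].
rewrite E1 E3; apply: complexP; rewrite !(ReD, ReN, ImD, ImN) /=; last by rewrite subrr.
by rewrite -(Rint_ray_mul al0 al2 a0 r0) -/ph; ring.
Qed.

End KernelValues.

Section UnifiedTransformKernels.
Variable R : realType.
Notation mu := (@lebesgue_measure R).
Notation itg D f := (mu.-integrable D (EFin \o f)).
Notation D0 := (`]0, +oo[%classic : set R).
Notation cabs := (@ComplexField.Normc.normc R).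
Let al : R := cos (pi / 4).

Let al_gt0 : 0 < al.
Proof. by have h := pi_gt0 R; apply: cos_gt0_pihalf; apply/andP; split; lra. Qed.

Let sin_pi4 : sin (pi / 4) = al.
Proof. by rewrite /al -cosBpihalf -cosN; congr cos; lra. Qed.

Let al2 : al ^+ 2 = 2^-1.
Proof. by have := cos2Dsin2 (pi / 4 : R); rewrite sin_pi4 -/al => h; lra. Qed.

Let cexp_i (x : R) : cexp ('i%C * x%:C%C) = (cos x +i* sin x)%C.
Proof.
rewrite /cexp ReM ImM [complex.Re _]/= [complex.Im _]/= [complex.Re _]/= [complex.Im _]/=.
by rewrite !(mul0r, mul1r, mulr0, add0r, oppr0) expR0 mul1r.
Qed.

Let cexp_pi4 : cexp ('i%C * (pi / 4)%:C%C) = (al +i* al)%C.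
Proof. by rewrite cexp_i sin_pi4. Qed.

Let cexp_3pi4 : cexp ('i%C * (3 * pi / 4)%:C%C) = (- al +i* al)%C.
Proof.
rewrite cexp_i (_ : 3 * pi / 4 = pi - pi / 4 :> R); last by lra.
by rewrite cosB sinB cospi sinpi sin_pi4 !mul0r addr0 sub0r !mulN1r opprK.
Qed.

Let cabs_c (p : R) : p ^+ 2 = al ^+ 2 -> cabs (p +i* al)%C <= 1.
Proof.
move=> pE; rewrite /= pE al2 -[leRHS]sqrtr1 ler_sqrt ?ler01//.
by rewrite [leRHS](splitr 1) !mul1r.
Qed.

Lemma cint_real_mul D (k : R -> R) (u : R -> R[i]) :
  cint D (fun y => (k y)%:C%C * u y) =
  ((\int[mu]_(y in D) (k y * complex.Re (u y))) +i*
   (\int[mu]_(y in D) (k y * complex.Im (u y))))%C.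
Proof. by apply: complexP; rewrite ?Re_cint ?Im_cint [RHS]/=; apply: eqRint => y _; rewrite ?ReZ ?ImZ. Qed.

Lemma RintegralZ_neq0 D (k : R) (h : R -> R) : measurable D -> k != 0 ->
  itg D (fun y => k * h y) -> \int[mu]_(y in D) (k * h y) = k * \int[mu]_(y in D) h y.
Proof.
move=> mD k0 hi; rewrite RintegralZl//.
by apply: (eq_itg mD _ (itgZl k^-1 mD hi)) => y _; rewrite mulrA mulVf// mul1r.
Qed.

Lemma cint_scaled_kernel D (k : R) (h : R -> R) (u : R -> R[i]) : measurable D -> k != 0 ->
  citg D (fun y => (k * h y)%:C%C * u y) ->
  cint D (fun y => (k * h y)%:C%C * u y) =
  k%:C%C * ((\int[mu]_(y in D) (complex.Re (u y) * h y)) +i*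
            (\int[mu]_(y in D) (complex.Im (u y) * h y)))%C.
Proof.
move=> mD k0 [i1 i2]; rewrite cint_real_mul; apply: complexP; rewrite ?ReZ ?ImZ /=.
  rewrite -(RintegralZ_neq0 mD k0).
    by apply: eqRint => y _; ring.
  by apply: (eq_itg mD _ i1) => y _; rewrite ReZ; ring.
rewrite -(RintegralZ_neq0 mD k0).
  by apply: eqRint => y _; ring.
by apply: (eq_itg mD _ i2) => y _; rewrite ImZ; ring.
Qed.

Lemma cint_sub_sub D (A B C K : R -> R[i]) : measurable D -> citg D A -> citg D B -> citg D C ->
  (forall y, D y -> A y - (B y - C y) = K y) ->
  cint D A - (cint D B - cint D C) = cint D K /\ citg D K.
Proof.
move=> mD iA iB iC E; have iBC := citgB mD iB iC; split.
  by rewrite -(cintB mD iB iC) -(cintB mD iA iBC); exact: (eq_cint E).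
exact: (eq_citg mD E (citgB mD iA iBC)).
Qed.

(** Sign bookkeeping on abstract numbers: the minus in front of the boundary term meets the minus of
    [dray_val], so the boundary potential enters with a plus. *)
Let assemble (L B C D E F G H l b c d e f g h X Y Z : R[i]) :
  L = l -> B = b -> C = c -> D = d -> E = e -> F = f -> G = g -> H = h ->
  l - (b - c) = X -> d - e = - Y -> f - (g - h) = Z ->
  L - (B - C) - (D - E) + F - (G - H) = X + Y + Z.
Proof. by do 8!move=> ->; move=> -> -> <-; rewrite opprK addrA. Qed.

(** The line supplies the direct kernel and the rays the reflected one, which together form [hG], at
    time [t] for [u0] and at [t - tau] for [f]; the rays with weight [2 i lam] supply [hh]. *)
Lemma unified_transformE (u0 g0 : R -> R[i]) (f : R -> R -> R[i]) (b bf : R -> R) (M x t : R) :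
  0 < x -> 0 < t ->
  cmeas D0 u0 -> itg D0 b -> (forall y : R, 0 < y -> cabs (u0 y) <= b y) ->
  cmeas `]0, t[ g0 -> (forall tau : R, 0 < tau < t -> cabs (g0 tau) <= M) ->
  (forall tau, cmeas D0 (f ^~ tau)) -> itg D0 bf ->
  (forall y tau : R, 0 < y -> tau <= t -> cabs (f y tau) <= bf y) ->
  (forall y : R, 0 < y -> continuous (fun tau => complex.Re (f y tau)) /\
                          continuous (fun tau => complex.Im (f y tau))) ->
  unified_transform u0 g0 f x t = (2 * pi)%:C%C *
    ((hP (fun y => complex.Re (u0 y)) x t + hB (fun tau => complex.Re (g0 tau)) x t +
        hS (fun y tau => complex.Re (f y tau)) x t) +i*
     (hP (fun y => complex.Im (u0 y)) x t + hB (fun tau => complex.Im (g0 tau)) x t +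
        hS (fun y tau => complex.Im (f y tau)) x t))%C.
Proof.
move=> x0 t0 mu0 bi ub mg gM mf bfi fb fc.
have mD0 : measurable D0 by [].
have mI : measurable (`]0, t[ : set R) by [].
have p2 : 2 * pi != 0 :> R by rewrite mulf_neq0// gt_eqF// pi_gt0.
have alN : (- al) ^+ 2 = al ^+ 2 by rewrite sqrrN.
have [iL EL] := line_fhat x t0 mu0 bi ub.
have [iR1 ER1] := @ray_fhat R (al +i* al)%C al x t al_gt0 erefl erefl (cabs_c erefl) x0 t0 u0 b mu0 bi ub.
have [iR3 ER3] := @ray_fhat R (- al +i* al)%C al x t al_gt0 erefl alN (cabs_c alN) x0 t0 u0 b mu0 bi ub.
have [iG1 EG1] := @ray_ftilde R (al +i* al)%C al x t al_gt0 erefl erefl (cabs_c erefl) x0 t0 g0 M mg gM.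
have [iG3 EG3] := @ray_ftilde R (- al +i* al)%C al x t al_gt0 erefl alN (cabs_c alN) x0 t0 g0 M mg gM.
have [jL kL FL] := line_fhat_tilde x t0 mf bfi fb fc.
have [j1 k1 F1] := @ray_fhat_tilde R (al +i* al)%C al x t al_gt0 erefl erefl (cabs_c erefl) x0 t0 f bf mf bfi fb fc.
have [j3 k3 F3] := @ray_fhat_tilde R (- al +i* al)%C al x t al_gt0 erefl alN (cabs_c alN) x0 t0 f bf mf bfi fb fc.
have KE (r y : R) (z : R[i]) : 0 < r -> 0 < y -> kline (x - y) r * z - (kray (al +i* al)%C (x + y) r * z -
    kray (- al +i* al)%C (x + y) r * z) = (2 * pi * hG x y r)%:C%C * z.
  move=> r0 y0; rewrite -mulrBl -mulrBl kline_val// (kray_val al_gt0 al2 (addr_gt0 x0 y0) r0).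
  by rewrite /hG mulrBr rmorphB.
have HU : cint D0 (fun y => kline (x - y) t * u0 y) -
   (cint D0 (fun y => kray (al +i* al)%C (x + y) t * u0 y) -
    cint D0 (fun y => kray (- al +i* al)%C (x + y) t * u0 y)) = (2 * pi)%:C%C *
   (hP (fun y => complex.Re (u0 y)) x t +i* hP (fun y => complex.Im (u0 y)) x t)%C.
  have E y : D0 y -> kline (x - y) t * u0 y - (kray (al +i* al)%C (x + y) t * u0 y -
      kray (- al +i* al)%C (x + y) t * u0 y) = (2 * pi * hG x y t)%:C%C * u0 y.
    by rewrite D0P => y0; exact: KE.
  have [H iK] := cint_sub_sub mD0 iL iR1 iR3 E.
  exact: (eq_trans H (cint_scaled_kernel mD0 p2 iK)).
have HG : cint `]0, t[ (fun tau => dray (al +i* al)%C x (t - tau) * g0 tau) -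
    cint `]0, t[ (fun tau => dray (- al +i* al)%C x (t - tau) * g0 tau) = - ((2 * pi)%:C%C *
   (hB (fun y => complex.Re (g0 y)) x t +i* hB (fun y => complex.Im (g0 y)) x t)%C).
  have E tau : `]0, t[%classic tau -> dray (al +i* al)%C x (t - tau) * g0 tau -
      dray (- al +i* al)%C x (t - tau) * g0 tau = (- (2 * pi) * hh x (t - tau))%:C%C * g0 tau.
    rewrite /= in_itv/= => /andP[_ h2].
    by rewrite -mulrBl (dray_val al_gt0 al2 x0) ?subr_gt0// mulNr.
  have p2N : - (2 * pi) != 0 :> R by rewrite oppr_eq0.
  rewrite -mulNr -rmorphN; apply: (eq_trans (esym (cintB mI iG1 iG3))).
  apply: (eq_trans (eq_cint E)).
  exact: (cint_scaled_kernel mI p2N (eq_citg mI E (citgB mI iG1 iG3))).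
have HF : cint `]0, t[ (fun tau => cint D0 (fun y => kline (x - y) (t - tau) * f y tau)) -
   (cint `]0, t[ (fun tau => cint D0 (fun y => kray (al +i* al)%C (x + y) (t - tau) * f y tau)) -
    cint `]0, t[ (fun tau => cint D0 (fun y => kray (- al +i* al)%C (x + y) (t - tau) * f y tau))) = (2 * pi)%:C%C *
   (hS (fun y tau => complex.Re (f y tau)) x t +i* hS (fun y tau => complex.Im (f y tau)) x t)%C.
  have E tau : `]0, t[%classic tau -> cint D0 (fun y => kline (x - y) (t - tau) * f y tau) -
      (cint D0 (fun y => kray (al +i* al)%C (x + y) (t - tau) * f y tau) -
       cint D0 (fun y => kray (- al +i* al)%C (x + y) (t - tau) * f y tau)) =
      (2 * pi * 1)%:C%C * (hP (fun y => complex.Re (f y tau)) x (t - tau) +i*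
        hP (fun y => complex.Im (f y tau)) x (t - tau))%C.
    rewrite /= in_itv/= => tI; have r0 : 0 < t - tau by rewrite subr_gt0; case/andP: tI.
    have E' y : D0 y -> kline (x - y) (t - tau) * f y tau - (kray (al +i* al)%C (x + y) (t - tau) * f y tau -
      kray (- al +i* al)%C (x + y) (t - tau) * f y tau) = (2 * pi * hG x y (t - tau))%:C%C * f y tau.
      by rewrite D0P => y0; exact: KE.
    have [H iK] := cint_sub_sub mD0 (kL tau tI) (k1 tau tI) (k3 tau tI) E'.
    rewrite mulr1; exact: (eq_trans H (cint_scaled_kernel mD0 p2 iK)).
  have [H iK] := cint_sub_sub mI jL j1 j3 E.
  apply: (eq_trans H); apply: (eq_trans (cint_scaled_kernel mI p2 iK)).
  congr (_ * (_ +i* _)%C); apply: eqRint => tau _; exact: mulr1.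
rewrite /unified_transform /gamma_int /ray_int cexp_pi4 cexp_3pi4.
rewrite /heat_exp in EL ER1 ER3 EG1 EG3 FL F1 F3.
apply: (eq_trans (assemble EL ER1 ER3 EG1 EG3 FL F1 F3 HU HG HF)).
by rewrite -!mulrDr.
Qed.

End UnifiedTransformKernels.

(** * The initial-boundary value problem *)

Section Components.
Variable R : realType.
Notation mu := (@lebesgue_measure R).
Notation itg D f := (mu.-integrable D (EFin \o f)).
Notation D0 := (`]0, +oo[%classic : set R).
Notation cabs := (@ComplexField.Normc.normc R).

(** A boolean selects the component, so that each argument on the heat problem is written once for
    both. *)
Definition part (b : bool) (z : R[i]) : R := if b then complex.Re z else complex.Im z.

Lemma eq_part (z w : R[i]) : (forall b, part b z = part b w) -> z = w.
Proof. by move=> H; apply: complexP; [exact: (H true)|exact: (H false)]. Qed.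

Lemma part_le b z : `|part b z| <= cabs z.
Proof. by case: b; [exact: cabs_Re|exact: cabs_Im]. Qed.

Lemma partB b z w : part b (z - w) = part b z - part b w.
Proof. by case: b; rewrite /= ?ReD ?ImD ?ReN ?ImN. Qed.

Lemma partZ b (k : R) z : part b (k%:C%C * z) = k * part b z.
Proof. by case: b; rewrite /= ?ReZ ?ImZ. Qed.

Lemma chderivable_part b (u : R -> R[i]) x : chderivable u x -> hderivable (fun s => part b (u s)) x.
Proof. by case: b => -[]. Qed.

Lemma part_chderivable (u : R -> R[i]) x : (forall b, hderivable (fun s => part b (u s)) x) -> chderivable u x.
Proof. by move=> H; split; [exact: (H true)|exact: (H false)]. Qed.

Lemma part_chderive b (u : R -> R[i]) x : part b (chderive u x) = hderive (fun s => part b (u s)) x.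
Proof. by case: b. Qed.

Lemma part_ccvg T (h : T -> R[i]) (F : set_system T) l :
  (forall b, part b (h s) @[s --> F] --> part b l) -> ccvg h F l.
Proof. by move=> H; split; [exact: (H true)|exact: (H false)]. Qed.

Lemma ccvg_part b T (h : T -> R[i]) (F : set_system T) l :
  ccvg h F l -> part b (h s) @[s --> F] --> part b l.
Proof. by case: b => -[]. Qed.

Lemma hderivable_is_derive (h : R -> R) (x : R) : 0 < x -> hderivable h x ->
  is_derive x (1 : R) h (hderive h x).
Proof.
rewrite /hderivable /hderive => x0; rewrite x0 => dh.
by rewrite derive1E; apply: DeriveDef.
Qed.

Lemma is_derive_hderivable (h : R -> R) (x d : R) : 0 < x -> is_derive x (1 : R) h d ->
  hderivable h x /\ hderive h x = d.
Proof.
rewrite /hderivable /hderive => x0 H; rewrite x0; split; first exact: ex_derive.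
by rewrite derive1E derive_val.
Qed.

Lemma hderivable_cvg0 (h : R -> R) : hderivable h 0 -> h y @[y --> 0^'+] --> h 0.
Proof.
rewrite /hderivable ltxx => dh.
have h1 : y * ((h y - h 0) / y) + h 0 @[y --> (0 : R)^'+] --> 0 * lim ((h y - h 0) / y @[y --> 0^'+]) + h 0.
  apply: cvgD; last exact: cvg_cst.
  apply: cvgM; last exact: dh.
  by apply: cvg_at_right_filter; exact: cvg_id.
rewrite mul0r add0r in h1; apply: cvg_trans h1; apply: near_eq_cvg; near=> y.
have y0 : y != 0 by rewrite gt_eqF//; near: y; exact: nbhs_right_gt.
by rewrite mulrCA divff// mulr1 subrK.
Unshelve. all: by end_near. Qed.

(** Freezing the function at its value at [0] makes it continuous on the whole line: a right
    derivative at [0] yields right continuity, and to the left it is constant. *)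
Lemma hderivable_max_continuous (h : R -> R) : (forall t : R, 0 <= t -> hderivable h t) ->
  continuous (fun t : R => h (Num.max t 0)).
Proof.
move=> dh t; have [t0|t0|t0] := ltgtP t 0.
- rewrite /continuous_at max_r ?(ltW t0)//; apply: cvg_near_cst.
  near=> s; rewrite max_r//; apply: ltW; near: s; exact: lt_nbhsl.
- have H := hderivable_is_derive t0 (dh t (ltW t0)).
  rewrite /continuous_at max_l ?(ltW t0)//; apply: cvg_trans (is_derive_continuous H).
  apply: near_eq_cvg; near=> s; rewrite max_l//; apply: ltW; near: s; exact: lt_nbhsr.
- rewrite t0 /continuous_at maxxx; have /hderivable_cvg0 /cvgrPdist_le H := dh 0 (lexx 0).
  apply/cvgrPdist_le => e e0; have [d /= d0 dP] := H e e0.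
  exists d => //= s sd; have [s0|s0] := leP s 0; first by rewrite subrr normr0 ltW.
  exact: dP.
Unshelve. all: by end_near. Qed.

Lemma cabs_norm_le (z : R[i]) (M : R) : `|z| <= M%:C%C -> cabs z <= M.
Proof. by rewrite cabsE lecR. Qed.

(** Adding the Schwartz bounds of orders [0] and [2] bounds [1 + y^2] times the modulus by
    [M0 + M2]. *)
Lemma decay_bound (z : R[i]) (y M0 M2 : R) : `|y%:C%C ^+ 0 * z| <= M0%:C%C ->
  `|y%:C%C ^+ 2 * z| <= M2%:C%C -> cabs z <= (M0 + M2) * (1 + y ^+ 2)^-1.
Proof.
move=> /cabs_norm_le h0 /cabs_norm_le h2; rewrite ler_pdivlMr ?ltr_pwDl ?sqr_ge0//.
rewrite expr0 mul1r in h0; rewrite -rmorphXn/= cabsM cabs_real ger0_norm ?sqr_ge0// in h2.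
by rewrite mulrDr mulr1 (mulrC (cabs z)) lerD.
Qed.

End Components.

(** * The data as real functions defined at all times *)

Section Data.
Variable R : realType.
Notation mu := (@lebesgue_measure R).
Notation itg D f := (mu.-integrable D (EFin \o f)).
Notation D0 := (`]0, +oo[%classic : set R).
Notation cabs := (@ComplexField.Normc.normc R).
Variables (u0 g0 : R -> R[i]) (f : R -> R -> R[i]).
Hypotheses (hu0 : schwartz_half u0) (hg0 : smooth_half g0) (hf : smooth_Qbar f)
  (hfS : schwartz_loc_unif f).

Let pos (t : R) := Num.max t 0.
Let pos_ge0 t : 0 <= pos t. Proof. by rewrite le_max lexx orbT. Qed.
Let posE (t : R) : 0 <= t -> pos t = t. Proof. exact: max_l. Qed.

(* Time is extended to negative values by freezing the data at [t = 0]. *)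
Definition initial_part b (y : R) := part b (u0 y).
Definition boundary_part b (tau : R) := part b (g0 (pos tau)).
Definition source_part b (y tau : R) := part b (f y (pos tau)).

Lemma source_partP b : source (source_part b) (fun y tau => part b (Dx f y (pos tau)))
  (fun y tau => part b (Dx (Dx f) y (pos tau))) (fun tau => part b (f 0 (pos tau))).
Proof.
have dx w y tau : 0 <= y -> hderivable (fun s => part b (pderiv w f s (pos tau))) y.
  by move=> y0; have [/(_ y (pos tau) y0 (pos_ge0 _))[h _] _] := hf w; exact: chderivable_part.
have dt w y tau : 0 <= y -> 0 <= tau -> hderivable (fun s => part b (pderiv w f y s)) tau.
  by move=> y0 t0; have [/(_ y tau y0 t0)[_ h] _] := hf w; exact: chderivable_part.
split.
- move=> tau y y0; split.
    have := hderivable_is_derive y0 (dx [::] y tau (ltW y0)).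
    by rewrite -part_chderive.
  have := hderivable_is_derive y0 (dx [:: true] y tau (ltW y0)).
  by rewrite -part_chderive.
- move=> tau y y0; have H := hderivable_is_derive y0 (dx [:: true; true] y tau (ltW y0)).
  exact: is_derive_continuous H.
(* The Schwartz hypothesis concerns positive [T]; freezing sends every [tau <= T] into [[0, T']]. *)
- move=> T; pose T' := Num.max T 1.
  have T0 : 0 < T' by rewrite lt_max ltr01 orbT.
  have bnd k : exists M : R, forall tau y : R, tau <= T -> 0 < y ->
      `|part b (iter k (@Dx R) f y (pos tau))| <= M * (1 + y ^+ 2)^-1.
    have [M0 H0] := hfS k 0 T0; have [M2 H2] := hfS k 2 T0.
    exists (M0 + M2) => tau y tT y0.
    have tI : 0 <= pos tau <= T'.
      by rewrite pos_ge0 /pos ge_max !le_max tT ler01 orbT.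
    apply: (le_trans (part_le _ _)); apply: decay_bound.
      exact: H0 (ltW y0) tI.
    exact: H2 (ltW y0) tI.
  have [M0 H0] := bnd 0; have [M1 H1] := bnd 1; have [M2 H2] := bnd 2.
  exists (Num.max M0 (Num.max M1 M2)) => tau y tT y0.
  have w0 : 0 <= (1 + y ^+ 2)^-1 by exact: oneDsqrV_ge0.
  split.
  + apply: (le_trans (H0 tau y tT y0)); rewrite ler_wpM2r// le_max lexx//.
  + apply: (le_trans (H1 tau y tT y0)); rewrite ler_wpM2r// !le_max lexx orbT//.
  + apply: (le_trans (H2 tau y tT y0)); rewrite ler_wpM2r// !le_max lexx !orbT//.
- move=> y y0; apply: (@hderivable_max_continuous R (fun s => part b (f y s))) => tau.
  exact: (dt [::] y tau (ltW y0)).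
- move=> tau; exact: (hderivable_cvg0 (dx [::] 0 tau (lexx _))).
Qed.

Lemma boundary_part_continuous b : continuous (boundary_part b).
Proof.
apply: (@hderivable_max_continuous R (fun s => part b (g0 s))) => tau tau0.
exact: chderivable_part (hg0 0 tau0).
Qed.

Lemma boundary_part_bdd b : bdd_loc (boundary_part b).
Proof.
have gc := @boundary_part_continuous b.
split; first exact: continuous_measurable_fun.
move=> T; have [T0|T0] := leP T 0.
  exists `|boundary_part b 0| => t tT.
  by rewrite /boundary_part /pos (max_r (le_trans tT T0)) maxxx.
have nc : {within `[0, T], continuous (fun tau => `|boundary_part b tau|)}.
  apply: continuous_subspaceT => tau; apply: continuous_comp; first exact: gc.
  exact: norm_continuous.
have [c _ cP] := EVT_max (ltW T0) nc.
exists `|boundary_part b c| => t tT; have [t0|t0] := leP 0 t.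
  by apply: cP; rewrite in_itv/= t0.
have -> : boundary_part b t = boundary_part b 0 by rewrite /boundary_part /pos (max_r (ltW t0)) maxxx.
by apply: cP; rewrite in_itv/= lexx ltW.
Qed.

Lemma initial_part_dominated : exists2 M : R, forall y : R, 0 < y -> cabs (u0 y) <= M * (1 + y ^+ 2)^-1 &
  forall b, dominated (initial_part b) 0 (fun y => M * (1 + y ^+ 2)^-1) /\
    forall y, 0 < y -> {for y, continuous (initial_part b)}.
Proof.
have [sm bd] := hu0; have [M0 H0] := bd 0 0; have [M2 H2] := bd 0 2.
have MP (y : R) : 0 < y -> cabs (u0 y) <= (M0 + M2) * (1 + y ^+ 2)^-1.
  by move=> y0; apply: decay_bound; [exact: H0 (ltW y0)|exact: H2 (ltW y0)].
exists (M0 + M2) => // b.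
have cu y : 0 < y -> {for y, continuous (initial_part b)}.
  move=> y0; apply: is_derive_continuous.
  exact: (hderivable_is_derive y0 (chderivable_part b (sm 0 y (ltW y0)))).
split => //; split => //.
- exact: continuous_D0_measurable.
- by apply: itgZl => //; exact: itg_oneDsqrV0.
- by move=> y y0; exact: le_trans (cabs_ge0 _) (MP y y0).
- by move=> y y0; rewrite add0r; exact: le_trans (part_le _ _) (MP y y0).
Qed.

(** At time [t] the transform reads [g0] and [f] on [[0, t]] only, so freezing the data before [0]
    leaves it unchanged. *)
Lemma unified_transform_ext (h0 : R -> R[i]) (k : R -> R -> R[i]) (x t : R) :
  (forall tau, 0 <= tau <= t -> g0 tau = h0 tau) ->
  (forall y tau, 0 <= tau <= t -> f y tau = k y tau) ->
  unified_transform u0 g0 f x t = unified_transform u0 h0 k x t.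
Proof.
move=> gh fk.
have Eg lam : ftilde g0 lam t = ftilde h0 lam t.
  by apply: eq_cint => tau; rewrite /= in_itv/= => /gh ->.
have Ef lam : fhat_tilde f lam t = fhat_tilde k lam t.
  apply: eq_cint => tau; rewrite /= in_itv/= => tI; congr (_ * _).
  by apply: eq_cint => y _; rewrite fk.
pose Phi (G F : R[i] -> R[i]) : R[i] := let E lam := cexp ('i%C * lam * x%:C%C - lam ^+ 2 * t%:C%C) in
  line_int (fun lam => E lam * fhat u0 lam)
  - gamma_int (fun lam => E lam * fhat u0 (- lam))
  - gamma_int (fun lam => E lam * (2 * 'i%C * lam) * G lam)
  + line_int (fun lam => E lam * F lam)
  - gamma_int (fun lam => E lam * F (- lam)).
have Eg' : ftilde g0 ^~ t = ftilde h0 ^~ t by apply/funext => lam; exact: Eg.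
have Ef' : fhat_tilde f ^~ t = fhat_tilde k ^~ t by apply/funext => lam; exact: Ef.
exact: (f_equal2 Phi Eg' Ef').
Qed.

Lemma unified_transform_part b (x t : R) : 0 < x -> 0 < t ->
  part b (unified_transform u0 g0 f x t) = 2 * pi *
    (hP (initial_part b) x t + hB (boundary_part b) x t + hS (source_part b) x t).
Proof.
move=> x0 t0.
rewrite (@unified_transform_ext (fun tau => g0 (pos tau)) (fun y tau => f y (pos tau))); last 2 first.
- by move=> tau /andP[h _]; rewrite posE.
- by move=> y tau /andP[h _]; rewrite posE.
have [M MP dom] := initial_part_dominated.
have [_ /(_ t)[G1 G1P]] := boundary_part_bdd true.
have [_ /(_ t)[G2 G2P]] := boundary_part_bdd false.
have [s1 _ s3 s4 _] := source_partP true; have [s1' _ s3' s4' _] := source_partP false.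
have [M1 M1P] := s3 t; have [M2 M2P] := s3' t.
rewrite (@unified_transformE R _ _ _ (fun y => M * (1 + y ^+ 2)^-1) (fun y => (M1 + M2) * (1 + y ^+ 2)^-1) (G1 + G2))//.
- by rewrite partZ; case: b.
- by split; [have [[m _ _ _ _] _] := dom true|have [[m _ _ _ _] _] := dom false].
- by apply: itgZl => //; exact: itg_oneDsqrV0.
- split; apply: measurable_funTS; apply: continuous_measurable_fun.
    exact: (@boundary_part_continuous true).
  exact: (@boundary_part_continuous false).
- move=> tau /andP[_ /ltW h]; apply: (le_trans (cabs_le_add _)); apply: lerD.
    exact: (G1P tau h).
  exact: (G2P tau h).
- move=> tau; split; apply: continuous_D0_measurable => y y0.
    have [H _] := s1 tau y y0; exact: (is_derive_continuous H).
  have [H _] := s1' tau y y0; exact: (is_derive_continuous H).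
- by apply: itgZl => //; exact: itg_oneDsqrV0.
- move=> y tau y0 h; apply: (le_trans (cabs_le_add _)); rewrite mulrDl; apply: lerD.
    by have [k _ _] := M1P tau y h y0.
  by have [k _ _] := M2P tau y h y0.
- by move=> y y0; split; [exact: s4|exact: s4'].
Qed.

End Data.

(** * The transform solves the problem, and uniqueness *)

Section Solution.
Variable R : realType.
Notation mu := (@lebesgue_measure R).
Notation itg D f := (mu.-integrable D (EFin \o f)).
Notation D0 := (`]0, +oo[%classic : set R).
Notation cabs := (@ComplexField.Normc.normc R).
Variables (u0 g0 : R -> R[i]) (f U : R -> R -> R[i]).
Hypotheses (hu0 : schwartz_half u0) (hg0 : smooth_half g0) (hf : smooth_Qbar f)
  (hfS : schwartz_loc_unif f).
Hypothesis hU : forall x t : R, 0 < x -> 0 < t ->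
  2 * (pi : R)%:C%C * U x t = unified_transform u0 g0 f x t.

Let u b := initial_part u0 b.
Let g b := boundary_part g0 b.
Let k b := source_part f b.
Let P b x t := hP (u b) x t + hB (g b) x t + hS (k b) x t.
Let Px b x t := hPx (u b) x t + hBx (g b) x t + hSx (k b) x t.
Let Pxx b x t := hPxx (u b) x t + hBt (g b) x t + hSxx (k b) x t.

Let kE b (x t : R) : 0 < t -> k b x t = part b (f x t).
Proof. by move=> t0; rewrite /k /source_part max_l// ltW. Qed.

Let gE b (t : R) : 0 < t -> g b t = part b (g0 t).
Proof. by move=> t0; rewrite /g /boundary_part max_l// ltW. Qed.

Lemma part_U b (x t : R) : 0 < x -> 0 < t -> part b (U x t) = P b x t.
Proof.
move=> x0 t0; have p2 : 2 * pi != 0 :> R by rewrite mulf_neq0// gt_eqF// pi_gt0.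
apply: (mulfI p2); rewrite -(unified_transform_part hu0 hg0 hf hfS b x0 t0) -hU// -partZ.
by rewrite rmorphM/= (rmorph_nat (real_complex R) 2).
Qed.

Lemma is_derive_P b (x t : R) : 0 < x -> 0 < t ->
  [/\ is_derive x (1 : R) (P b ^~ t) (Px b x t), is_derive x (1 : R) (Px b ^~ t) (Pxx b x t) &
      is_derive t (1 : R) (P b x) (Pxx b x t + k b x t)].
Proof.
move=> x0 t0; have [M _ /(_ b)[ud _]] := initial_part_dominated hu0.
have gd := boundary_part_bdd hg0 b; have ks := source_partP hf hfS b.
split.
- exact: (is_deriveD (is_deriveD (is_derive_hP_x x ud t0) (is_derive_hB_x gd x0 t0)) (is_derive_hS_x ks x0 t0)).
- exact: (is_deriveD (is_deriveD (is_derive_hP_xx x ud t0) (is_derive_hB_xx gd x0 t0)) (is_derive_hS_xx ks x0 t0)).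
- rewrite -addrA; exact: (is_deriveD (is_deriveD (is_derive_hP_s x ud t0) (is_derive_hB_t gd x0 t0)) (is_derive_hS_t ks x0 t0)).
Qed.

Lemma is_derive_U b (x t : R) : 0 < x -> 0 < t ->
  is_derive x (1 : R) (fun s => part b (U s t)) (Px b x t) /\
  is_derive t (1 : R) (fun s => part b (U x s)) (Pxx b x t + k b x t).
Proof.
move=> x0 t0; have [H1 _ H3] := is_derive_P b x0 t0; split.
  apply: is_derive_near H1; near=> s; rewrite part_U//; near: s; exact: lt_nbhsr.
apply: is_derive_near H3; near=> s; rewrite part_U//; near: s; exact: lt_nbhsr.
Unshelve. all: by end_near. Qed.

Lemma is_derive_DxU b (x t : R) : 0 < x -> 0 < t ->
  is_derive x (1 : R) (fun s => part b (Dx U s t)) (Pxx b x t).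
Proof.
move=> x0 t0; have [_ H2 _] := is_derive_P b x0 t0.
apply: is_derive_near H2; near=> s; have s0 : 0 < s by near: s; exact: lt_nbhsr.
rewrite /Dx part_chderive; have [H _] := is_derive_U b s0 t0.
by have [_ ->] := is_derive_hderivable s0 H.
Unshelve. all: by end_near. Qed.

Lemma unified_solves : solves_heat f u0 g0 U.
Proof.
split.
- move=> x t x0 t0; split.
  + split; apply: part_chderivable => b; have [H1 H2] := is_derive_U b x0 t0.
      by have [] := is_derive_hderivable x0 H1.
    by have [] := is_derive_hderivable t0 H2.
  + by apply: part_chderivable => b; have [] := is_derive_hderivable x0 (is_derive_DxU b x0 t0).
  + apply: eq_part => b; rewrite partB /Dt {1}/Dx !part_chderive.
    have [_ H2] := is_derive_U b x0 t0.
    have [_ ->] := is_derive_hderivable t0 H2.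
    have [_ ->] := is_derive_hderivable x0 (is_derive_DxU b x0 t0).
    by rewrite kE// addrC addKr.
- move=> x x0; apply: part_ccvg => b.
  have [M _ /(_ b)[ud uc]] := initial_part_dominated hu0.
  have gd := boundary_part_bdd hg0 b; have ks := source_partP hf hfS b.
  have H : P b x t @[t --> 0^'+] --> u b x + 0 + 0.
    apply: cvgD; last exact: (hS_t0 ks x0).
    by apply: cvgD; [exact: (hP_t0 ud x0 (uc x x0))|exact: (hB_t0 gd x0)].
  rewrite !addr0 in H; apply: cvg_trans H; apply: near_eq_cvg; near=> t.
  by rewrite part_U//; near: t; exact: nbhs_right_gt.
- move=> t t0; apply: part_ccvg => b.
  have [M _ /(_ b)[ud uc]] := initial_part_dominated hu0.
  have gd := boundary_part_bdd hg0 b; have ks := source_partP hf hfS b.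
  have H : P b x t @[x --> 0^'+] --> 0 + g b t + 0.
    apply: cvgD; last exact: (hS_x0 ks t0).
    by apply: cvgD; [exact: (hP_x0 ud t0)|exact: (hB_x0 gd (@boundary_part_continuous _ _ hg0 b) t0)].
  rewrite addr0 add0r gE// in H; apply: cvg_trans H; apply: near_eq_cvg; near=> x.
  by rewrite part_U//; near: x; exact: nbhs_right_gt.
Unshelve. all: by end_near. Qed.

Section Uniqueness.
Variable V : R -> R -> R[i].
Hypothesis C2 : C2_off_corner V.
Hypothesis Vsol : solves_heat f u0 g0 V.
Hypothesis Vy : forall t : R, 0 < t -> ccvg (fun x => V x t) (+oo)%R 0 /\
  exists M : R, forall x : R, 1 <= x -> `|Dx V x t| <= M%:C%C.
Hypothesis VB : forall T : R, 0 < T -> exists B : R -> R,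
  [/\ forall x : R, 0 < x -> 0 < B x, itg D0 B &
      forall x t : R, 0 < x -> 0 < t <= T ->
        `|V x t| ^+ 2 <= (B x)%:C%C /\ `|Dt V x t| ^+ 2 <= (B x)%:C%C].

(** The open quadrant is a neighbourhood of the point, and on it the continuous extension coincides
    with the derivative. *)
Lemma pderiv_continuous b (w : seq bool) (x t : R) : (size w <= 2)%N -> 0 < x -> 0 < t ->
  {for (x, t), continuous (fun p : R * R => part b (pderiv w V p.1 p.2))}.
Proof.
move=> sw x0 t0; have [_ /(_ w sw)[G [Gc GE]]] := C2.
have Gb : {within Qbar (R:=R) `\ (0, 0), continuous (fun p => part b (G p))}.
  by case: b Gc => -[].
have QA : Q (R:=R) `<=` Qbar (R:=R) `\ (0, 0).
  move=> [y s] [/= y0 s0]; split; first by split; exact: ltW.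
  by case=> yE _; rewrite yE ltxx in y0.
have Qo : open (Q (R:=R)).
  rewrite (_ : Q (R:=R) = (fst @^-1` [set y : R | 0 < y]) `&` (snd @^-1` [set y : R | 0 < y]))//.
  by apply: openI; apply: open_comp; [move=> p _; exact: cvg_fst|exact: open_gt|move=> p _; exact: cvg_snd|exact: open_gt].
have Qxt : Q (x, t) by [].
have := continuous_subspaceW QA Gb; rewrite continuous_open_subspace// => /(_ (x, t) (mem_set Qxt)) H.
rewrite /prop_for /continuous_at -(GE _ Qxt); apply: cvg_trans H; apply: near_eq_cvg.
have : nbhs (x, t) (Q (R:=R)) by exact: open_nbhs_nbhs.
by apply: filterS => p Qp; rewrite (GE p Qp).
Qed.

(** Condition (ii) bounds [V_x] only for [x >= 1]. For smaller [x] the continuous extension is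
    bounded on the compact segment [[0, 1]] at height [t], which avoids the corner because
    [t > 0]. *)
Lemma Dx_bounded_near0 b (t : R) : 0 < t ->
  exists M : R, forall x : R, 0 < x <= 1 -> `|part b (Dx V x t)| <= M.
Proof.
move=> t0; have [_ /(_ [:: true] isT)[G [Gc GE]]] := C2.
have Gb : {within Qbar (R:=R) `\ (0, 0), continuous (fun p => part b (G p))}.
  by case: b Gc => -[].
pose K := `[0, 1]%classic `*` [set t] : set (R * R).
have KA : K `<=` Qbar (R:=R) `\ (0, 0).
  move=> [y s] [/= ]; rewrite in_itv/= => /andP[y0 _] ->; split; first by split=> //=; exact: ltW.
  by case=> _ tE; rewrite tE ltxx in t0.
have cK : compact K by apply: compact_setX; [exact: segment_compact|exact: compact_set1].
have /compact_bounded [M [_ /(_ (M + 1))]] := continuous_compact (continuous_subspaceW KA Gb) cK.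
rewrite ltrDl ltr01 => /(_ isT) MP; exists (M + 1) => x /andP[x0 x1].
have Qxt : Q (x, t) by [].
rewrite -[Dx V x t]/(pderiv [:: true] V (x, t).1 (x, t).2) -(GE _ Qxt).
apply: MP; exists (x, t) => //; split=> //=.
by rewrite in_itv/= ltW.
Qed.

(** The representation involves only the data, so it yields for [V] the very expression that
    [part_U] gives for [U]. *)
Lemma part_V b (x t : R) : 0 < x -> 0 < t -> part b (V x t) = P b x t.
Proof.
move=> x0 t0; have [Veq Vt0 Vx0] := Vsol; have [Vd _] := C2.
apply: (@heat_representation R (fun x t => part b (V x t)) (fun x t => part b (Dx V x t))
  (fun x t => part b (Dx (Dx V) x t)) (fun x t => part b (Dt V x t)) (k b)
  _ _ (u b) (g b) _ (source_partP hf hfS b) (boundary_part_bdd hg0 b) (@boundary_part_continuous _ _ hg0 b)) => //.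
- move=> y s y0 s0; have [/(chderivable_part b) H _] := Vd [::] isT y s y0 s0.
  by have := hderivable_is_derive y0 H; rewrite -part_chderive.
- move=> y s y0 s0; have [/(chderivable_part b) H _] := Vd [:: true] isT y s y0 s0.
  by have := hderivable_is_derive y0 H; rewrite -part_chderive.
- move=> y s y0 s0; have [_ /(chderivable_part b) H] := Vd [::] isT y s y0 s0.
  by have := hderivable_is_derive s0 H; rewrite -part_chderive.
- move=> y s y0 s0; have [_ _ E] := Veq y s y0 s0.
  by rewrite -partB E kE.
- move=> y s y0 s0; have H := @pderiv_continuous b [:: true; true] y s isT y0 s0.
  apply: (continuous_comp (f := fun z : R => (z, s)) _ H).
  have := @cvg_pair R R R (nbhs y) (nbhs y) (nbhs s) _ _ _ id (fun=> s).
  by apply; [exact: cvg_id|exact: cvg_cst].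
- move=> y s y0 s0 e e0.
  have /cvgrPdist_le /(_ e e0) := @pderiv_continuous b [::] y s isT y0 s0.
  move=> /nbhs_ballP[d /= d0 dP]; exists d => // z r z0 r0 zy rs.
  have zb : ball y d z by rewrite /ball/= distrC.
  have rb : ball s d r by rewrite /ball/= distrC.
  by rewrite distrC; exact: (dP (z, r) (conj zb rb)).
- by move=> y y0; exact: ccvg_part (Vt0 y y0).
- by move=> s s0; rewrite gE//; exact: ccvg_part (Vx0 s s0).
- move=> s s0; have [_ [M MP]] := Vy s0; have [M' M'P] := Dx_bounded_near0 b s0.
  exists (Num.max M M') => y y0; have [y1|y1] := leP y 1.
    by rewrite le_max M'P ?orbT// y0.
  by rewrite le_max (le_trans (part_le _ _))// cabs_norm_le// MP// ltW.
- move=> s s0; have [H _] := Vy s0.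
  have E : part b 0 = 0 :> R by case: (b).
  by rewrite -{1}E; exact: ccvg_part H.
- move=> T T0; have [B [B0 Bi BP]] := VB T0; exists B; split => //.
    by move=> y y0; exact: ltW (B0 y y0).
  move=> y s y0 sT; have [H1 H2] := BP y s y0 sT.
  have N z : `|z| ^+ 2 <= (B y)%:C%C -> `|part b z| ^+ 2 <= B y.
    rewrite cabsE -rmorphXn/= lecR; apply: le_trans.
    by rewrite lerXn2r ?nnegrE ?cabs_ge0// part_le.
  by split; exact: N.
Qed.

End Uniqueness.

End Solution.

Theorem theorem4 (R : realType) (u0 g0 : R -> R[i]) (f : R -> R -> R[i])
    (U : R -> R -> R[i])
    (hu0 : schwartz_half u0)
    (hg0 : smooth_half g0)
    (hf : smooth_Qbar f)
    (hfS : schwartz_loc_unif f)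
    (hcompat0 : u0 0 = g0 0)
    (hcompat1 : iter 2 (@chderive R) u0 0 + f 0 0 = chderive g0 0)
    (hU : forall x t : R, 0 < x -> 0 < t ->
       2 * (pi : R)%:C%C * U x t = unified_transform u0 g0 f x t) :
  solves_heat f u0 g0 U /\
  forall V : R -> R -> R[i],
    (* (i) *)
    C2_off_corner V ->
    solves_heat f u0 g0 V ->
    (* (ii) *)
    (forall t : R, 0 < t ->
       ccvg (fun x => V x t) (+oo)%R 0 /\
       exists M : R, forall x : R, 1 <= x -> `|Dx V x t| <= M%:C%C) ->
    (* (iii) *)
    (forall T : R, 0 < T ->
       exists B : R -> R,
         [/\ forall x : R, 0 < x -> 0 < B x,
             (@lebesgue_measure R).-integrable `]0, +oo[ (EFin \o B) &
             forall x t : R, 0 < x -> 0 < t <= T ->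
               `|V x t| ^+ 2 <= (B x)%:C%C /\ `|Dt V x t| ^+ 2 <= (B x)%:C%C]) ->
    forall x t : R, 0 < x -> 0 < t -> V x t = U x t.
Proof.
split; first exact: unified_solves.
move=> V C2 Vsol Vy VB x t x0 t0; apply: eq_part => b.
by rewrite (part_U hu0 hg0 hf hfS hU)// (part_V hg0 hf hfS C2 Vsol Vy VB).
Qed.
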